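(* Consider the linear Gaussian state-space model $x_k = A_k x_{k-1} + q_k$ for $k=1,\dots,T$ and $y_k = C_k x_k + r_k$ for $k=0,\dots,T$, with $x_k\in\mathbb{R}^{n_x}$, $y_k\in\mathbb{R}^{n_y}$, where $q_k\sim\mathcal{N}(0,Q_k)$ and $r_k\sim\mathcal{N}(0,R_k)$ are independent white Gaussian sequences, $x_0\sim\mathcal{N}(0,P_0)$ is independent of them, and $Q_0:=P_0$. Fix weights $\alpha_k\ge 0$ and the cost $\mathcal{C}(\hat x_0,\dots,\hat x_T)=\sum_{k=0}^T\alpha_k\,\mathbb{E}\|x_k-\hat x_k\|^2$. Consider estimators $\hat X_0^T=(\hat x_0,\dots,\hat x_T)$ satisfying (temporal causality) $\hat x_k\sim p_{\hat x_k}(\cdot\mid y_0,\dots,y_k,\hat x_0,\dots,\hat x_{k-1})$ for every $k$, and (perfect perceptual quality) the joint law of $(\hat x_0,\dots,\hat x_T)$ equals the joint law of $(x_0,\dots,x_T)$. Then, among all such estimators, there exists one minimizing $\mathcal{C}$ which is linear and of the form $\hat x_0=J_0$, $\hat x_k=A_k\hat x_{k-1}+J_k$ ($k\ge1$), with $$J_k=\pi_k\mathcal{I}_k+\phi_k\upsilon_k+w_k,$$ where $\pi_k\in\mathbb{R}^{n_x\times n_y}$ and $\phi_k\in\mathbb{R}^{n_x\times (k n_y)}$ are deterministic coefficient matrices, $w_k$ is a zero-mean Gaussian noise independent of everything else (of the observations and of $J_0,\dots,J_{k-1}$) with covariance $\Sigma_{w_k}=Q_k-\pi_kS_k\pi_k^\top-\phi_k\Sigma_{\upsilon_k}\phi_k^\top\succeq0$,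 and $\upsilon_k$ is the unutilized information process $$\upsilon_k=\mathcal{I}_0^{k-1}-\mathbb{E}\big[\mathcal{I}_0^{k-1}\,\big|\,\hat X_0^{k-1}\big],\qquad \upsilon_0=0,$$ with $\mathcal{I}_0^{k-1}=(\mathcal{I}_0,\dots,\mathcal{I}_{k-1})\in\mathbb{R}^{kn_y}$ and $\Sigma_{\upsilon_k}$ the covariance of $\upsilon_k$.
   Context: The innovation process is $\mathcal{I}_k=y_k-C_k\hat x^*_{k|k-1}$, where $\hat x^*_{k|k-1}=\mathbb{E}[x_k\mid y_0,\dots,y_{k-1}]$ (with $\mathcal{I}_0=y_0$), and $S_k$ denotes the covariance of $\mathcal{I}_k$. An estimator is called linear if $(Y_0^T, J_0^T)$, hence $(Y_0^T,\hat X_0^T)$, are jointly Gaussian, where $J_k=\hat x_k-A_k\hat x_{k-1}$, $J_0=\hat x_0$. $\hat X_0^{k-1}=(\hat x_0,\dots,\hat x_{k-1})$. *)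

(* Defs.v *)
From HB Require Import structures.
From mathcomp Require Import all_boot all_order all_algebra.
From mathcomp Require Import all_classical all_reals all_analysis.
Set Implicit Arguments.
Unset Strict Implicit.
Unset Printing Implicit Defensive.
Import Order.TTheory GRing.Theory Num.Theory.
Local Open Scope classical_set_scope.
Local Open Scope ring_scope.

Section defs.
Context {d : measure_display} {Omega : measurableType d} {R : realType}.
Variable P : probability Omega R.

Definition coord {n} (X : Omega -> 'cV[R]_n) (i : 'I_n) : Omega -> R :=
  fun w => X w i 0.
Definition coords {n} (X : Omega -> 'cV[R]_n) : set (Omega -> R) :=
  [set f | exists i : 'I_n, f = coord X i].
Definition rvec_meas {n} (X : Omega -> 'cV[R]_n) :=
  forall i, measurable_fun setT (coord X i).

Definition sigma_of (S : set (Omega -> R)) : set (set Omega) :=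
  <<s [set A | exists f, S f /\ exists B : set R, measurable B /\ A = f @^-1` B] >>.

Definition cexp_version (G : set (set Omega)) (X Z : Omega -> R) :=
  [/\ P.-integrable setT (EFin \o X), P.-integrable setT (EFin \o Z),
      (forall B : set R, measurable B -> G (Z @^-1` B)) &
      forall A, G A ->
        (\int[P]_(w in A) (Z w)%:E = \int[P]_(w in A) (X w)%:E)%E].
Definition cexp_vec (G : set (set Omega)) {n} (X Z : Omega -> 'cV[R]_n) :=
  forall i, cexp_version G (coord X i) (coord Z i).

(* conditional independence of F1 and F2 given G:
   E[1_A | G \/ F2] = E[1_A | G] (a common version exists) for all A in F1 *)
Definition cond_indep (G F1 F2 : set (set Omega)) :=
  forall A, F1 A -> exists Z : Omega -> R,
    cexp_version G (\1_A) Z /\ cexp_version (<<s G `|` F2 >>) (\1_A) Z.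

Definition mutual_indep (Gs : seq (set (set Omega))) :=
  forall A : nat -> set Omega,
    (forall i, (i < size Gs)%N -> nth set0 Gs i (A i)) ->
    P (\big[setI/setT]_(i < size Gs) A i) = (\prod_(i < size Gs) P (A i))%E.

Definition gauss_rv (Z : Omega -> R) (m s2 : R) :=
  [/\ measurable_fun setT Z, 0 <= s2 &
      forall B : set R, measurable B ->
        P (Z @^-1` B) = (if s2 == 0 then (\1_B m)%:E
                         else normal_prob m (Num.sqrt s2) B)].

Definition gauss_vec {n} (X : Omega -> 'cV[R]_n) (m : 'cV[R]_n) (S : 'M[R]_n) :=
  forall u : 'cV[R]_n,
    gauss_rv (fun w => (u^T *m X w) 0 0) ((u^T *m m) 0 0) ((u^T *m S *m u) 0 0).

Definition jointly_gauss (S : set (Omega -> R)) :=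
  forall (fs : seq (Omega -> R)) (cs : seq R), (forall f, f \in fs -> S f) ->
    exists m s2, gauss_rv (fun w => \sum_(i < size fs) cs`_i * nth (fun _ => 0) fs i w) m s2.

Definition covmx {n} (X : Omega -> 'cV[R]_n) : 'M[R]_n :=
  \matrix_(i, j) fine ('E_P[coord X i \* coord X j]
                       - 'E_P[coord X i] * 'E_P[coord X j])%E.

Variables (nx ny T : nat).

Definition model_vars (x : nat -> Omega -> 'cV[R]_nx) (y : nat -> Omega -> 'cV[R]_ny)
  : set (Omega -> R) :=
  [set f | exists j, (j <= T)%N /\ (coords (x j) f \/ coords (y j) f)].

Definition lgss_model (A : nat -> 'M[R]_nx) (C : nat -> 'M[R]_(ny, nx))
  (Q : nat -> 'M[R]_nx) (Rn : nat -> 'M[R]_ny)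
  (x : nat -> Omega -> 'cV[R]_nx) (y : nat -> Omega -> 'cV[R]_ny) :=
  exists (q : nat -> Omega -> 'cV[R]_nx) (r : nat -> Omega -> 'cV[R]_ny),
  [/\ q 0%N = x 0%N,
      (forall k, (1 <= k <= T)%N -> forall w, x k w = A k *m x k.-1 w + q k w),
      (forall k, (k <= T)%N -> forall w, y k w = C k *m x k w + r k w),
      (forall k, (k <= T)%N -> gauss_vec (q k) 0 (Q k) /\ gauss_vec (r k) 0 (Rn k)) &
      mutual_indep ([seq sigma_of (coords (q k)) | k <- iota 0 T.+1]
                    ++ [seq sigma_of (coords (r k)) | k <- iota 0 T.+1])].

(* equality of the joint laws of (xh_0..xh_T) and (x_0..x_T)
   (equality on all measurable rectangles, which generate the product
   sigma-algebra) *)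
Definition same_joint_law (x xh : nat -> Omega -> 'cV[R]_nx) :=
  forall B : nat -> 'I_nx -> set R, (forall j i, measurable (B j i)) ->
    P [set w | forall j i, (j <= T)%N -> B j i (xh j w i 0)]
    = P [set w | forall j i, (j <= T)%N -> B j i (x j w i 0)].

(* admissible estimators: temporal causality and perfect perceptual quality.
   Causality: xh_k is conditionally independent of all states/observations
   given (y_0..y_k, xh_0..xh_{k-1}), i.e. xh_k ~ p(. | y_0^k, xh_0^{k-1}). *)
Definition admissible (x : nat -> Omega -> 'cV[R]_nx) (y : nat -> Omega -> 'cV[R]_ny)
  (xh : nat -> Omega -> 'cV[R]_nx) :=
  [/\ (forall k, (k <= T)%N -> rvec_meas (xh k)),
      (forall k, (k <= T)%N ->
         cond_indep
           (sigma_of [set f | exists j, ((j <= k)%N /\ coords (y j) f)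
                                     \/ ((j < k)%N /\ coords (xh j) f)])
           (sigma_of (coords (xh k)))
           (sigma_of (model_vars x y))) &
      same_joint_law x xh].

Definition cost (alpha : nat -> R) (x xh : nat -> Omega -> 'cV[R]_nx) : \bar R :=
  (\sum_(k < T.+1) (alpha k)%:E *
     \int[P]_w (\sum_(i < nx) (x k w i 0 - xh k w i 0) ^+ 2)%:E)%E.

End defs.

Definition psd {R : realType} {n} (M : 'M[R]_n) :=
  M^T = M /\ forall u : 'cV[R]_n, 0 <= (u^T *m M *m u) 0 0.

(* stacking k vectors of R^n into a vector of R^(k n): (v_0, ..., v_{k-1}) *)
Definition stack {R : realType} {k n} (f : 'I_k -> 'cV[R]_n) : 'cV[R]_(k * n) :=
  (mxvec (\matrix_(j < k) (f j)^T))^T.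

Definition stackp {Omega} {R : realType} {n} (X : nat -> Omega -> 'cV[R]_n) (k : nat)
  : Omega -> 'cV[R]_(k * n) :=
  fun w => stack (fun j : 'I_k => X j w).

(* innovation I_k = y_k - C_k xp_k, with xp_k (a version of) E[x_k | y_0..y_{k-1}],
   and I_0 = y_0 *)
Definition innov {Omega} {R : realType} {nx ny} (C : nat -> 'M[R]_(ny, nx))
  (y : nat -> Omega -> 'cV[R]_ny) (xp : nat -> Omega -> 'cV[R]_nx) (k : nat)
  : Omega -> 'cV[R]_ny :=
  fun w => if k is 0 then y 0 w else y k w - C k *m xp k w.

(* unutilized information upsilon_k = I_0^{k-1} - E[I_0^{k-1} | xh_0^{k-1}],
   with Ec k (a version of) the conditional expectation *)
Definition ups {Omega} {R : realType} {ny} (I : nat -> Omega -> 'cV[R]_ny)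
  (Ec : forall k, Omega -> 'cV[R]_(k * ny)) (k : nat) : Omega -> 'cV[R]_(k * ny) :=
  fun w => stackp I k w - Ec k w.

(* Main.v *)
(** The random vector stacking all q_k and r_k is Gaussian, and every x_k and y_k is a fixed
    matrix applied to it. For an arbitrary admissible estimator, causality forces xh_k to be
    uncorrelated with every linear functional of the model that is orthogonal to y_0..y_k,
    while perfect perceptual quality fixes the second moments of (xh_0..xh_T). The cost thus
    depends only on the cross-covariance M of the estimator with the model: it is affine in M,
    and M ranges over a compact set cut out by a positivity condition and linear equations.
    A maximiser of the linear part is realised by a jointly Gaussian vector, for which
    uncorrelated means independent. Regressing J_k on (I_k, upsilon_k) then leaves a residual
    orthogonal to the whole model and to the earlier residuals, since (I_0..I_k) and the past
    estimates span the same space as (I_k, upsilon_k) and the past estimates. *)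

(* A Gaussian vector is specified here only through the one-dimensional laws of its linear
   functionals, while independence, causality and equality of joint laws speak of rectangles and
   sigma-algebras. The analytic first half crosses this gap: the Cramer-Wold device turns equal
   covariances into equal joint laws, and orthogonality into independence. Nothing is assumed
   invertible: [Q], [Rn] and the optimal joint covariance may all be singular. Gaussian laws
   therefore include Dirac masses, square roots come from a Cholesky factorisation that tolerates
   zero pivots, and projections from pseudo-inverses. A competitor need be neither Gaussian nor
   defined on the same space; it enters only through its cross-covariance with the model noise. In
   the construction all randomness, including that of the estimator, sits in one Gaussian vector
   with the optimal joint covariance, and every random object of the theorem is a matrix applied to
   that vector. *)
Require Import Defs.
From HB Require Import structures.
From mathcomp Require Import all_boot all_order all_algebra.
From mathcomp Require Import all_classical all_reals all_analysis.
From mathcomp Require Import measurable_realfun ring lra zify.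
Import Order.TTheory GRing.Theory Num.Theory.
Import numFieldNormedType.Exports.
Local Open Scope classical_set_scope.
Local Open Scope ring_scope.

Set Implicit Arguments.
Unset Strict Implicit.
Unset Printing Implicit Defensive.

(** * Sums of independent centred Gaussian variables *)

Section lebesgue_affine.
Context {R : realType}.
Local Notation leb := (@lebesgue_measure R).

(** The scaled pushforward has the right value on half-open intervals, and these determine Lebesgue
    measure. *)
Lemma lebesgue_measure_affine (c d : R) (A : set R) : 0 < c -> measurable A ->
  leb A = (c%:E * leb ((fun x => (c * x + d)%R) @^-1` A))%E.
Proof.
move=> c0 mA.
have mf : measurable_fun [set: measurableTypeR R]
    (fun x => c * x + d : measurableTypeR R).
  by apply: measurable_funD => //; exact: measurable_funM.
have := @lebesgue_measure_unique R
  (mscale (PosNum c0)%:num%:nng (pushforward leb (fun x => c * x + d : measurableTypeR R))).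
apply => // _ [[a b] _ <-] /=.
rewrite /mscale/= /pushforward.
have -> : (fun x => c * x + d) @^-1` `]a, b]%classic =
    `](a - d) / c, (b - d) / c]%classic.
  apply/seteqP; split => x /=; rewrite !in_itv/= ltr_pdivrMr // ler_pdivlMr //;
    rewrite ltrBlDr lerBrDr mulrC //.
rewrite !lebesgue_measure_itv/= !lte_fin ltr_pM2r ?invr_gt0// ltrD2r.
case: ifP => _; last by rewrite mule0.
rewrite -!EFinB -EFinM; congr (_%:E).
by field; rewrite gt_eqF.
Qed.

Lemma integral_affine (c d : R) (f : R -> \bar R) : 0 < c ->
  measurable_fun setT f -> (forall x, (0 <= f x)%E) ->
  (\int[leb]_x f x = c%:E * \int[leb]_x f (c * x + d)%R)%E.
Proof.
move=> c0 mf f0.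
have mphi : measurable_fun [set: measurableTypeR R]
    (fun x => c * x + d : measurableTypeR R).
  by apply: measurable_funD => //; exact: measurable_funM.
have -> : (\int[leb]_x f (c * x + d)%R)%E =
    (\int[pushforward leb (fun x => c * x + d : measurableTypeR R)%R]_x f x)%E.
  by rewrite ge0_integral_pushforward.
rewrite -(@ge0_integral_mscale _ _ R _ _ _ (PosNum c0)%:num%:nng)//.
apply: eq_measure_integral => A mA _ /=.
by rewrite /mscale/= -lebesgue_measure_affine.
Qed.

End lebesgue_affine.

(** * Integration against a density *)

Section density.
Context d (T : measurableType d) (R : realType).
Variables (mu nu : {measure set T -> \bar R}) (h : T -> R).
Hypotheses (mh : measurable_fun setT h) (h0 : forall x, 0 <= h x).
Hypothesis nuE : forall A, measurable A -> nu A = (\int[mu]_(x in A) (h x)%:E)%E.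
Import HBNNSimple.

(** Both sides commute with increasing limits, so simple functions suffice; for an indicator the
    identity is [nuE]. *)
Lemma ge0_integral_density (f : T -> \bar R) : measurable_fun setT f ->
  (forall x, (0 <= f x)%E) ->
  (\int[nu]_x f x = \int[mu]_x (f x * (h x)%:E))%E.
Proof.
move=> mf f0.
pose f_ := nnsfun_approx measurableT mf.
transitivity (limn (fun n => \int[nu]_x (f_ n x)%:E))%E.
  rewrite -monotone_convergence//.
  - by apply: eq_integral => y _; apply/esym/cvg_lim => //; exact: cvg_nnsfun_approx.
  - by move=> n; exact/measurable_EFinP.
  - by move=> n x _; rewrite lee_fin.
  - by move=> x _ m n mn; rewrite lee_fin; exact/lefP/nd_nnsfun_approx.
transitivity (limn (fun n => \int[mu]_x ((f_ n x)%:E * (h x)%:E)))%E; last first.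
  rewrite -monotone_convergence//.
  - apply: eq_integral => y _; apply/cvg_lim => //.
    apply: cvgeZr => //; exact: cvg_nnsfun_approx.
  - move=> n; apply: emeasurable_funM; exact/measurable_EFinP.
  - by move=> n x _; rewrite -EFinM lee_fin mulr_ge0.
  - move=> x _ m n mn; rewrite -!EFinM lee_fin ler_wpM2r//.
    exact/lefP/nd_nnsfun_approx.
congr (limn _); apply/funext => n.
under eq_integral do rewrite fimfunE// -fsumEFin//.
rewrite ge0_integral_fsum//; last 2 first.
- by move=> y; exact/measurable_EFinP/measurable_funM.
- by move=> y x _; rewrite nnfun_muleindic_ge0.
under [RHS]eq_integral => x _.
  rewrite fimfunE// -fsumEFin// ge0_mule_fsuml; last first.
    by move=> y; rewrite nnfun_muleindic_ge0.
  over.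
rewrite ge0_integral_fsum//; last 2 first.
- by move=> y; apply: emeasurable_funM; apply/measurable_EFinP => //; exact: measurable_funM.
- by move=> y x _; rewrite mule_ge0 ?nnfun_muleindic_ge0 ?lee_fin.
apply: eq_fsbigr => r _.
rewrite (integralZl_indic _ (fun r => f_ n @^-1` [set r]))//; last first.
  by move=> r0; rewrite preimage_nnfun0.
rewrite integral_indic// setIT nuE//.
(* The sum ranges over all reals, but a negative value is never taken by a nonnegative simple
   function. *)
have [r0|r0] := leP 0 r; last first.
  rewrite preimage_nnfun0// integral_set0 mule0.
  by under eq_integral do rewrite indic0 mulr0 mul0e; rewrite integral0.
under [RHS]eq_integral do rewrite EFinM -muleA.
rewrite ge0_integralZl//=; last 2 first.
- apply: emeasurable_funM; exact/measurable_EFinP.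
- by move=> x _; rewrite -EFinM lee_fin mulr_ge0.
congr (_ * _)%E; rewrite integral_mkcond; apply: eq_integral => x _.
by rewrite patchE indicE; case: ifP; rewrite ?mul1e ?mul0e.
Qed.

End density.

Section gauss_sum.
Context {R : realType}.
Local Notation leb := (@lebesgue_measure R).

Lemma normal_peakE (s : R) : 0 < s ->
  normal_peak s = s^-1 * (Num.sqrt (pi *+ 2))^-1.
Proof.
move=> s0; rewrite /normal_peak -mulrnAr sqrtrM ?sqr_ge0// sqrtr_sqr gtr0_norm//.
by rewrite invfM.
Qed.

(* Completing the square in x. *)
Lemma normal_pdf_mul (s t x z : R) : 0 < s -> 0 < t ->
  let n := Num.sqrt (s ^+ 2 + t ^+ 2) in
  normal_pdf 0 s x * normal_pdf 0 t (z - x) =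
  normal_pdf 0 n z * normal_pdf (z * s ^+ 2 / n ^+ 2) (s * t / n) x.
Proof.
move=> s0 t0 n.
have n2 : n ^+ 2 = s ^+ 2 + t ^+ 2 by rewrite sqr_sqrtr// addr_ge0// sqr_ge0.
have n0 : 0 < n by rewrite sqrtr_gt0 addr_gt0// exprn_gt0.
have [sN tN nN] : [/\ s != 0, t != 0 & n != 0] by rewrite !gt_eqF.
rewrite !normal_pdfE ?mulf_neq0 ?invr_neq0//.
rewrite mulrACA [RHS]mulrACA -!expRD; congr (_ * expR _).
  rewrite !normal_peakE ?divr_gt0 ?mulr_gt0//; field.
  by rewrite sN tN nN gt_eqF// sqrtr_gt0 mulrn_wgt0// pi_gt0.
suff : - (x - 0) ^+ 2 / (s ^+ 2 *+ 2) + - (z - x - 0) ^+ 2 / (t ^+ 2 *+ 2) =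
  - (z - 0) ^+ 2 / (n ^+ 2 *+ 2) +
  - (x - z * s ^+ 2 / n ^+ 2) ^+ 2 / ((s ^+ 2 * t ^+ 2 / n ^+ 2) *+ 2).
  by move=> ->; rewrite -exprVn -!exprMn.
rewrite n2; field; rewrite sN tN/= gt_eqF// addr_gt0// exprn_gt0 -?topredE//.
all: by rewrite exprn_gt0.
Qed.

Lemma ge0_integral_normal (m s : R) (f : R -> \bar R) : measurable_fun setT f ->
  (forall x, (0 <= f x)%E) ->
  (\int[normal_prob m s]_x f x = \int[leb]_x (f x * (normal_pdf m s x)%:E))%E.
Proof.
move=> mf f0; apply: ge0_integral_density => //.
  exact: measurable_normal_pdf.
by move=> x; exact: normal_pdf_ge0.
Qed.

(** The left side is a double integral of [g]. After exchanging the integrals and completing the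
    square, the inner integrand is a normal density in x of total mass 1, and the density of the sum
    in z factors out. *)
Lemma normal_prob_convolution (s t : R) (B : set R) : 0 < s -> 0 < t ->
  measurable B ->
  (normal_prob 0%R s \x normal_prob 0%R t)%E [set z | B (z.1 + z.2)] =
  normal_prob 0 (Num.sqrt (s ^+ 2 + t ^+ 2)) B.
Proof.
move=> s0 t0 mB.
rewrite /product_measure1/=.
pose g (x z : R) := (\1_B z * normal_pdf 0 t (z - x) * normal_pdf 0 s x)%:E : \bar R.
have mg : measurable_fun setT (fun xz : R * R => g xz.1 xz.2).
  apply/measurable_EFinP; apply: measurable_funM; last first.
    by apply: measurableT_comp => //; exact: measurable_normal_pdf.
  apply: measurable_funM; first exact: measurableT_comp.
  apply: measurableT_comp; first exact: measurable_normal_pdf.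
  exact: measurable_funB.
have g0 x z : (0 <= g x z)%E.
  by rewrite lee_fin !mulr_ge0// normal_pdf_ge0.
have mBx x : measurable [set y | B (x + y)].
  rewrite -[X in measurable X]setTI; apply: (measurable_funD _ _) => //.
transitivity (\int[leb]_x \int[leb]_z g x z)%E.
  rewrite ge0_integral_normal//; last first.
    rewrite -/(_ \o _); apply: measurable_fun_xsection.
    rewrite -[X in measurable X]setTI; apply: (measurable_funD _ _) => //.
  apply: eq_integral => x _ /=.
  have -> : xsection [set z | B (z.1 + z.2)] x = [set y | B (x + y)].
    by apply/seteqP; split => y; rewrite /xsection/= inE.
  under [RHS]eq_integral do rewrite /g EFinM.
  rewrite ge0_integralZr//; last 3 first.
  - apply/measurable_EFinP; apply: measurable_funM => //.
    apply: measurableT_comp; first exact: measurable_normal_pdf.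
    exact: measurable_funB.
  - by move=> z _; rewrite lee_fin mulr_ge0// normal_pdf_ge0.
  - by rewrite lee_fin normal_pdf_ge0.
  congr (_ * _)%E.
  (* The substitution z = x + y, as the slope-one affine change of variable. *)
  rewrite (@integral_affine _ 1 x)//; last 2 first.
  - apply/measurable_EFinP; apply: measurable_funM => //.
    apply: measurableT_comp; first exact: measurable_normal_pdf.
    exact: measurable_funB.
  - by move=> z; rewrite lee_fin mulr_ge0// normal_pdf_ge0.
  rewrite mul1e /normal_prob integral_mkcond; apply: eq_integral => y _.
  rewrite patchE mul1r addrK addrC indicE.
  have -> : (y \in [set y | B (x + y)]) = (x + y \in B) by apply/idP/idP; rewrite !inE.
  by case: ifP; rewrite ?mul1r ?mul0r.
rewrite (@fubini_tonelli _ _ (measurableTypeR R) (measurableTypeR R) R leb leb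
  (fun xz => g xz.1 xz.2) mg (fun xz => g0 xz.1 xz.2)) /=.
rewrite /normal_prob [RHS]integral_mkcond; apply: eq_integral => z _.
rewrite patchE /g.
under eq_integral do rewrite -mulrA [X in _ * X]mulrC normal_pdf_mul// mulrA EFinM.
rewrite ge0_integralZl//; last 3 first.
- by apply/measurable_EFinP; exact: measurable_normal_pdf.
- by move=> x _; rewrite lee_fin normal_pdf_ge0.
- by rewrite lee_fin mulr_ge0// normal_pdf_ge0.
by rewrite integral_normal_pdf mule1 indicE; case: ifP; rewrite ?mul1r ?mul0r.
Qed.

(** Zero variances need their own argument, because [gauss_rv] then means a Dirac mass, which has no
    density to convolve. *)
Lemma gauss_rv_add d (T : measurableType d) (P : probability T R)
    (f g : T -> R) (a b : R) :
  gauss_rv P f 0 a -> gauss_rv P g 0 b ->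
  (forall B D : set R, measurable B -> measurable D ->
    P (f @^-1` B `&` g @^-1` D) = (P (f @^-1` B) * P (g @^-1` D))%E) ->
  gauss_rv P (f \+ g) 0 (a + b).
Proof.
move=> [mf a0 fE] [mg b0 gE] indep.
have mfg : measurable_fun setT (f \+ g) by exact: measurable_funD.
split; [exact: mfg|exact: addr_ge0|].
(* A variable with law Dirac at 0 vanishes off a null event, so adding it changes no probability. *)
have degen (u v : T -> R) (c : R) : measurable_fun setT u -> measurable_fun setT v ->
    (forall B : set R, measurable B -> P (u @^-1` B) = (\1_B 0)%:E :> \bar R) ->
    forall B : set R, measurable B -> P ((u \+ v) @^-1` B) = P (v @^-1` B).
  move=> mu mv uE B mB.
  have mpre (h : T -> R) (C : set R) : measurable_fun setT h -> measurable C -> measurable (h @^-1` C).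
    by move=> mh mC; rewrite -[X in measurable X]setTI; exact: mh.
  have N0 : P (u @^-1` (~` [set 0])) = 0%E.
    rewrite uE; last exact: measurableC.
    by rewrite indicE memNset// => /(_ erefl).
  have mN : measurable (u @^-1` (~` [set 0])) by apply: mpre => //; exact: measurableC.
  have null (C : set T) : measurable C -> P C = P (C `\` u @^-1` (~` [set 0])).
    move=> mC; rewrite measureD//; last first.
      by rewrite (le_lt_trans (probability_le1 _ _))// ltry.
    rewrite -[LHS]sube0; congr (_ - _)%E; apply/esym.
    by apply: (subset_measure0 (mu := P) _ mN) => //; exact: measurableI.
  rewrite (null ((u \+ v) @^-1` B)) ?(null (v @^-1` B)); last 2 first.
  - exact: mpre.
  - by apply: mpre => //; exact: measurable_funD.
  congr (P _); apply/seteqP; split => w /= [] Bw /contrapT u0; split => //.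
  - by move: Bw; rewrite u0 add0r.
  - by rewrite u0 add0r.
move=> B mB.
have [a_eq0|a_neq0] := eqVneq a 0.
  rewrite a_eq0 add0r -gE//; apply: degen => // D mD.
  by rewrite fE// a_eq0 eqxx.
have [b_eq0|b_neq0] := eqVneq b 0.
  rewrite b_eq0 addr0 (negbTE a_neq0).
  have -> : f \+ g = g \+ f by apply/funext => w; rewrite /= addrC.
  rewrite degen //; last by move=> D mD; rewrite gE// b_eq0 eqxx.
  by rewrite fE// (negbTE a_neq0).
have a_gt0 : 0 < a by rewrite lt_neqAle eq_sym a_neq0.
have b_gt0 : 0 < b by rewrite lt_neqAle eq_sym b_neq0.
rewrite gt_eqF ?addr_gt0//.
have mpair : measurable_fun setT (fun w => (f w, g w)) by exact: measurable_fun_pair.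
have mS : measurable [set z : R * R | B (z.1 + z.2)].
  by rewrite -[X in measurable X]setTI; apply: (measurable_funD _ _).
have mpair' : measurable_fun setT
  (fun w => (f w, g w) : measurableTypeR R * measurableTypeR R) by exact: mpair.
have -> : P ((f \+ g) @^-1` B) = (normal_prob 0%R (Num.sqrt a) \x
    normal_prob 0%R (Num.sqrt b))%E [set z | B (z.1 + z.2)].
  (* Independence gives the law of the pair on rectangles, and these determine the product
     measure. *)
  apply/esym; apply: (@product_measure_unique _ _ (measurableTypeR R)
    (measurableTypeR R) R (normal_prob 0%R (Num.sqrt a))
    (normal_prob 0%R (Num.sqrt b)) (pushforward P
      (fun w => (f w, g w) : measurableTypeR R * measurableTypeR R)) _ _ mS).
  move=> D E mD mE; rewrite /= /pushforward.
  have := indep _ _ mD mE; rewrite fE// gE// (negbTE a_neq0) (negbTE b_neq0) => <-.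
  by congr (P _); apply/seteqP; split.
have sa : 0 < Num.sqrt a by rewrite sqrtr_gt0.
have sb : 0 < Num.sqrt b by rewrite sqrtr_gt0.
rewrite (normal_prob_convolution sa sb mB) (sqr_sqrtr a0) (sqr_sqrtr b0).
by [].
Qed.

(** For positive [c] this is a change of variable in the density; a negative [c] is reduced to it by
    the symmetry of the centred normal law. *)
Lemma gauss_rv_scale d (T : measurableType d) (P : probability T R)
    (f : T -> R) (a c : R) :
  gauss_rv P f 0 a -> gauss_rv P (fun w => c * f w) 0 (c ^+ 2 * a).
Proof.
move=> [mf a0 fE]; split.
- exact: measurable_funM.
- by rewrite mulr_ge0// sqr_ge0.
have [a_eq0|a_neq0] := eqVneq a 0.
  move=> B mB; rewrite a_eq0 mulr0 eqxx.
  have mcB : measurable (( *%R c) @^-1` B).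
    by rewrite -[X in measurable X]setTI; exact: mulrl_measurable.
  have := fE _ mcB; rewrite a_eq0 eqxx => fE'.
  rewrite [LHS]fE'; congr (_%:E); rewrite !indicE.
  suff -> : (0 \in (( *%R c) @^-1` B)) = (0 \in B) by [].
  by apply/idP/idP; rewrite !inE/= mulr0.
have a_gt0 : 0 < a by rewrite lt_neqAle eq_sym a_neq0.
have pos (e : R) (g : T -> R) : 0 < e -> measurable_fun setT g ->
    (forall B : set R, measurable B -> P (g @^-1` B) = normal_prob 0 (Num.sqrt a) B) ->
    forall B : set R, measurable B ->
      P ((fun w => e * g w) @^-1` B) = normal_prob 0 (Num.sqrt (e ^+ 2 * a)) B.
  move=> e0 mg gE B mB.
  have meB : measurable (( *%R e) @^-1` B).
    by rewrite -[X in measurable X]setTI; exact: mulrl_measurable.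
  rewrite [LHS](gE _ meB) /normal_prob [RHS]integral_mkcond [LHS]integral_mkcond.
  rewrite (@integral_affine _ e 0 (_ \_ B))//; last 2 first.
  - apply/measurable_restrict => //; rewrite setTI.
    by apply/measurable_EFinP/measurable_funTS; exact: measurable_normal_pdf.
  - by move=> x; rewrite patchE; case: ifP => // _; rewrite lee_fin normal_pdf_ge0.
  have sa0 : 0 < Num.sqrt a by rewrite sqrtr_gt0.
  rewrite -ge0_integralZl//; last 3 first.
  - apply: (measurableT_comp (f := (_ \_ B))).
      apply/measurable_restrict => //; rewrite setTI.
      by apply/measurable_EFinP/measurable_funTS; exact: measurable_normal_pdf.
    by apply: measurable_funD => //; exact: mulrl_measurable.
  - by move=> x _; rewrite patchE; case: ifP => // _; rewrite lee_fin normal_pdf_ge0.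
  - by rewrite lee_fin ltW.
  apply: eq_integral => x _; rewrite !patchE addr0.
  have -> : (x \in ( *%R e) @^-1` B) = (e * x \in B) by apply/idP/idP; rewrite !inE.
  case: ifP => _; last by rewrite mule0.
  rewrite -EFinM; congr (_%:E).
  rewrite sqrtrM ?sqr_ge0// sqrtr_sqr gtr0_norm//.
  rewrite !normal_pdfE ?mulf_neq0 ?gt_eqF//.
  rewrite !normal_peakE ?mulr_gt0// mulrA; congr (_ * expR _).
    (* The exponents agree because the factor e^2 cancels between the scaled argument and the scaled
       variance. *)
    by field; rewrite !gt_eqF// sqrtr_gt0 mulrn_wgt0// pi_gt0.
  by field; rewrite !gt_eqF.
have [c_eq0|c_neq0] := eqVneq c 0.
  move=> B mB; rewrite c_eq0 expr0n/= mul0r eqxx.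
  have -> : (fun w => 0 * f w) @^-1` B = (cst 0) @^-1` B.
    by apply/seteqP; split => w /=; rewrite mul0r.
  rewrite preimage_cst indicE; case: ifP => _.
    by rewrite probability_setT.
  by rewrite measure0.
rewrite mulf_eq0 (negbTE a_neq0) sqrf_eq0 (negbTE c_neq0)/= => B mB.
have [c_lt0|c_gt0|/esym c0] := ltgtP c 0; last by rewrite c0 eqxx in c_neq0.
  have -> : (fun w => c * f w) @^-1` B = (fun w => - c * - f w) @^-1` B.
    by apply/seteqP; split => w /=; rewrite mulrNN.
  rewrite -sqrrN (pos (- c) (fun w => - f w))//.
  - by rewrite oppr_gt0.
  - exact: measurableT_comp.
  move=> D mD.
  have mND : measurable (-%R @^-1` D) by rewrite -[X in measurable X]setTI; exact: oppr_measurable.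
  rewrite [LHS](fE _ mND) (negbTE a_neq0) /normal_prob.
  have mphi : measurable_fun [set: measurableTypeR R] (-%R : _ -> measurableTypeR R).
    exact: oppr_measurable.
  transitivity (\int[pushforward leb (-%R : _ -> measurableTypeR R)]_(x in D)
     (normal_pdf 0 (Num.sqrt a) x)%:E)%E.
    rewrite ge0_integral_pushforward; [|exact: mphi|exact: mD| |].
    - apply: eq_integral => x _ /=; rewrite !normal_pdfE ?gt_eqF ?sqrtr_gt0//.
      by rewrite /normal_fun !subr0 sqrrN.
    - by apply/measurable_EFinP/measurable_funTS; exact: measurable_normal_pdf.
    - by move=> x _; rewrite lee_fin normal_pdf_ge0.
  by apply: eq_measure_integral => A mA _; exact: lebesgue_measureN.
by apply: pos => // D mD; rewrite fE// (negbTE a_neq0).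
Qed.

End gauss_sum.

(** * The Cramer-Wold device *)

Section indicator_approximation.
Context {R : realType}.

Lemma bernoulli_ge (x : R) m : -1 <= x -> 1 + m%:R * x <= (1 + x) ^+ m.
Proof.
move=> x1; elim: m => [|m IH]; first by rewrite mul0r addr0 expr0.
rewrite exprS; apply: (@le_trans _ _ ((1 + x) * (1 + m%:R * x))).
  rewrite -[m.+1]addn1 natrD; have := mulr_ge0 (ler0n R m) (sqr_ge0 x); nra.
by rewrite ler_wpM2l//; lra.
Qed.

(** With y = z^2 the sequence is (n z^n) z^n. Bernoulli applied to z^-n bounds the first factor by 1
    / (z^-1 - 1), and the second tends to 0. *)
Lemma cvg_natmul_expr (y : R) : 0 <= y -> y < 1 ->
  n%:R * y ^+ n @[n --> \oo] --> (0 : R).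
Proof.
move=> y0 y1.
have [->|yneq0] := eqVneq y 0.
  apply: cvg_near_cst; near=> n; rewrite expr0n.
  suff -> : (n == 0)%N = false by rewrite mulr0.
  by apply/negbTE; rewrite -lt0n; near: n; exists 1%N.
have ygt0 : 0 < y by rewrite lt_neqAle eq_sym yneq0.
pose z := Num.sqrt y.
have z0 : 0 < z by rewrite sqrtr_gt0.
have z1 : z < 1 by rewrite -sqrtr1 ltr_sqrt.
have k0 : 0 < z^-1 - 1 by rewrite subr_gt0 invf_gt1.
have zn : z ^+ n @[n --> \oo] --> (0 : R).
  by apply: cvg_expr; rewrite gtr0_norm.
apply: (@squeeze_cvgr _ _ _ _ (fun=> 0) (fun n => (z^-1 - 1)^-1 * z ^+ n)).
- near=> n; rewrite mulr_ge0 ?exprn_ge0//=.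
  have -> : y = z * z by rewrite -expr2 sqr_sqrtr.
  rewrite exprMn mulrA ler_wpM2r ?exprn_ge0 ?(ltW z0)//.
  rewrite -[leRHS]mul1r ler_pdivlMr// mulrAC.
  rewrite -ler_pdivlMr ?exprn_gt0// mul1r -exprVn.
  apply: (@le_trans _ _ (1 + n%:R * (z^-1 - 1))); first by rewrite lerDr.
  apply: le_trans (bernoulli_ge _ _) _; first by lra.
  by rewrite addrC subrK.
- exact: cvg_cst.
- by rewrite -[X in _ --> X](mulr0 (z^-1 - 1)^-1); apply: cvgM => //; exact: cvg_cst.
Unshelve. all: end_near. Qed.

(* The exponent n 2^n puts the threshold at r = 1/2, and makes the limit 0 there. *)
Lemma cvg_threshold (r : R) : 0 <= r <= 1 ->
  (1 - r ^+ n) ^+ (n * 2 ^ n)%N @[n --> \oo] --> ((r < 2^-1)%R%:R : R).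
Proof.
move=> /andP[r0 r1]; have rn n : 0 <= r ^+ n <= 1 by rewrite exprn_ge0// exprn_ile1.
case: ltP => r2 /=.
  have y1 : 2 * r < 1 by lra.
  have := cvg_natmul_expr (mulr_ge0 (ler0n _ 2) r0) y1 => h.
  apply: (@squeeze_cvgr _ _ _ _ (fun n => 1 - n%:R * (2 * r) ^+ n) (fun=> 1)).
  - near=> n; apply/andP; split; last first.
      by rewrite exprn_ile1// ?subr_ge0; have := rn n; lra.
    have := @bernoulli_ge (- r ^+ n) (n * 2 ^ n)%N.
    have /andP[a b] := rn n; rewrite lerN2 => /(_ b).
    by rewrite natrM natrX mulrN -mulrA exprMn.
  - by rewrite -[X in _ --> X]subr0; apply: cvgB => //; exact: cvg_cst.
  - exact: cvg_cst.
apply: (@squeeze_cvgr _ _ _ _ (fun=> 0) (fun n => n.+1%:R^-1)).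
- near=> n; apply/andP; split.
    by rewrite exprn_ge0// subr_ge0; have := rn n; lra.
  have x0 : 0 < (2^-1 : R) ^+ n by rewrite exprn_gt0.
  have x1 : (2^-1 : R) ^+ n <= r ^+ n by rewrite lerXn2r ?nnegrE ?invr_ge0.
  have x2 : 1 + (2^-1 : R) ^+ n != 0 by rewrite gt_eqF// addr_gt0.
  apply: (@le_trans _ _ ((1 + 2^-1 ^+ n)^-1 ^+ (n * 2 ^ n)%N)).
    rewrite lerXn2r ?nnegrE ?subr_ge0 ?invr_ge0 ?addr_ge0//; try by have := rn n; lra.
    rewrite -[leRHS]mul1r ler_pdivlMr ?addr_gt0//.
    have := rn n; nra.
  rewrite exprVn lef_pV2 ?posrE ?exprn_gt0// ?addr_gt0//.
  apply: le_trans (bernoulli_ge _ _); last by lra.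
  by rewrite natrM natrX -mulrA -exprMn divff// expr1n mulr1 -natr1 addrC.
- exact: cvg_cst.
- exact: cvg_harmonic.
Unshelve. all: end_near. Qed.

End indicator_approximation.

(** * A monotone class argument starting from cosines *)

Section bounded_class.
Context {R : realType} (E : Type) (H : set (E -> R)) (phi : E -> R).
Hypothesis Hlin : forall a b f g, H f -> H g -> H (fun e => a * f e + b * g e).
Hypothesis Hlim : forall (f_ : nat -> E -> R) (f : E -> R) (M : R), (forall n, H (f_ n)) ->
  (forall n e, `|f_ n e| <= M) -> (forall e, f_ n e @[n --> \oo] --> f e) -> H f.
Hypothesis Hbnd : forall f, H f -> exists M : R, forall e, `|f e| <= M.
Hypothesis Hcos : forall f a s, H f -> H (fun e => f e * cos (a * phi e + s)).

Let Heq f g : H f -> f =1 g -> H g.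
Proof. by move=> Hf /funext <-. Qed.

Let bnd_mul f (q : nat -> E -> R) (l : E -> R) : H f ->
  (forall n, H (fun e => f e * q n e)) -> (forall n e, 0 <= q n e <= 1) ->
  (forall e, q n e @[n --> \oo] --> l e) -> H (fun e => f e * l e).
Proof.
move=> Hf Hfq q01 ql; have [M fM] := Hbnd Hf.
apply: (Hlim (f_ := fun n e => f e * q n e) (M := M)) => //.
- move=> n e; rewrite normrM; apply: le_trans (fM e).
  by rewrite ler_piMr// ger0_norm; have /andP[] := q01 n e.
- by move=> e; apply: cvgM => //; exact: cvg_cst.
Qed.

(** The class is stable under multiplication by polynomials in a sine, and the threshold polynomials
    in r = (1 - sin) / 2 converge boundedly to the indicator of r < 1/2, that is, of a positive
    sine. *)
Let H_sin_gt0 f t a : H f -> H (fun e => f e * (0 < sin (t * (phi e - a)))%R%:R).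
Proof.
move=> Hf; pose r e : R := (1 - sin (t * (phi e - a))) / 2.
have r01 e : 0 <= r e <= 1.
  by have := sin_le1 (t * (phi e - a)); have := sin_geN1 (t * (phi e - a)); rewrite /r; lra.
have Hr g : H g -> H (fun e => g e * r e).
  (* The phase shift by pi / 2 turns the available cosine into the wanted sine. *)
  move=> Hg; apply: Heq (Hlin 2^-1 (- 2^-1) Hg (Hcos t (- (t * a) - pi / 2) Hg)) _ => e.
  rewrite /r mulrBr addrA cosBpihalf; lra.
have Hrn n g : H g -> H (fun e => g e * r e ^+ n).
  elim: n g => [|n IH] g Hg; first by apply: Heq Hg _ => e; rewrite expr0 mulr1.
  by apply: Heq (IH _ (Hr _ Hg)) _ => e; rewrite exprS mulrA.
have Hq n m g : H g -> H (fun e => g e * (1 - r e ^+ n) ^+ m).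
  elim: m g => [|m IH] g Hg; first by apply: Heq Hg _ => e; rewrite expr0 mulr1.
  apply: Heq (IH _ (Hlin 1 (-1) Hg (Hrn n _ Hg))) _ => e.
  by rewrite [in RHS]exprS [in RHS]mulrA mul1r mulN1r [g e * (1 - _)]mulrDr mulr1 mulrN.
apply: (bnd_mul (q := fun n e => (1 - r e ^+ n) ^+ (n * 2 ^ n)%N)) => //.
- by move=> n; exact: Hq.
- move=> n e; have /andP[r0 r1] := r01 e.
  have h : 0 <= 1 - r e ^+ n <= 1.
    by rewrite subr_ge0 exprn_ile1//= gerBl exprn_ge0.
  by have /andP[h0 h1] := h; rewrite exprn_ge0// exprn_ile1.
- move=> e; have := cvg_threshold (r01 e).
  suff -> : (r e < 2^-1) = (0 < sin (t * (phi e - a))) by [].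
  by rewrite /r; apply/idP/idP; lra.
Qed.

(** At frequency 1 / (n + 1) the argument of the sine eventually lies in (-pi, pi), where the sine
    has the sign of [phi e - a]. Letting the period grow removes the periodicity. *)
Let H_gt f a : H f -> H (fun e => f e * (a < phi e)%R%:R).
Proof.
move=> Hf; apply: (bnd_mul (q := fun n e => (0 < sin (n.+1%:R^-1 * (phi e - a)))%R%:R)) => //.
- by move=> n; exact: H_sin_gt0.
- by move=> n e; case: (_ < _); rewrite /= ?lexx ?ler01.
move=> e; apply: cvg_near_cst.
have := @cvg_harmonic R => /cvgrPdist_lt.
pose x := phi e - a.
have x1 : 0 < `|x| + 1 by rewrite ltr_wpDl.
(* The added 1 keeps the tolerance finite when x = 0. *)
move=> /(_ (pi / (`|x| + 1))); rewrite divr_gt0 ?pi_gt0// => /(_ isT).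
apply: filterS => n; rewrite sub0r normrN ger0_norm ?invr_ge0// => hn.
have hx : n.+1%:R^-1 * `|x| < pi.
  move: hn; rewrite ltr_pdivlMr// => hn; apply: le_lt_trans hn.
  by rewrite ler_pM2l ?invr_gt0// lerDl.
have n0 : 0 < (n.+1%:R : R)^-1 by rewrite invr_gt0.
rewrite -/x -[a < _]subr_gt0 -/x; congr ((nat_of_bool _)%:R).
have [x0|x0] := ltP 0 x.
  rewrite gtr0_norm in hx => //.
  have -> // : 0 < sin (n.+1%:R^-1 * x) by apply: sin_gt0_pi; rewrite mulr_gt0.
apply/negbTE; rewrite -leNgt -[_ * x]opprK sinN oppr_le0.
apply: sin_ge0_pi; rewrite -mulrN mulr_ge0 ?(ltW n0) ?oppr_ge0//=.
by apply: ltW; rewrite ler0_norm in hx.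
Qed.

(** Open half-lines form a pi-system generating the Borel sets. Complements come from linearity,
    disjoint unions from bounded limits of finite unions. *)
Lemma bounded_class_indic f (B : set R) : measurable B -> H f ->
  H (fun e => f e * \1_B (phi e)).
Proof.
move=> mB Hf.
pose PP (B : set R) := H (fun e => f e * \1_B (phi e)).
refine (@dynkin_induction _ (measurableTypeR R) (@RGenOInfty.G R) PP _ _ _ _ _ _ B _).
- exact: RGenOInfty.measurableE.
- move=> _ _ [x ->] [y ->]; exists (Num.max x y).
  by apply/seteqP; split => z /=; rewrite !in_itv/= !andbT gt_max => /andP.
- by apply: Heq Hf _ => e; rewrite indicT mulr1.
- move=> _ [x ->]; apply: Heq (H_gt x Hf) _ => e.
  by rewrite indicE mem_setE in_itv/= andbT.
- move=> S mS HS; apply: Heq (Hlin 1 (-1) Hf HS) _ => e.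
  by rewrite !indicE in_setC; case: (_ \in _) => /=; ring.
- move=> F mF tF HF.
  (* Pointwise, the indicators of the partial unions are eventually constant. *)
  apply: (bnd_mul (q := fun n e => \1_(\big[setU/set0]_(i < n) F i) (phi e))) => //.
  + elim=> [|n IH].
      by apply: Heq (Hlin 0 0 Hf Hf) _ => e; rewrite big_ord0 indic0 mulr0 !mul0r addr0.
    apply: Heq (Hlin 1 1 IH (HF n)) _ => e; rewrite !mul1r -mulrDr.
    congr (_ * _); rewrite !indicE big_ord_recr/= in_setU.
    case: (boolP (_ \in F n)) => [Fn|_]; last by rewrite orbF addr0.
    case: (boolP (_ \in \big[setU/set0]_(i < n) F i)) => [|_]; last by rewrite orbT add0r.
    rewrite inE -bigcup_mkord => -[k /= kn Fk]; move: Fn; rewrite inE => Fn.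
    have kE : k = n by apply: tF => //; exists (phi e).
    by rewrite kE ltnn in kn.
  + by move=> n e; rewrite indicE; case: (_ \in _); rewrite /= ?lexx ?ler01.
  + move=> e; apply: cvg_near_cst.
    have [[k _ Fk]|nF] := pselect ((\bigcup_k F k) (phi e)).
      exists k.+1 => // n /= kn; rewrite !indicE !mem_set//; first by exists k.
      by rewrite -bigcup_mkord; exists k.
    near=> n; rewrite !indicE (memNset nF) memNset//.
    by rewrite -bigcup_mkord => -[k /= _ Fk]; apply: nF; exists k.
- suff : (@RGenOInfty.G R).-sigma.-measurable B by [].
  by rewrite -RGenOInfty.measurableE.
Unshelve. all: end_near. Qed.
End bounded_class.

Section cramer_wold.
Context {R : realType} d d' (T : measurableType d) (T' : measurableType d').
Variables (P : probability T R) (P' : probability T' R).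

Lemma eq_law_integral (Z : T -> R) (Z' : T' -> R) (f : R -> R) :
  measurable_fun setT Z -> measurable_fun setT Z' ->
  (forall B : set R, measurable B -> P (Z @^-1` B) = P' (Z' @^-1` B)) ->
  measurable_fun setT f -> (forall x, 0 <= f x) ->
  (\int[P]_w (f (Z w))%:E = \int[P']_w (f (Z' w))%:E)%E.
Proof.
move=> mZ mZ' ZZ' mf f0.
have mf' : measurable_fun setT (fun x : R => (f x)%:E) by exact/measurable_EFinP.
transitivity (\int[pushforward P Z]_x (f x)%:E)%E.
  by rewrite ge0_integral_pushforward// => x _; rewrite lee_fin.
transitivity (\int[pushforward P' Z']_x (f x)%:E)%E.
  by apply: eq_measure_integral => A mA _; exact: ZZ'.
by rewrite ge0_integral_pushforward// => x _; rewrite lee_fin.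
Qed.

Variables (X : nat -> T -> R) (X' : nat -> T' -> R) (n : nat).
Hypothesis mX : forall i, measurable_fun setT (X i).
Hypothesis mX' : forall i, measurable_fun setT (X' i).
Hypothesis XX' : forall (c : nat -> R) (B : set R), measurable B ->
  P ((fun w => \sum_(i < n) c i * X i w) @^-1` B) =
  P' ((fun w => \sum_(i < n) c i * X' i w) @^-1` B).

Let measurable_comb d0 (U : measurableType d0) (Y : nat -> U -> R) (c : nat -> R) :
  (forall i, measurable_fun setT (Y i)) ->
  measurable_fun setT (fun w => \sum_(i < n) c i * Y i w).
Proof.
move=> mY; apply: measurable_sum => i.
exact: measurable_funM.
Qed.

Let cosE (a b : R) : cos a * cos b = 2^-1 * cos (a + b) + 2^-1 * cos (a - b).
Proof. by rewrite cosD cosB; lra. Qed.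

(** The free cosine factor is built in so that the class is stable under multiplication by cosines:
    the product-to-sum formula only changes [c] and [t]. *)
Let H : set ((nat -> R) -> R) := [set h : (nat -> R) -> R | [/\ exists M : R, forall e, `|h e| <= M,
  measurable_fun setT (fun w => h (X ^~ w)),
  measurable_fun setT (fun w => h (X' ^~ w)) &
  forall (c : nat -> R) (t : R),
   (\int[P]_w (h (X ^~ w) * cos (\sum_(i < n) c i * X i w + t))%:E =
    \int[P']_w (h (X' ^~ w) * cos (\sum_(i < n) c i * X' i w + t))%:E)%E]].

Let mcos d0 (U : measurableType d0) (Y : nat -> U -> R) (c : nat -> R) (t : R) :
  (forall i, measurable_fun setT (Y i)) ->
  measurable_fun setT (fun w => cos (\sum_(i < n) c i * Y i w + t)).
Proof.
move=> mY; apply: measurableT_comp.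
  by apply: continuous_measurable_fun; exact: continuous_cos.
by apply: measurable_funD => //; exact: measurable_comb.
Qed.

(** Equality of the laws of the linear forms is available for nonnegative integrands only, so 1 is
    added to the cosine and subtracted after integration. *)
Let H1 : H (fun=> 1).
Proof.
split=> //; first by exists 1 => e; rewrite normr1.
move=> c t.
have int1 d0 (U : measurableType d0) (Q : probability U R) (Y : nat -> U -> R) :
    (forall i, measurable_fun setT (Y i)) ->
    (\int[Q]_w (1 * cos (\sum_(i < n) c i * Y i w + t))%:E =
     \int[Q]_w (cos (\sum_(i < n) c i * Y i w + t) + 1)%:E - 1)%E.
  move=> mY; have m := mcos c t mY.
  have i1 : Q.-integrable setT (EFin \o fun w => cos (\sum_(i < n) c i * Y i w + t)).
    apply: measurable_bounded_integrable => //.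
      by rewrite (le_lt_trans (probability_le1 _ _))// ltry.
    exists 1; split; rewrite ?num_real// => x x1 w _; apply: le_trans (ltW x1).
    by rewrite ler_norml cos_geN1 cos_le1.
  transitivity (\int[Q]_w (cos (\sum_(i < n) c i * Y i w + t))%:E + 1 - 1)%E.
    by rewrite addeK//; apply: eq_integral => w _; rewrite mul1r.
  congr (_ - 1)%E; under [RHS]eq_integral do rewrite EFinD.
  rewrite integralD//=; last exact: finite_measure_integrable_cst.
  congr (_ + _)%E; apply/esym; apply: etrans (integral_cst Q measurableT 1%:E) _.
  by rewrite mul1e; exact: probability_setT.
rewrite !int1//; congr (_ - 1)%E.
apply: (@eq_law_integral (fun w => \sum_(i < n) c i * X i w)
  (fun w => \sum_(i < n) c i * X' i w) (fun x => cos (x + t) + 1)).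
- exact: measurable_comb.
- exact: measurable_comb.
- exact: XX'.
- apply: measurable_funD => //; apply: measurableT_comp; last exact: measurable_funD.
  by apply: continuous_measurable_fun; exact: continuous_cos.
- by move=> x; rewrite -lerBlDr sub0r cos_geN1.
Qed.

Let iH d0 (U : measurableType d0) (Q : probability U R) (Y : nat -> U -> R)
    (f : (nat -> R) -> R) (c : nat -> R) (t : R) :
  (forall i, measurable_fun setT (Y i)) ->
  (exists M : R, forall e, `|f e| <= M) ->
  measurable_fun setT (fun w => f (Y ^~ w)) ->
  Q.-integrable setT (fun w => (f (Y ^~ w) * cos (\sum_(i < n) c i * Y i w + t))%:E).
Proof.
move=> mY [M fM] mf; apply: measurable_bounded_integrable => //.
- by rewrite (le_lt_trans (probability_le1 _ _))// ltry.
- by apply: measurable_funM => //; exact: mcos.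
exists M; split; rewrite ?num_real// => x Mx w _; apply: le_trans (ltW Mx).
rewrite normrM; apply: le_trans (fM (Y ^~ w)); rewrite ler_piMr//.
by rewrite ler_norml cos_geN1 cos_le1.
Qed.

Let Hlin a b f g : H f -> H g -> H (fun e => a * f e + b * g e).
Proof.
move=> [bf mf mf' fE] [bg mg mg' gE].
split.
- have [[M fM] [N gN]] := (bf, bg); exists (`|a| * M + `|b| * N) => e.
  by rewrite (le_trans (ler_normD _ _))// !normrM lerD// ler_wpM2l.
- by apply: measurable_funD; exact: measurable_funM.
- by apply: measurable_funD; exact: measurable_funM.
move=> c t.
have lin d0 (U : measurableType d0) (Q : probability U R) (Y : nat -> U -> R) :
    (forall i, measurable_fun setT (Y i)) ->
    measurable_fun setT (fun w => f (Y ^~ w)) ->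
    measurable_fun setT (fun w => g (Y ^~ w)) ->
    (\int[Q]_w ((a * f (Y ^~ w) + b * g (Y ^~ w)) * cos (\sum_(i < n) c i * Y i w + t))%:E =
     a%:E * \int[Q]_w (f (Y ^~ w) * cos (\sum_(i < n) c i * Y i w + t))%:E +
     b%:E * \int[Q]_w (g (Y ^~ w) * cos (\sum_(i < n) c i * Y i w + t))%:E)%E.
  move=> mY mfY mgY.
  have i1 := iH Q c t mY bf mfY.
  have i2 := iH Q c t mY bg mgY.
  rewrite -!integralZl// -integralD//; [|exact: integrableZl..].
  by apply: eq_integral => w _; rewrite -!EFinM -EFinD; congr (_%:E); ring.
by rewrite !lin// fE gE.
Qed.

Let Hlim (f_ : nat -> (nat -> R) -> R) (f : (nat -> R) -> R) (M : R) :
  (forall m, H (f_ m)) -> (forall m e, `|f_ m e| <= M) ->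
  (forall e, f_ m e @[m --> \oo] --> f e) -> H f.
Proof.
move=> Hf fM fl.
have bf : exists M : R, forall e, `|f e| <= M.
  exists M => e; have fe : `|f_ m e| @[m --> \oo] --> `|f e| by apply: cvg_norm; exact: fl.
  rewrite -(cvg_lim _ fe)//; apply: limr_le; first by apply/cvg_ex; exists `|f e|.
  by near=> m.
have mlim d0 (U : measurableType d0) (Y : nat -> U -> R) :
    (forall m, measurable_fun setT (fun w => f_ m (Y ^~ w))) ->
    measurable_fun setT (fun w => f (Y ^~ w)).
  move=> mfY; apply: (measurable_fun_cvg (fun m => mfY m)) => w _; exact: fl.
have mf : measurable_fun setT (fun w => f (X ^~ w)) by apply: mlim => m; case: (Hf m).
have mf' : measurable_fun setT (fun w => f (X' ^~ w)) by apply: mlim => m; case: (Hf m).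
split=> // c t.
have lim d0 (U : measurableType d0) (Q : probability U R) (Y : nat -> U -> R) :
    (forall i, measurable_fun setT (Y i)) ->
    (forall m, measurable_fun setT (fun w => f_ m (Y ^~ w))) ->
    (\int[Q]_w (f_ m (Y ^~ w) * cos (\sum_(i < n) c i * Y i w + t))%:E)%E @[m --> \oo] -->
    (\int[Q]_w (f (Y ^~ w) * cos (\sum_(i < n) c i * Y i w + t))%:E)%E.
  move=> mY mfY.
  have := @dominated_convergence _ _ _ Q setT measurableT
    (fun m w => (f_ m (Y ^~ w) * cos (\sum_(i < n) c i * Y i w + t))%:E)
    (fun w => (f (Y ^~ w) * cos (\sum_(i < n) c i * Y i w + t))%:E) (fun=> M%:E).
  case=> //.
  - by move=> m; apply/measurable_EFinP; apply: measurable_funM => //; exact: mcos.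
  - by apply/measurable_EFinP; apply: measurable_funM; [exact: mlim|exact: mcos].
  - apply/aeW => w _; apply/cvg_EFin; first by near=> m.
    by apply: cvgM; [exact: fl|exact: cvg_cst].
  - exact: finite_measure_integrable_cst.
  - apply/aeW => w m _; rewrite lee_fin normrM; apply: le_trans (fM m (Y ^~ w)).
    by rewrite ler_piMr// ler_norml cos_geN1 cos_le1.
have l1 := lim _ _ P X mX (fun m => let: And4 _ h _ _ := Hf m in h).
have l2 := lim _ _ P' X' mX' (fun m => let: And4 _ _ h _ := Hf m in h).
apply: (cvg_unique _ l1) => //.
apply: cvg_trans l2; apply: near_eq_cvg; near=> m.
by have [_ _ _ ->] := Hf m.
Unshelve. all: end_near. Qed.

Let Hcos i f a s : (i < n)%N -> H f -> H (fun e => f e * cos (a * e i + s)).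
Proof.
move=> ni [bf mf mf' fE]; split.
- have [M fM] := bf; exists M => e; rewrite normrM; apply: le_trans (fM e).
  by rewrite ler_piMr// ler_norml cos_geN1 cos_le1.
- apply: measurable_funM => //; apply: measurableT_comp.
    by apply: continuous_measurable_fun; exact: continuous_cos.
  by apply: measurable_funD => //; exact: measurable_funM.
- apply: measurable_funM => //; apply: measurableT_comp.
    by apply: continuous_measurable_fun; exact: continuous_cos.
  by apply: measurable_funD => //; exact: measurable_funM.
move=> c t.
(* The two terms of the product-to-sum formula shift the i-th coefficient by [a] and by [- a]. *)
pose cp (sg : R) j := c j + (if (j == i)%N then sg * a else 0).
have cpE sg (y : nat -> R) :
    \sum_(j < n) cp sg j * y j = \sum_(j < n) c j * y j + sg * (a * y i).
  under eq_bigr do rewrite /cp mulrDl.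
  rewrite big_split/=; congr (_ + _).
  rewrite (bigD1 (Ordinal ni))//= eqxx big1 ?addr0 ?mulrA// => j /negbTE ji.
  by rewrite -(inj_eq val_inj)/= in ji; rewrite ji mul0r.
have lin d0 (U : measurableType d0) (Q : probability U R) (Y : nat -> U -> R) :
    (forall i, measurable_fun setT (Y i)) ->
    measurable_fun setT (fun w => f (Y ^~ w)) ->
    (\int[Q]_w (f (Y ^~ w) * cos (a * Y i w + s) * cos (\sum_(i < n) c i * Y i w + t))%:E =
     (2^-1)%:E * \int[Q]_w (f (Y ^~ w) * cos (\sum_(i < n) cp 1 i * Y i w + (t + s)))%:E +
     (2^-1)%:E * \int[Q]_w (f (Y ^~ w) * cos (\sum_(i < n) cp (-1) i * Y i w + (t - s)))%:E)%E.
  move=> mY mfY.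
  have i1 := iH Q (cp 1) (t + s) mY bf mfY.
  have i2 := iH Q (cp (-1)) (t - s) mY bf mfY.
  rewrite -!integralZl// -integralD//; [|exact: integrableZl..].
  apply: eq_integral => w _; rewrite -!EFinM -EFinD; congr (_%:E).
  rewrite -mulrA [cos _ * cos _]mulrC cosE !(cpE _ (Y ^~ w)).
  rewrite mulrDr ![f _ * (2^-1 * _)]mulrCA; congr (_ * (_ * cos _) + _ * (_ * cos _)); ring.
by rewrite !lin// !fE.
Qed.

(* Cramer-Wold. The bounded h with E h(X) = E h(X') contain the cosines of linear forms and
   are stable under multiplication by them and under bounded limits. *)
Lemma eq_law_rectangle (B : nat -> set R) : (forall i, measurable (B i)) ->
  P [set w | forall i, (i < n)%N -> B i (X i w)] =
  P' [set w | forall i, (i < n)%N -> B i (X' i w)].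
Proof.
move=> mB.
have Hm m : (m <= n)%N -> H (fun e => \prod_(i < m) \1_(B i) (e i)).
  elim: m => [_|m IH mn].
    have -> : (fun e : nat -> R => \prod_(i < 0) \1_(B i) (e i)) = (fun=> 1 : R).
      by apply/funext => e; rewrite big_ord0.
    exact: H1.
  have -> : (fun e : nat -> R => \prod_(i < m.+1) \1_(B i) (e i)) =
      (fun e => (\prod_(i < m) \1_(B i) (e i)) * \1_(B m) (e m) : R).
    by apply/funext => e; rewrite big_ord_recr.
  apply: (@bounded_class_indic _ _ H (fun e => e m)) => //.
  - by move=> f [].
  - by move=> f a s; exact: Hcos.
  - by apply: IH; exact: ltnW.
have [_ _ _ /(_ (fun=> 0) 0)] := Hm n (leqnn n).
have rect d0 (U : measurableType d0) (Q : probability U R) (Y : nat -> U -> R) :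
    (forall i, measurable_fun setT (Y i)) ->
    (\int[Q]_w (\prod_(i < n) \1_(B i) (Y i w) * cos (\sum_(i < n) 0 * Y i w + 0))%:E =
    Q [set w | forall i, (i < n)%N -> B i (Y i w)])%E.
  move=> mY.
  pose F i := Y i @^-1` B i.
  have -> : [set w | forall i, (i < n)%N -> B i (Y i w)] = \big[setI/setT]_(i < n) F i.
    by rewrite -(bigcap_mkord n F).
  rewrite -[RHS]mul1e -[X in (X * _)%E]/(1%:E) -integral_cst; last first.
    apply: bigsetI_measurable => i _.
    by rewrite -[X in measurable X]setTI; exact: mY.
  rewrite [RHS]integral_mkcond; apply: eq_integral => w _.
  rewrite [X in cos (X + 0)]big1; last by move=> i _; rewrite mul0r.
  rewrite addr0 cos0 mulr1 patchE -(bigcap_mkord n F).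
  case: ifPn => [|]; rewrite ?notin_setE ?inE => h.
    rewrite big1// => i _; rewrite indicE (_ : (Y i w \in B i) = true)//.
    by apply/mem_set; exact: (h i (ltn_ord i)).
  have [i /negP Bi] : exists i : 'I_n, ~~ (Y i w \in B i).
    apply: contrapT => /forallNP Bi; apply: h => i /= ni.
    by have := Bi (Ordinal ni) => /= /negP; rewrite negbK inE.
  rewrite (bigD1 i)//= indicE memNset ?mul0r// => Bi'; apply: Bi.
  by rewrite inE.
by rewrite !rect.
Qed.

End cramer_wold.

(** * Independence and Gaussian vectors *)

Section indep2.
Context {R : realType} d (T : measurableType d) (P : probability T R).

Definition indep2 (F G : set (set T)) :=
  forall A B, F A -> G B -> P (A `&` B) = (P A * P B)%E.

Lemma indep2_sym F G : indep2 F G -> indep2 G F.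
Proof. by move=> FG A B GA FB; rewrite setIC muleC; exact: FG. Qed.

Lemma indep2S F F' G G' : F' `<=` F -> G' `<=` G -> indep2 F G -> indep2 F' G'.
Proof. by move=> FF GG FG A B /FF FA /GG GB; exact: FG. Qed.

Lemma indep2_gen (C D : set (set T)) : C `<=` measurable -> D `<=` measurable ->
  setI_closed C -> indep2 C D -> indep2 <<s C >> D.
Proof.
move=> mC mD CI CD A B CA DB.
have mB := mD _ DB.
have sC : <<s C >> `<=` measurable.
  by apply: smallest_sub => //; exact: sigma_algebra_measurable.
pose PP (A : set T) := P (A `&` B) = (P A * P B)%E.
have fP (E : set T) : measurable E -> P E \is a fin_num by move=> mE; exact: fin_num_measure.
refine (@dynkin_induction _ (g_sigma_algebraType C) C PP _ _ _ _ _ _ A CA) => //.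
- by rewrite /PP setTI probability_setT mul1e.
- by move=> S CS; exact: CD.
- move=> S CS; rewrite /PP => SE.
  have mS : measurable (S : set T) by apply: sC; exact: CS.
  rewrite probability_setC// muleBl ?fP// ?mul1e.
  rewrite -SE setIC -setDE measureD// ?(setIC B)//.
  by rewrite (le_lt_trans (probability_le1 _ _))// ltry.
- move=> F CF tF PF; rewrite /PP.
  have mF n : measurable (F n : set T) by apply: sC; exact: CF.
  rewrite setI_bigcupl measure_bigcup//; last 2 first.
  + by move=> n _; exact: measurableI.
  + exact: trivIset_setIr.
  have -> : P (\bigcup_k F k) = (\sum_(0 <= i <oo | i \in [set: nat]) P (F i))%E.
    by rewrite measure_bigcup.
  rewrite -(fineK (fP _ mB)) muleC -nneseriesZl//.
  apply: eq_eseriesr => n _; apply: etrans (PF n) _.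
  by rewrite muleC fineK//; exact: fP.
Qed.

End indep2.

Section cylinders.
Context {R : realType} d (T : measurableType d).
Implicit Types S : set (T -> R).

(** Finite-dimensional cylinders, a pi-system generating [sigma_of S]. The families are total on
    [nat] and read only below [n], so that intersection is concatenation. *)
Definition cyl S : set (set T) := [set A | exists (n : nat) (f : nat -> T -> R)
  (B : nat -> set R), [/\ forall i, (i < n)%N -> S (f i),
     forall i, measurable (B i) & A = [set w | forall i, (i < n)%N -> B i (f i w)] ]].

Lemma cyl_setI S : setI_closed (cyl S).
Proof.
move=> _ _ [n [f [B [Sf mB ->]]]] [m [g [D [Sg mD ->]]]].
exists (n + m)%N, (fun i => if (i < n)%N then f i else g (i - n)%N),
  (fun i => if (i < n)%N then B i else D (i - n)%N); split.
- move=> i inm; case: ifPn => [/Sf//|]; rewrite -leqNgt => ni.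
  by apply: Sg; rewrite ltn_subLR.
- by move=> i; case: ifP.
apply/seteqP; split => w /=.
  move=> [fB gD] i inm; case: ifPn => [/fB//|]; rewrite -leqNgt => ni.
  by apply: gD; rewrite ltn_subLR.
move=> h; split => i im.
  by have := h i; rewrite im; apply; rewrite ltn_addr.
have := h (n + i)%N; rewrite ltn_add2l im (_ : (n + i < n)%N = false).
  by rewrite addKn; exact.
by apply/negbTE; rewrite -leqNgt leq_addr.
Qed.

Lemma sigma_of_preimage S f (B : set R) : S f -> measurable B ->
  sigma_of S (f @^-1` B).
Proof. by move=> Sf mB; apply: sub_sigma_algebra; exists f; split => //; exists B. Qed.

Lemma sigma_of_sub S (G : set (set T)) : sigma_algebra setT G ->
  (forall f B, S f -> measurable B -> G (f @^-1` B)) -> sigma_of S `<=` G.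
Proof.
move=> sG h; apply: smallest_sub => //.
by move=> _ [f [Sf [B [mB ->]]]]; exact: h.
Qed.

Lemma sigma_ofS S S' : S `<=` S' -> sigma_of S `<=` sigma_of S'.
Proof.
move=> SS; apply: sigma_of_sub; first exact: smallest_sigma_algebra.
by move=> f B /SS Sf mB; exact: sigma_of_preimage.
Qed.

Lemma sigma_of_measurable S : (forall f, S f -> measurable_fun setT f) ->
  sigma_of S `<=` measurable.
Proof.
move=> mS; apply: sigma_of_sub; first exact: sigma_algebra_measurable.
by move=> f B /mS mf mB; rewrite -[X in measurable X]setTI; exact: mf.
Qed.

Lemma sigma_of_cyl S : sigma_of S = <<s cyl S >>.
Proof.
apply/seteqP; split.
  apply: sigma_of_sub; first exact: smallest_sigma_algebra.
  move=> f B Sf mB; apply: sub_sigma_algebra; exists 1%N, (fun=> f), (fun=> B).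
  by split => //; apply/seteqP; split => w /=; [move=> fB i _|move=> /(_ 0%N isT)].
apply: smallest_sub; first exact: smallest_sigma_algebra.
move=> _ [n [f [B [Sf mB ->]]]].
pose F i := f i @^-1` B i.
rewrite (_ : [set _ | _] = \big[setI/setT]_(i < n) F i); last first.
  by rewrite -(bigcap_mkord n F).
apply: (@bigsetI_measurable _ (g_sigma_algebraType
  [set A | exists f, S f /\ exists B : set R, measurable B /\ A = f @^-1` B])) => i _.
by apply: sigma_of_preimage => //; exact: Sf.
Qed.

Lemma cyl_sub S : cyl S `<=` sigma_of S.
Proof. by rewrite sigma_of_cyl; exact: sub_sigma_algebra. Qed.

Lemma sigma_of_measurable_fun S f :
  measurable_fun (setT : set (g_sigma_algebraType
   [set A | exists f, S f /\ exists B : set R, measurable B /\ A = f @^-1` B])) (f : T -> R) <->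
  (forall B, measurable B -> sigma_of S (f @^-1` B)).
Proof.
split => [mf B mB|h _ B mB].
  by have := mf measurableT _ mB; rewrite setTI.
by rewrite setTI; exact: h.
Qed.

Lemma sigma_of_setT S : sigma_of S setT.
Proof.
exact: (@measurableT _ (g_sigma_algebraType
   [set A | exists f, S f /\ exists B : set R, measurable B /\ A = f @^-1` B])).
Qed.

Lemma sigma_of_setI S : setI_closed (sigma_of S).
Proof.
exact: (@measurableI _ (g_sigma_algebraType
   [set A | exists f, S f /\ exists B : set R, measurable B /\ A = f @^-1` B])).
Qed.

Lemma indep2_sigma_of (P : probability T R) S S' :
  (forall f, S f -> measurable_fun setT f) ->
  (forall f, S' f -> measurable_fun setT f) ->
  indep2 P (cyl S) (cyl S') -> indep2 P (sigma_of S) (sigma_of S').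
Proof.
move=> mS mS' h; rewrite sigma_of_cyl; apply: indep2_gen.
- by apply: subset_trans (sigma_of_measurable mS); exact: cyl_sub.
- exact: sigma_of_measurable.
- exact: cyl_setI.
apply: indep2_sym; rewrite sigma_of_cyl; apply: indep2_gen.
- by apply: subset_trans (sigma_of_measurable mS'); exact: cyl_sub.
- by apply: subset_trans (sigma_of_measurable mS); exact: cyl_sub.
- exact: cyl_setI.
exact: indep2_sym.
Qed.

(** The pi-system that reduces independence from a joined sigma-algebra to a factorisation over
    pairs of events. *)
Definition capsets (F G : set (set T)) : set (set T) :=
  [set A | exists B C, [/\ F B, G C & A = B `&` C] ].

Lemma sigma_of_capsets S S' :
  sigma_of (S `|` S') = <<s capsets (sigma_of S) (sigma_of S') >>.
Proof.
apply/seteqP; split.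
  apply: sigma_of_sub; first exact: smallest_sigma_algebra.
  move=> f B [Sf|Sf] mB; apply: sub_sigma_algebra.
    exists (f @^-1` B), setT; rewrite setIT; split => //.
      exact: sigma_of_preimage.
    exact: sigma_of_setT.
  exists setT, (f @^-1` B); rewrite setTI; split => //.
    exact: sigma_of_setT.
  exact: sigma_of_preimage.
apply: smallest_sub; first exact: smallest_sigma_algebra.
move=> _ [B [C [SB SC ->]]]; apply: sigma_of_setI.
  by apply: sigma_ofS SB; exact: subsetUl.
by apply: sigma_ofS SC; exact: subsetUr.
Qed.

Lemma capsets_setI F G : setI_closed F -> setI_closed G -> setI_closed (capsets F G).
Proof.
move=> FI GI _ _ [B [C [FB GC ->]]] [B' [C' [FB' GC' ->]]].
exists (B `&` B'), (C `&` C'); split; [exact: FI|exact: GI|].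
by rewrite setIACA.
Qed.

End cylinders.

Section product_probability.
Context {R : realType} d d' (T : measurableType d) (T' : measurableType d').
Variables (P : probability T R) (P' : probability T' R).

(** A name for the product measure, to which the structure of a probability can be attached. *)
Definition pprod : set (T * T') -> \bar R := (P \x P')%E.
HB.instance Definition _ := Measure.on pprod.

Let pprodT : pprod setT = 1%E.
Proof.
rewrite /pprod -setXTT product_measure1E//.
by rewrite -[RHS]mule1; congr (_ * _)%E; exact: probability_setT.
Qed.

HB.instance Definition _ := @Measure_isProbability.Build _ _ R pprod pprodT.

Lemma pprodE A B : measurable A -> measurable B -> pprod (A `*` B) = (P A * P' B)%E.
Proof. by move=> mA mB; rewrite /pprod product_measure1E. Qed.

Lemma pprod_fst A : measurable A -> pprod (fst @^-1` A) = P A.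
Proof.
move=> mA; rewrite (_ : _ @^-1` _ = A `*` setT); last first.
  by apply/seteqP; split => x //= [].
by rewrite pprodE// -[RHS]mule1; congr (_ * _)%E; exact: probability_setT.
Qed.

Lemma pprod_snd A : measurable A -> pprod (snd @^-1` A) = P' A.
Proof.
move=> mA; rewrite (_ : _ @^-1` _ = setT `*` A); last first.
  by apply/seteqP; split => x //= [].
by rewrite pprodE// -[RHS]mul1e; congr (_ * _)%E; exact: probability_setT.
Qed.

Lemma gauss_rv_pprod (f : T -> R) (g : T' -> R) (a b : R) :
  gauss_rv P f 0 a -> gauss_rv P' g 0 b ->
  gauss_rv pprod (fun z => f z.1 + g z.2) 0 (a + b).
Proof.
move=> [mf a0 fE] [mg b0 gE].
have mpre d0 (U : measurableType d0) (h : U -> R) (B : set R) :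
    measurable_fun setT h -> measurable B -> measurable (h @^-1` B).
  by move=> mh mB; rewrite -[X in measurable X]setTI; exact: mh.
apply: (@gauss_rv_add _ _ _ pprod (f \o fst) (g \o snd)).
- split; [exact: measurableT_comp|by []|].
  by move=> B mB; rewrite -fE//; apply: (pprod_fst (A := f @^-1` B)); exact: mpre.
- split; [exact: measurableT_comp|by []|].
  by move=> B mB; rewrite -gE//; apply: (pprod_snd (A := g @^-1` B)); exact: mpre.
move=> B D mB mD.
have [mfB mgD] : measurable (f @^-1` B) /\ measurable (g @^-1` D) by split; exact: mpre.
apply: etrans (pprodE mfB mgD) _; apply/esym; congr (_ * _)%E.
  exact: pprod_fst.
exact: pprod_snd.
Qed.

End product_probability.

Section gaussian_vector.
Context {R : realType} d (T : measurableType d) (P : probability T R).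
Variables (N : nat) (xi : T -> 'cV[R]_N) (Sig : 'M[R]_N).
Hypothesis gxi : gauss_vec P xi 0 Sig.

Definition lin d0 (U : measurableType d0) (z : U -> 'cV[R]_N) (u : 'rV[R]_N) : U -> R :=
  fun w => (u *m z w) 0 0.

Lemma gauss_rv_lin u : gauss_rv P (lin xi u) 0 ((u *m Sig *m u^T) 0 0).
Proof. by have := gxi u^T; rewrite trmxK mulmx0 mxE. Qed.

Lemma measurable_lin u : measurable_fun setT (lin xi u).
Proof. by case: (gauss_rv_lin u). Qed.

Lemma linE (n : nat) (c : nat -> R) (u : nat -> 'rV[R]_N) w :
  \sum_(i < n) c i * lin xi (u i) w = lin xi (\sum_(i < n) c i *: u i) w.
Proof.
rewrite /lin mulmx_suml summxE; apply: eq_bigr => i _.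
by rewrite -scalemxAl [RHS]mxE.
Qed.

Hypothesis sSig : Sig^T = Sig.

(** Uncorrelated implies independent, by comparison with two independent copies of [xi] on the
    product space. Orthogonality gives every mixed linear combination the same variance in both
    settings, so Cramer-Wold identifies the probabilities of rectangles, and on the product they
    factor. *)
Lemma gauss_indep2_cyl (U V : set 'rV[R]_N) :
  (forall u v, U u -> V v -> u *m Sig *m v^T = 0) ->
  indep2 P (cyl (lin xi @` U)) (cyl (lin xi @` V)).
Proof.
move=> UV A A' cA cA'.
have mlin W f : (lin xi @` W) f -> measurable_fun setT f.
  by move=> [u _ <-]; exact: measurable_lin.
have mA : measurable A by apply: sigma_of_measurable (cyl_sub cA); exact: mlin.
have mA' : measurable A' by apply: sigma_of_measurable (cyl_sub cA'); exact: mlin.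
move: cA cA' mA mA' => [n [f [B [Uf mB ->]]]] [m [g [D [Vg mD ->]]]] mA mA'.
have [u uP] : exists u : nat -> 'rV[R]_N,
    forall i, (i < n)%N -> U (u i) /\ lin xi (u i) = f i.
  suff /boolp.choice[u uP] : forall i, exists u, (i < n)%N -> U u /\ lin xi u = f i.
    by exists u.
  move=> i; have [/Uf [u Uu <-]|_] := boolP (i < n)%N; last by exists 0.
  by exists u.
have [v vP] : exists v : nat -> 'rV[R]_N,
    forall i, (i < m)%N -> V (v i) /\ lin xi (v i) = g i.
  suff /boolp.choice[v vP] : forall i, exists v, (i < m)%N -> V v /\ lin xi v = g i.
    by exists v.
  move=> i; have [/Vg [v Vv <-]|_] := boolP (i < m)%N; last by exists 0.
  by exists v.
(* The two families in one sequence: functionals from [U] first, then those from [V]. In [X'] the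
   two groups read different copies of [xi]. *)
pose X i := if (i < n)%N then lin xi (u i) else lin xi (v (i - n)%N).
pose X' i (z : T * T) := if (i < n)%N then lin xi (u i) z.1 else lin xi (v (i - n)%N) z.2.
pose E i := if (i < n)%N then B i else D (i - n)%N.
have mE i : measurable (E i) by rewrite /E; case: ifP.
have mX i : measurable_fun setT (X i) by rewrite /X; case: ifP => _; exact: measurable_lin.
have mX' i : measurable_fun setT (X' i).
  rewrite /X'; case: (i < n)%N; last by apply: measurableT_comp => //; exact: measurable_lin.
  by apply: measurableT_comp => //; exact: measurable_lin.
have splitX (c : nat -> R) (F : nat -> R) (G : nat -> R) :
    \sum_(i < n + m) c i * (if (i < n)%N then F i else G (i - n)%N) =
    \sum_(i < n) c i * F i + \sum_(i < m) c (n + i)%N * G i.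
  rewrite big_split_ord/=; congr (_ + _); apply: eq_bigr => i _; rewrite ?ltn_ord//.
  by rewrite ltnNge leq_addr addKn.
have XX' (c : nat -> R) (Z : set R) : measurable Z ->
    P ((fun w => \sum_(i < n + m) c i * X i w) @^-1` Z) =
    pprod P P ((fun z => \sum_(i < n + m) c i * X' i z) @^-1` Z).
  move=> mZ.
  pose uc := \sum_(i < n) c i *: u i; pose vc := \sum_(i < m) c (n + i)%N *: v i.
  have ucE w : lin xi uc w = \sum_(i < n) c i * lin xi (u i) w by rewrite linE.
  have vcE w : lin xi vc w = \sum_(i < m) c (n + i)%N * lin xi (v i) w.
    by rewrite (linE m (fun i => c (n + i)%N)).
  have -> : (fun w => \sum_(i < n + m) c i * X i w) = lin xi (uc + vc).
    apply/funext => w; rewrite {1}/lin mulmxDl mxE -!/(lin xi _ w) ucE vcE.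
    rewrite -(splitX c (fun i => lin xi (u i) w) (fun i => lin xi (v i) w)).
    by apply: eq_bigr => i _; rewrite /X; case: ifP.
  have -> : (fun z => \sum_(i < n + m) c i * X' i z) =
      fun z => lin xi uc z.1 + lin xi vc z.2.
    apply/funext => z; rewrite ucE vcE.
    rewrite -(splitX c (fun i => lin xi (u i) z.1) (fun i => lin xi (v i) z.2)).
    by apply: eq_bigr => i _; rewrite /X'; case: ifP.
  have [_ _ PE] := gauss_rv_lin (uc + vc).
  have [_ _ PPE] := gauss_rv_pprod (gauss_rv_lin uc) (gauss_rv_lin vc).
  rewrite (PE _ mZ); apply: etrans _ (esym (PPE _ mZ)).
  suff -> : ((uc + vc) *m Sig *m (uc + vc)^T) 0 0 =
    (uc *m Sig *m uc^T) 0 0 + (vc *m Sig *m vc^T) 0 0 by [].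
  (* The cross terms, which the independent copies lack, vanish by orthogonality. *)
  have uv0 : uc *m Sig *m vc^T = 0.
    rewrite /uc /vc linear_sum/= !mulmx_suml big1// => i _.
    rewrite mulmx_sumr big1// => j _.
    rewrite linearZ/= -scalemxAr -!scalemxAl UV ?scaler0//.
      by have [] := uP i (ltn_ord i).
    by have [] := vP j (ltn_ord j).
  have vu0 : vc *m Sig *m uc^T = 0.
    by apply: trmx_inj; rewrite !trmx_mul trmxK sSig mulmxA uv0 trmx0.
  by rewrite linearD/= !mulmxDl !mulmxDr uv0 vu0 addr0 add0r mxE.
have := eq_law_rectangle mX mX' XX' mE.
have splitE (Y : nat -> Prop) : (forall i, (i < n + m)%N -> Y i) <->
   (forall i, (i < n)%N -> Y i) /\ (forall i, (i < m)%N -> Y (n + i)%N).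
  split => [h|[h1 h2] i].
    by split=> i im; apply: h; [rewrite ltn_addr|rewrite ltn_add2l].
  by have [/h1|ni] := ltnP i n => // inm; rewrite -(subnKC ni); apply: h2; rewrite ltn_subLR.
have -> : [set w | forall i, (i < n + m)%N -> E i (X i w)] =
    [set w | forall i, (i < n)%N -> B i (f i w)] `&`
    [set w | forall i, (i < m)%N -> D i (g i w)].
  apply/seteqP; split => w /=; rewrite splitE => -[h1 h2]; split => i im.
  - by have := h1 i im; rewrite /E /X im; have [_ ->] := uP i im.
  - have := h2 i im; rewrite /E /X ltnNge leq_addr addKn/=.
    by have [_ ->] := vP i im.
  - by rewrite /E /X im; have [_ ->] := uP i im; exact: h1.
  - by rewrite /E /X ltnNge leq_addr addKn/=; have [_ ->] := vP i im; exact: h2.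
move=> ->.
apply: etrans _ (pprodE P P mA mA'); congr (pprod _ _ _).
apply/seteqP; split => z /=; rewrite splitE => -[h1 h2]; split => i im.
- by have := h1 i im; rewrite /E /X' im; have [_ ->] := uP i im.
- have := h2 i im; rewrite /E /X' ltnNge leq_addr addKn/=.
  by have [_ ->] := vP i im.
- by rewrite /E /X' im; have [_ ->] := uP i im; exact: h1.
- by rewrite /E /X' ltnNge leq_addr addKn/=; have [_ ->] := vP i im; exact: h2.
Qed.

Lemma gauss_indep2 (U V : set 'rV[R]_N) :
  (forall u v, U u -> V v -> u *m Sig *m v^T = 0) ->
  indep2 P (sigma_of (lin xi @` U)) (sigma_of (lin xi @` V)).
Proof.
move=> UV; apply: indep2_sigma_of; last exact: gauss_indep2_cyl.
all: by move=> f [u _ <-]; exact: measurable_lin.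
Qed.

End gaussian_vector.

(** * Second moments *)

Section square_integrable.
Context {R : realType} d (T : measurableType d) (P : probability T R).

Definition sqint (f : T -> R) :=
  measurable_fun setT f /\ (\int[P]_w ((f w) ^+ 2)%:E < +oo)%E.

Definition Ex (f : T -> R) : R := fine (\int[P]_w (f w)%:E).

Lemma ExE f : P.-integrable setT (EFin \o f) -> (\int[P]_w (f w)%:E = (Ex f)%:E)%E.
Proof. by move=> /integrable_fin_num => /(_ measurableT) h; rewrite fineK. Qed.

Lemma ExD f g : P.-integrable setT (EFin \o f) -> P.-integrable setT (EFin \o g) ->
  Ex (fun w => f w + g w) = Ex f + Ex g.
Proof.
move=> fi gi; apply: EFin_inj; rewrite EFinD -!ExE//.
  by rewrite -integralD.
by rewrite (_ : _ \o _ = (EFin \o f) \+ (EFin \o g))//; exact: integrableD.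
Qed.

Lemma ExZ a f : P.-integrable setT (EFin \o f) ->
  Ex (fun w => a * f w) = a * Ex f.
Proof.
move=> fi; apply: EFin_inj; rewrite EFinM -!ExE//.
  by rewrite -integralZl.
by rewrite (_ : _ \o _ = (fun w => a%:E * (EFin \o f) w)%E)//; exact: integrableZl.
Qed.

Lemma integrableZ a f : P.-integrable setT (EFin \o f) ->
  P.-integrable setT (EFin \o fun w => a * f w).
Proof.
move=> fi; rewrite (_ : _ \o _ = (fun w => a%:E * (EFin \o f) w)%E)//.
exact: integrableZl.
Qed.

Lemma integrableA f g : P.-integrable setT (EFin \o f) ->
  P.-integrable setT (EFin \o g) -> P.-integrable setT (EFin \o fun w => f w + g w).
Proof.
move=> fi gi; rewrite (_ : _ \o _ = (EFin \o f) \+ (EFin \o g))//.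
exact: integrableD.
Qed.

Lemma Ex_sum (I : Type) (r : seq I) (f : I -> T -> R) :
  (forall i, P.-integrable setT (EFin \o f i)) ->
  P.-integrable setT (EFin \o fun w => \sum_(i <- r) f i w) /\
  Ex (fun w => \sum_(i <- r) f i w) = \sum_(i <- r) Ex (f i).
Proof.
move=> fi; elim: r => [|i r [IH1 IH2]].
  rewrite big_nil (_ : (fun w => _) = cst 0); last first.
    by apply/funext => w; rewrite big_nil.
  split; first exact: finite_measure_integrable_cst.
  by rewrite /Ex (_ : (fun w => _) = cst 0%E)// integral0.
rewrite (_ : (fun w => _) = fun w => f i w + \sum_(j <- r) f j w); last first.
  by apply/funext => w; rewrite big_cons.
split; first exact: integrableA.
by rewrite ExD// IH2 big_cons.
Qed.

Lemma Ex_ge0 f : (forall w, 0 <= f w) -> 0 <= Ex f.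
Proof.
by move=> f0; apply: fine_ge0; apply: integral_ge0 => w _; rewrite lee_fin.
Qed.

Lemma sqint_sqr f : sqint f -> P.-integrable setT (EFin \o fun w => f w ^+ 2).
Proof.
move=> [mf fi]; apply/integrableP; split.
  by apply/measurable_EFinP; exact: measurable_funX.
apply: le_lt_trans fi; rewrite le_eqVlt; apply/orP; left; apply/eqP.
by apply: eq_integral => w _ /=; rewrite ger0_norm// sqr_ge0.
Qed.

Lemma sqintM f g : sqint f -> sqint g ->
  P.-integrable setT (EFin \o fun w => f w * g w).
Proof.
move=> Lf Lg; have [mf _] := Lf; have [mg _] := Lg.
have := integrableA (sqint_sqr Lf) (sqint_sqr Lg); apply: le_integrable => //.
  by apply/measurable_EFinP; exact: measurable_funM.
move=> w _ /=; rewrite lee_fin.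
rewrite [X in _ <= X]ger0_norm ?addr_ge0 ?sqr_ge0//.
rewrite ler_norml; apply/andP; split.
  by have := sqr_ge0 (f w + g w); have := sqr_ge0 (f w); have := sqr_ge0 (g w); nra.
by have := sqr_ge0 (f w - g w); have := sqr_ge0 (f w); have := sqr_ge0 (g w); nra.
Qed.

Lemma sqint_cst c : sqint (cst c).
Proof.
split => //; rewrite (eq_integral (cst (c ^+ 2)%:E))// integral_cst//.
by rewrite -ge0_fin_numE ?fin_numM// ?fin_num_measure// mule_ge0// lee_fin sqr_ge0.
Qed.

Lemma sqint_integrable f : sqint f -> P.-integrable setT (EFin \o f).
Proof.
move=> Lf; have := sqintM Lf (sqint_cst 1).
by rewrite (_ : (fun w => f w * _) = f)//; apply/funext => w /=; rewrite mulr1.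
Qed.

Lemma sqintZ a f : sqint f -> sqint (fun w => a * f w).
Proof.
move=> Lf; have [mf _] := Lf; split; first exact: measurable_funM.
have := integrableZ (a ^+ 2) (sqint_sqr Lf) => /integrableP[_]; apply: le_lt_trans.
rewrite le_eqVlt; apply/orP; left; apply/eqP; apply: eq_integral => w _ /=.
by rewrite -exprMn ger0_norm// sqr_ge0.
Qed.

Lemma sqintD f g : sqint f -> sqint g -> sqint (fun w => f w + g w).
Proof.
move=> Lf Lg; have [mf _] := Lf; have [mg _] := Lg.
split; first exact: measurable_funD.
have := integrableA (sqint_sqr Lf) (integrableA (integrableZ 2 (sqintM Lf Lg)) (sqint_sqr Lg)).
move=> /integrableP[_]; apply: le_lt_trans.
rewrite le_eqVlt; apply/orP; left; apply/eqP; apply: eq_integral => w _ /=.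
have -> : f w ^+ 2 + (2 * (f w * g w) + g w ^+ 2) = (f w + g w) ^+ 2 by ring.
by rewrite ger0_norm// sqr_ge0.
Qed.

Lemma sqint_sum (I : Type) (r : seq I) (f : I -> T -> R) :
  (forall i, sqint (f i)) -> sqint (fun w => \sum_(i <- r) f i w).
Proof.
move=> fi; elim: r => [|i r IH].
  rewrite (_ : (fun w => _) = cst 0); first exact: sqint_cst.
  by apply/funext => w; rewrite big_nil.
rewrite (_ : (fun w => _) = fun w => f i w + \sum_(j <- r) f j w); first exact: sqintD.
by apply/funext => w; rewrite big_cons.
Qed.

End square_integrable.

(** * Mean and variance of the normal law *)

Section normal_moments.
Context {R : realType}.
Local Notation leb := (@lebesgue_measure R).

Let h (s : R) n := Num.sqrt (1 + 2 * 2^-1 ^+ n * s ^+ 2).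

(** Multiplying a centred normal density by exp(- t x^2), with t = 2^-n, only rescales [s]; the
    factor [h] satisfies h^2 = 1 + 2 t s^2. *)
Let normal_tilt (s x : R) n : 0 < s ->
  expR (- (2^-1 ^+ n * x ^+ 2)) * normal_pdf 0 s x =
  (h s n)^-1 * normal_pdf 0 (s / h s n) x.
Proof.
move=> s0.
have t0 : 0 < (2^-1 : R) ^+ n by rewrite exprn_gt0.
have h2 : h s n ^+ 2 = 1 + 2 * 2^-1 ^+ n * s ^+ 2.
  by rewrite sqr_sqrtr// addr_ge0// !mulr_ge0// ?sqr_ge0// ltW.
have h0 : 0 < h s n by rewrite sqrtr_gt0 ltr_wpDr// !mulr_ge0// ?sqr_ge0// ltW.
have [sN hN] : s != 0 /\ h s n != 0 by rewrite !gt_eqF.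
rewrite !normal_pdfE ?mulf_neq0 ?invr_neq0//.
rewrite mulrCA -expRD [RHS]mulrA; congr (_ * expR _).
  rewrite !normal_peakE ?divr_gt0//; field.
  by rewrite sN hN gt_eqF// sqrtr_gt0 mulrn_wgt0// pi_gt0.
have -> : (s / h s n) ^+ 2 = s ^+ 2 / h s n ^+ 2 by rewrite exprMn exprVn.
rewrite h2; field; rewrite sN/= gt_eqF// -h2 exprn_gt0//.
Qed.

(** x^2 is the increasing limit of (1 - exp(- t x^2)) / t along t = 2^-n, and each of these
    functions has a closed-form integral by [normal_tilt]. No integration by parts is involved. *)
Lemma normal_second_moment (s : R) : 0 < s ->
  (\int[normal_prob 0%R s]_x (x ^+ 2)%:E = (s ^+ 2)%:E)%E.
Proof.
move=> s0.
pose a n (x : measurableTypeR R) : \bar R :=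
  (2 ^+ n * (1 - expR (- (2^-1 ^+ n * x ^+ 2))))%:E.
have t0 n : 0 < (2^-1 : R) ^+ n by rewrite exprn_gt0.
have t2 n : 2 ^+ n * (2^-1 : R) ^+ n = 1 by rewrite -exprMn divff// expr1n.
have ma n : measurable_fun setT (a n).
  apply/measurable_EFinP; apply: measurable_funM => //; apply: measurable_funB => //.
  apply: measurableT_comp; first exact: measurable_expR.
  by apply: measurableT_comp => //; apply: measurable_funM => //; exact: exprn_measurable.
have a0 n x : (0 <= a n x)%E.
  rewrite lee_fin mulr_ge0 ?exprn_ge0// subr_ge0 -[leRHS]expR0 ler_expR.
  by rewrite oppr_le0 mulr_ge0 ?sqr_ge0// ltW.
have h1 n : 1 <= h s n.
  by rewrite -[leLHS]sqrtr1 ler_wsqrtr// lerDl !mulr_ge0// ?sqr_ge0// ltW.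
have ha n : (\int[normal_prob 0%R s]_x a n x = (2 * s ^+ 2 / (h s n * (h s n + 1)))%:E)%E.
  have h0 : 0 < h s n by apply: lt_le_trans (h1 n).
  have h2 : h s n ^+ 2 = 1 + 2 * 2^-1 ^+ n * s ^+ 2.
    by rewrite sqr_sqrtr// addr_ge0// !mulr_ge0// ?sqr_ge0// ltW.
  rewrite ge0_integral_normal//; last exact: (ma n).
  have -> : (\int[leb]_x (a n x * (normal_pdf 0 s x)%:E) =
    \int[leb]_x ((2 ^+ n * normal_pdf 0 s x)%:E -
      (2 ^+ n * (h s n)^-1 * normal_pdf 0 (s / h s n) x)%:E))%E.
    apply: eq_integral => x _; rewrite -EFinM -EFinB; congr (_%:E).
    by rewrite -[in RHS]mulrA -normal_tilt//; ring.
  have i1 : leb.-integrable setT (fun x => (2 ^+ n * normal_pdf 0 s x)%:E).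
    exact: (@integrableZl _ _ _ leb setT measurableT (2 ^+ n) _ (integrable_normal_pdf 0 s)).
  have i2 : leb.-integrable setT (fun x => (2 ^+ n * (h s n)^-1 * normal_pdf 0 (s / h s n) x)%:E).
    exact: (@integrableZl _ _ _ leb setT measurableT (2 ^+ n * (h s n)^-1) _ (integrable_normal_pdf 0 (s / h s n))).
  rewrite integralB//.
  under eq_integral do rewrite EFinM.
  rewrite integralZl//; last exact: integrable_normal_pdf.
  under [X in (_ - X)%E]eq_integral do rewrite EFinM.
  rewrite [X in (_ - X)%E]integralZl//; last exact: integrable_normal_pdf.
  rewrite !integral_normal_pdf !mule1 -EFinB; congr (_%:E).
  (* Since h^2 - 1 = 2 t s^2, the quotient (1 - 1/h) / t becomes 2 s^2 / (h (h + 1)), which stays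
     regular as h tends to 1. *)
  have -> : 2 * s ^+ 2 = 2 ^+ n * (h s n ^+ 2 - 1).
    rewrite h2; move: (t2 n); move: (2 ^+ n) (2^-1 ^+ n) => p q pq.
    have -> : p * (1 + 2 * q * s ^+ 2 - 1) = 2 * s ^+ 2 * (p * q) by ring.
    by rewrite pq mulr1.
  by field; rewrite !gt_eqF// addr_gt0.
have a_mono n x : (a n x <= a n.+1 x)%E.
  rewrite lee_fin; set e := expR (- (2^-1 ^+ n.+1 * x ^+ 2)).
  (* Halving t takes a square root of the exponential, so monotonicity in n reads 1 - e^2 <= 2 (1 -
     e), that is, 0 <= (1 - e)^2. *)
  have -> : expR (- (2^-1 ^+ n * x ^+ 2)) = e * e.
    have half (q y : R) : - (q * y) = - (2^-1 * q * y) + - (2^-1 * q * y) by lra.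
    by rewrite /e -expRD; congr expR; rewrite [2^-1 ^+ n.+1]exprS; exact: half.
  have e0 : 0 <= e by exact: expR_ge0.
  have p0 : 0 < (2 : R) ^+ n by rewrite exprn_gt0.
  by rewrite exprS; have := sqr_ge0 (e - 1); nra.
have a_cvg x : a n x @[n --> \oo] --> (x ^+ 2)%:E.
  apply/cvg_EFin; first by near=> n.
  apply: (@squeeze_cvgr _ _ _ _ (fun n => x ^+ 2 / (1 + 2^-1 ^+ n * x ^+ 2)) (fun=> x ^+ 2)).
  (* With u = t x^2, the squeeze is u / (1 + u) <= 1 - exp(- u) <= u, both sides from exp(v) >= 1 +
     v. *)
  - near=> n; rewrite /a/=.
    set u := 2^-1 ^+ n * x ^+ 2.
    have u0 : 0 <= u by rewrite mulr_ge0 ?sqr_ge0// ltW.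
    have xu : x ^+ 2 = 2 ^+ n * u by rewrite /u mulrA t2 mul1r.
    have p0 : 0 < (2 : R) ^+ n by rewrite exprn_gt0.
    have up : 0 < 1 + u by rewrite ltr_wpDr.
    rewrite xu -mulrA !ler_pM2l//; apply/andP; split; last first.
      by rewrite lerBlDr -lerBlDl; exact: expR_ge1Dx.
    have e1 : expR (- u) <= (1 + u)^-1.
      by rewrite expRN lef_pV2 ?posrE ?expR_gt0//; exact: expR_ge1Dx.
    suff -> : u / (1 + u) = 1 - (1 + u)^-1 by rewrite lerD2l lerN2.
    by field; rewrite gt_eqF.
  - have c0 : 2^-1 ^+ n @[n --> \oo] --> (0 : R).
      by apply: cvg_expr; rewrite gtr0_norm// invf_lt1// ltr1n.
    rewrite -[X in _ --> X]divr1; apply: cvgM; first exact: cvg_cst.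
    apply: cvgV => //; rewrite -[X in _ --> X]addr0; apply: cvgD; first exact: cvg_cst.
    by rewrite -[X in _ --> X](mul0r (x ^+ 2)); apply: cvgM => //; exact: cvg_cst.
  - exact: cvg_cst.
have := @cvg_monotone_convergence _ _ _ (normal_prob 0%R s) setT measurableT a ma (fun n x _ => a0 n x).
have nd x : setT x -> nondecreasing_seq (a ^~ x).
  by move=> _; apply/nondecreasing_seqP => n; exact: a_mono.
move=> /(_ nd) c1.
have -> : (\int[normal_prob 0%R s]_x (x ^+ 2)%:E = \int[normal_prob 0%R s]_x limn (a ^~ x))%E.
  by apply: eq_integral => x _; apply/esym/cvg_lim => //; exact: a_cvg.
apply: (cvg_unique _ c1) => //.
have -> : (fun n => \int[normal_prob 0%R s]_x a n x)%E =
    (fun n => (2 * s ^+ 2 / (h s n * (h s n + 1)))%:E).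
  by apply/funext => n; exact: ha.
apply/cvg_EFin; first by near=> n.
have hc2 : 1 + 2 * 2^-1 ^+ n * s ^+ 2 @[n --> \oo] --> (1 : R).
  rewrite -[X in _ --> X]addr0; apply: cvgD; first exact: cvg_cst.
  rewrite -[X in _ --> X](mul0r (s ^+ 2)); apply: cvgM; last exact: cvg_cst.
  rewrite -[X in _ --> X](mulr0 2); apply: cvgM; first exact: cvg_cst.
  by apply: cvg_expr; rewrite gtr0_norm// invf_lt1// ltr1n.
have hc : h s n @[n --> \oo] --> (1 : R).
  rewrite -[X in _ --> X]sqrtr1 /h.
  exact: (@cvg_comp _ _ _ (fun n => 1 + 2 * 2^-1 ^+ n * s ^+ 2) (@Num.sqrt R) _
    (nbhs (1 : R)) _ hc2 (@sqrt_continuous R 1)).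
have : 2 * s ^+ 2 / (h s n * (h s n + 1)) @[n --> \oo] --> 2 * s ^+ 2 / (1 * (1 + 1)).
  apply: cvgM; first exact: cvg_cst.
  apply: cvgV; first by rewrite mulf_neq0// gt_eqF.
  by apply: cvgM => //; apply: cvgD => //; exact: cvg_cst.
by have <- : s ^+ 2 = 2 * s ^+ 2 / (1 * (1 + 1)) by field.
Unshelve. all: end_near. Qed.

Variables (d : measure_display) (T : measurableType d) (P : probability T R).
Variables (Z : T -> R) (a : R).
Hypothesis gZ : gauss_rv P Z 0 a.

Lemma gauss_rv_second_moment : (\int[P]_w (Z w ^+ 2)%:E = a%:E)%E.
Proof.
have [mZ a0 ZE] := gZ.
have [aE|aN] := eqVneq a 0.
  have := @eq_law_integral R _ _ T T P P Z (cst 0) (fun x => x ^+ 2) mZ.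
  move=> ->; last first.
  - by move=> x; exact: sqr_ge0.
  - exact: exprn_measurable.
  - move=> B mB; rewrite ZE// aE eqxx preimage_cst indicE; case: ifP => _.
      by apply/esym/probability_setT.
    by rewrite measure0.
  - exact: measurable_cst.
  by rewrite /= expr0n/= integral0 aE.
have a_gt0 : 0 < a by rewrite lt_neqAle eq_sym aN.
have := @eq_law_integral R _ _ T (measurableTypeR R) P (normal_prob 0 (Num.sqrt a)) Z id
  (fun x => x ^+ 2) mZ.
move=> ->; last first.
- by move=> x; exact: sqr_ge0.
- exact: exprn_measurable.
- by move=> B mB; rewrite ZE// (negbTE aN).
- exact: measurable_id.
have sa : 0 < Num.sqrt a by rewrite sqrtr_gt0.
by apply: etrans (normal_second_moment sa) _; rewrite sqr_sqrtr.
Qed.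

Lemma gauss_rv_sqint : sqint P Z.
Proof. by have [mZ _ _] := gZ; split => //; rewrite gauss_rv_second_moment ltry. Qed.

(** Z and - Z have the same law, so the positive and negative parts of Z have the same finite
    integral. *)
Lemma gauss_rv_mean : (\int[P]_w (Z w)%:E = 0)%E.
Proof.
have [mZ a0 ZE] := gZ.
have iZ := sqint_integrable gauss_rv_sqint.
have gN := gauss_rv_scale (-1) gZ.
have [mN _ NE] := gN.
have pos : (\int[P]_w (Num.max (Z w) 0)%:E = \int[P]_w (Num.max (-1 * Z w) 0)%:E)%E.
  apply: (@eq_law_integral R _ _ T T P P Z (fun w => -1 * Z w) (fun x => Num.max x 0)) => //.
  - by move=> B mB; rewrite ZE// [RHS](NE _ mB) sqrrN expr1n mul1r.
  - exact: measurable_maxr.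
  - by move=> x; rewrite le_max lexx orbT.
rewrite integralE (_ : (\int[P]_w ((fun w => (Z w)%:E)^\- w) = \int[P]_w ((fun w => (Z w)%:E)^\+ w))%E).
  by rewrite subee//; exact: integrable_pos_fin_num.
have <- : (\int[P]_w (Num.max (Z w) 0)%:E = \int[P]_w ((fun w => (Z w)%:E)^\+ w))%E.
  by apply: eq_integral => w _; rewrite funeposE EFin_max.
rewrite pos; apply: eq_integral => w _.
by rewrite funenegE EFin_max mulN1r.
Qed.

End normal_moments.

Section gaussian_covariance.
Context {R : realType} d (T : measurableType d) (P : probability T R).
Variables (N : nat) (xi : T -> 'cV[R]_N) (Sig : 'M[R]_N).
Hypotheses (gxi : gauss_vec P xi 0 Sig) (sSig : Sig^T = Sig).

Lemma sqint_lin u : sqint P (lin xi u).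
Proof. exact: gauss_rv_sqint (gauss_rv_lin gxi u). Qed.

Lemma Ex_lin u : Ex P (lin xi u) = 0.
Proof. by rewrite /Ex (gauss_rv_mean (gauss_rv_lin gxi u)). Qed.

(** Polarisation: expand the second moment of [lin xi (u + v)]. *)
Lemma Ex_linM u v : Ex P (fun w => lin xi u w * lin xi v w) = (u *m Sig *m v^T) 0 0.
Proof.
have sq (z : 'rV[R]_N) : Ex P (fun w => lin xi z w ^+ 2) = (z *m Sig *m z^T) 0 0.
  by rewrite /Ex (gauss_rv_second_moment (gauss_rv_lin gxi z)).
have Lu := sqint_lin u; have Lv := sqint_lin v.
have := sq (u + v).
have -> : (fun w => lin xi (u + v) w ^+ 2) =
    fun w => lin xi u w ^+ 2 + (2 * (lin xi u w * lin xi v w) + lin xi v w ^+ 2).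
  by apply/funext => w; rewrite /lin mulmxDl mxE; ring.
have iuv := sqintM Lu Lv.
rewrite ExD; [|exact: sqint_sqr|exact/integrableA/sqint_sqr/Lv/integrableZ].
rewrite ExD; [|exact: integrableZ|exact: sqint_sqr].
rewrite ExZ// !sq linearD/= !mulmxDl !mulmxDr.
have -> : v *m Sig *m u^T = u *m Sig *m v^T.
  have <- : (u *m Sig *m v^T)^T = v *m Sig *m u^T.
    by rewrite !trmx_mul trmxK sSig mulmxA.
  by apply/matrixP => i j; rewrite mxE !ord1.
rewrite !mxE; lra.
Qed.

End gaussian_covariance.

(** * Existence of Gaussian vectors *)

Section psd_factor.
Context {R : realType}.

Lemma mx11E (M : 'M[R]_1) : M = (M 0 0)%:M.
Proof. exact: mx11_scalar. Qed.

(* Cholesky; a vanishing pivot is harmless because 0^-1 = 0 and then its column vanishes too. *)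
Lemma psd_factor n (M : 'M[R]_n) : psd M -> exists G : 'M[R]_n, M = G *m G^T.
Proof.
elim: n M => [|n IH] M [sM pM].
  by exists 0; apply/matrixP => -[].
pose M' : 'M[R]_(1 + n) := M.
pose a := M' 0 0; pose b := dlsubmx M'; pose D := drsubmx M'.
have ME : M' = block_mx a%:M b^T b D.
  rewrite -[LHS]submxK; congr block_mx.
    by rewrite [LHS]mx11E; congr (_%:M); rewrite !mxE; congr (M' _ _); apply/val_inj.
  rewrite /b -[in RHS](sM : M'^T = M'); apply/matrixP => i j; rewrite !mxE//.
have sD : D^T = D.
  by rewrite /D -[in LHS](sM : M'^T = M'); apply/matrixP => i j; rewrite !mxE.
have quad (x : R) (v : 'cV[R]_n) :
    0 <= x ^+ 2 * a + 2 * x * (b^T *m v) 0 0 + (v^T *m D *m v) 0 0.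
  have := (pM : forall u : 'cV_(1 + n), 0 <= (u^T *m M' *m u) 0 0) (col_mx x%:M v).
  rewrite ME tr_col_mx mul_row_block mul_row_col !mulmxDl tr_scalar_mx.
  have addE (E F : 'M[R]_1) : (E + F) 0 0 = E 0 0 + F 0 0 by rewrite mxE.
  rewrite -!scalar_mxM !addE.
  have -> : ((x * a * x)%:M : 'M[R]_1) 0 0 = x ^+ 2 * a by rewrite mxE eqxx mulr1n; ring.
  have -> : (v^T *m b *m x%:M) 0 0 = x * (b^T *m v) 0 0.
    rewrite mul_mx_scalar [LHS]mxE; congr (_ * _).
    have <- : (b^T *m v)^T = v^T *m b by rewrite trmx_mul trmxK.
    by rewrite mxE.
  have -> : (x%:M *m b^T *m v) 0 0 = x * (b^T *m v) 0 0.
    by rewrite -mulmxA mul_scalar_mx mxE.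
  lra.
have a0 : 0 <= a by have := quad 1 0; rewrite !mulmx0 mxE; lra.
have b0 : a = 0 -> b = 0.
  move=> aE; apply/matrixP => j k; rewrite ord1 [RHS]mxE.
  pose v : 'cV[R]_n := delta_mx j 0.
  have bv : (b^T *m v) 0 0 = b j 0.
    by rewrite /v -colE !mxE.
  have h := quad _ v; apply: contrapT => /eqP bj.
  have := h (- ((v^T *m D *m v) 0 0 + 1) / (2 * b j 0)).
  rewrite bv aE mulr0 add0r; set q := (v^T *m D *m v) 0 0.
  have -> : 2 * (- (q + 1) / (2 * b j 0)) * b j 0 = - (q + 1) by field.
  by lra.
have aab : (Num.sqrt a * (Num.sqrt a)^-1) *: b = b.
  have [/b0 ->|aN] := eqVneq a 0; first by rewrite scaler0.
  by rewrite divff ?scale1r// gt_eqF// sqrtr_gt0 lt_neqAle eq_sym aN.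
pose D' := D - a^-1 *: (b *m b^T).
have [|G' G'E] := IH D'.
  split; first by rewrite /D' linearB/= linearZ/= trmx_mul trmxK sD.
  move=> v; have := quad (- (a^-1 * (b^T *m v) 0 0)) v.
  have -> : (v^T *m D' *m v) 0 0 = (v^T *m D *m v) 0 0 - a^-1 * (b^T *m v) 0 0 ^+ 2.
    rewrite /D' mulmxBr mulmxBl mxE; congr (_ + _); rewrite mxE; congr (- _).
    rewrite -scalemxAr -scalemxAl mxE; congr (_ * _).
    rewrite [v^T *m (b *m b^T)]mulmxA -[v^T *m b *m b^T *m v]mulmxA mxE big_ord1 expr2; congr (_ * _).
    have <- : (b^T *m v)^T = v^T *m b by rewrite trmx_mul trmxK.
    by rewrite mxE.
  have [->|aN] := eqVneq a 0; first by rewrite invr0; lra.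
  set q := (b^T *m v) 0 0; set r := (v^T *m D *m v) 0 0.
  suff -> : (- (a^-1 * q)) ^+ 2 * a + 2 * - (a^-1 * q) * q + r = r - a^-1 * q ^+ 2 by [].
  by field.
suff : exists G : 'M[R]_(1 + n), M' = G *m G^T by [].
exists (block_mx (Num.sqrt a)%:M 0 ((Num.sqrt a)^-1 *: b) G').
rewrite ME tr_block_mx mulmx_block.
rewrite !tr_scalar_mx !trmx0 !mulmx0 !mul0mx !addr0 -scalar_mxM -expr2 sqr_sqrtr//.
congr block_mx.
- by rewrite mul_scalar_mx linearZ/= scalerA -[in LHS]aab linearZ.
- by rewrite mul_mx_scalar scalerA aab.
- rewrite -G'E /D' linearZ/= -scalemxAl -scalemxAr scalerA -invfM -expr2 sqr_sqrtr//.
  by rewrite addrC subrK.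
Qed.

End psd_factor.

Section gaussian_existence.
Context {R : realType}.

(** Each coordinate adds one real factor to the probability space. In dimension 0 any probability
    space would do; the real line is at hand. *)
Lemma ex_std_gauss_vec N : exists (d : measure_display) (T : measurableType d)
  (P : probability T R) (xi : T -> 'cV[R]_N), gauss_vec P xi 0 1%:M.
Proof.
elim: N => [|N [d [T [P [xi gxi]]]]].
  exists _, (measurableTypeR R), (normal_prob 0 1), (fun=> 0) => u.
  have -> : u = 0 by apply/matrixP => -[].
  rewrite !trmx0 !mul0mx mxE; split => //.
  move=> B mB; rewrite eqxx.
  rewrite preimage_cst indicE; case: ifP => _; last by rewrite measure0.
  by rewrite probability_setT.
exists _, (T * measurableTypeR R)%type, (pprod P (normal_prob 0 1)),
  (fun z => col_mx (z.2)%:M (xi z.1) : 'cV[R]_(1 + N)) => u.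
have gid : gauss_rv (normal_prob 0 1 : probability (measurableTypeR R) R) id 0 1.
  by split => // B mB; rewrite oner_eq0 sqrtr1.
pose u' : 'cV[R]_(1 + N) := u.
have := gauss_rv_pprod (gauss_rv_lin gxi (dsubmx u')^T) (gauss_rv_scale (usubmx u' 0 0) gid).
rewrite mulmx0 trmxK.
have uE : u' = col_mx (usubmx u') (dsubmx u') by rewrite vsubmxK.
have -> : ((dsubmx u')^T *m 1%:M *m dsubmx u') 0 0 + usubmx u' 0 0 ^+ 2 * 1 =
    (u'^T *m 1%:M *m u') 0 0.
  rewrite !mulmx1 [in RHS]uE tr_col_mx mul_row_col [RHS]mxE.
  rewrite addrC; congr (_ + _); rewrite mulr1 [usubmx u']mx11E tr_scalar_mx.
  by rewrite -scalar_mxM !mxE/= !mulr1n.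
rewrite [X in _ -> gauss_rv _ _ X _]mxE.
congr gauss_rv; apply/funext => z.
have -> : (u^T *m col_mx (z.2)%:M (xi z.1)) 0 0 =
    (u'^T *m (col_mx (z.2)%:M (xi z.1) : 'cV_(1 + N))) 0 0 by [].
rewrite [in RHS]uE tr_col_mx mul_row_col [RHS]mxE addrC; congr (_ + _).
by rewrite [usubmx u']mx11E tr_scalar_mx -scalar_mxM !mxE/= !mulr1n.
Qed.

Lemma ex_gauss_vec N (Sig : 'M[R]_N) : psd Sig ->
  exists (d : measure_display) (T : measurableType d)
    (P : probability T R) (xi : T -> 'cV[R]_N), gauss_vec P xi 0 Sig.
Proof.
move=> /psd_factor[G ->].
have [d [T [P [xi gxi]]]] := ex_std_gauss_vec N.
exists d, T, P, (fun w => G *m xi w) => u.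
have := gxi (G^T *m u); rewrite !mulmx0 mulmx1 trmx_mul trmxK !mulmxA.
by congr gauss_rv; apply/funext => w; rewrite mulmxA.
Qed.

End gaussian_existence.

(** * Conditional independence *)

Section pair_law.
Context {R : realType} d d' (T : measurableType d) (T' : measurableType d').
Variables (P : probability T R) (P' : probability T' R).
Variables (X Y : T -> R) (X' Y' : T' -> R).
Hypotheses (mX : measurable_fun setT X) (mY : measurable_fun setT Y).
Hypotheses (mX' : measurable_fun setT X') (mY' : measurable_fun setT Y').
Hypothesis XY : forall B D : set R, measurable B -> measurable D ->
  P (X @^-1` B `&` Y @^-1` D) = P' (X' @^-1` B `&` Y' @^-1` D).

Let mXY : measurable_fun setT (fun w => (X w, Y w)).
Proof. exact: measurable_fun_pair. Qed.
Let mXY' : measurable_fun setT (fun w => (X' w, Y' w)).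
Proof. exact: measurable_fun_pair. Qed.

Lemma eq_pair_law (A : set (R * R)) : measurable A ->
  P ((fun w => (X w, Y w)) @^-1` A) = P' ((fun w => (X' w, Y' w)) @^-1` A).
Proof.
move=> mA.
have mp d0 (U : measurableType d0) (F : U -> R * R) (D : set (R * R)) :
    measurable_fun setT F -> measurable D -> measurable (F @^-1` D).
  by move=> mF mD; rewrite -[X in measurable X]setTI; exact: mF.
pose PP (A : set (R * R)) :=
  P ((fun w => (X w, Y w)) @^-1` A) = P' ((fun w => (X' w, Y' w)) @^-1` A).
refine (@dynkin_induction _ (R * R)%type _ PP (@measurable_prod_measurableType _ _ R R) _ _ _ _ _ A _).
- move=> _ _ [B1 mB1 [D1 mD1 <-]] [B2 mB2 [D2 mD2 <-]].
  exists (B1 `&` B2); first exact: measurableI.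
  exists (D1 `&` D2); first exact: measurableI.
  by apply/seteqP; split => z /=; [move=> [[? ?] [? ?]]|move=> [[? ?] [? ?]]].
- by rewrite /PP !preimage_setT; apply: etrans (probability_setT P) (esym (probability_setT P')).
- by move=> _ [B mB [D mD <-]]; exact: XY.
- move=> S mS PS.
  apply: etrans (probability_setC P (mp _ _ _ _ mXY mS)) _.
  apply: etrans _ (esym (probability_setC P' (mp _ _ _ _ mXY' mS))).
  by congr (1 - _)%E; exact: PS.
- move=> F mF tF PF; rewrite /PP !preimage_bigcup.
  rewrite !measure_bigcup//; last 4 first.
  + by move=> n _; exact: mp.
  + apply/trivIsetP => i j _ _ ij; rewrite -preimage_setI.
    by move/trivIsetP : tF => /(_ i j I I ij) ->; exact: preimage_set0.
  + by move=> n _; exact: mp.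
  + apply/trivIsetP => i j _ _ ij; rewrite -preimage_setI.
    by move/trivIsetP : tF => /(_ i j I I ij) ->; exact: preimage_set0.
  by apply: eq_eseriesr => n _; exact: PF.
- by rewrite -measurable_prod_measurableType.
Qed.

Lemma eq_pair_law_integral (h : R * R -> \bar R) : measurable_fun setT h ->
  (forall z, (0 <= h z)%E) ->
  (\int[P]_w h (X w, Y w) = \int[P']_w h (X' w, Y' w))%E.
Proof.
move=> mh h0.
transitivity (\int[pushforward P (fun w => (X w, Y w))]_z h z)%E.
  by rewrite ge0_integral_pushforward.
transitivity (\int[pushforward P' (fun w => (X' w, Y' w))]_z h z)%E.
  by apply: eq_measure_integral => A mA _; exact: eq_pair_law.
by rewrite ge0_integral_pushforward.
Qed.

Lemma eq_pair_law_integrable (h : R * R -> \bar R) : measurable_fun setT h ->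
  P.-integrable setT (fun w => h (X w, Y w)) ->
  P'.-integrable setT (fun w => h (X' w, Y' w)).
Proof.
move=> mh /integrableP[_ hoo]; apply/integrableP; split; first exact: measurableT_comp.
rewrite -(eq_pair_law_integral (h := fun z => `|h z|%E))//.
exact: measurableT_comp.
Qed.

Lemma eq_pair_law_integral_signed (h : R * R -> \bar R) : measurable_fun setT h ->
  P.-integrable setT (fun w => h (X w, Y w)) ->
  (\int[P]_w h (X w, Y w) = \int[P']_w h (X' w, Y' w))%E.
Proof.
move=> mh hi; rewrite integralE [RHS]integralE; congr (_ - _)%E.
  have h1 := eq_pair_law_integral (measurable_funepos mh) (funepos_ge0 h).
  transitivity (\int[P]_w h^\+ (X w, Y w))%E.
    by apply: eq_integral => w _; rewrite !funeposE.
  by rewrite h1; apply: eq_integral => w _; rewrite !funeposE.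
have h1 := eq_pair_law_integral (measurable_funeneg mh) (funeneg_ge0 h).
transitivity (\int[P]_w h^\- (X w, Y w))%E.
  by apply: eq_integral => w _; rewrite !funenegE.
by rewrite h1; apply: eq_integral => w _; rewrite !funenegE.
Qed.

End pair_law.

Section independent_product.
Context {R : realType} d (T : measurableType d) (P : probability T R).
Variables X Y : T -> R.
Hypotheses (iX : P.-integrable setT (EFin \o X)) (iY : P.-integrable setT (EFin \o Y)).
Hypothesis iXY : P.-integrable setT (EFin \o fun w => X w * Y w).
Hypothesis indep : forall B D : set R, measurable B -> measurable D ->
  P (X @^-1` B `&` Y @^-1` D) = (P (X @^-1` B) * P (Y @^-1` D))%E.

(** Independence says that (X, Y) has the law of (X o fst, Y o snd) under the product of [P] with
    itself, where Fubini separates the variables. *)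
Lemma integral_mul_indep :
  (\int[P]_w (X w * Y w)%:E = \int[P]_w (X w)%:E * \int[P]_w (Y w)%:E)%E.
Proof.
have mX : measurable_fun setT X by apply/measurable_EFinP; exact: measurable_int iX.
have mY : measurable_fun setT Y by apply/measurable_EFinP; exact: measurable_int iY.
have mpre (h : T -> R) (B : set R) :
    measurable_fun setT h -> measurable B -> measurable (h @^-1` B).
  by move=> mh mB; rewrite -[X in measurable X]setTI; exact: mh.
have mX1 : measurable_fun setT (X \o (fst : T * T -> T)) by exact: measurableT_comp.
have mY2 : measurable_fun setT (Y \o (snd : T * T -> T)) by exact: measurableT_comp.
have XY (B D : set R) : measurable B -> measurable D ->
    P (X @^-1` B `&` Y @^-1` D) =
    pprod P P ((X \o fst) @^-1` B `&` (Y \o snd) @^-1` D).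
  move=> mB mD; rewrite indep//; apply/esym.
  exact: (pprodE (A := X @^-1` B) (B := Y @^-1` D) P P (mpre _ _ mX mB) (mpre _ _ mY mD)).
have mh : measurable_fun setT (fun z : R * R => (z.1 * z.2)%:E).
  by apply/measurable_EFinP; exact: measurable_funM.
have int2 := eq_pair_law_integrable mX mY mX1 mY2 XY mh iXY.
apply: etrans (eq_pair_law_integral_signed mX mY mX1 mY2 XY mh iXY) _ => /=.
have := @integral12_prod_meas1 _ _ T T R P P (fun z => (X z.1 * Y z.2)%:E) int2.
move=> <-.
rewrite /fubini_F /=.
under eq_integral => x _.
  under eq_integral do rewrite EFinM.
  rewrite integralZl//.
  over.
by rewrite (ExE iY) integralZr.
Qed.

Lemma Ex_mul_indep : Ex P (fun w => X w * Y w) = Ex P X * Ex P Y.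
Proof.
apply: EFin_inj; rewrite EFinM -!ExE//; exact: integral_mul_indep.
Qed.

End independent_product.

Section finite_measure_of.
Context d (T : measurableType d) (R : realType) (mu : {measure set T -> \bar R}).

(** An alias indexed by a finiteness proof, so that the finite-measure structure required by
    Radon-Nikodym can be declared on it. *)
Definition fmeasure (_ : fin_num_fun mu) : set T -> \bar R := mu.

Variable fmu : fin_num_fun mu.
HB.instance Definition _ := Measure.on (fmeasure fmu).
HB.instance Definition _ := Measure_isFinite.Build _ _ _ (fmeasure fmu) fmu.

End finite_measure_of.

Section conditional_independence.
Context {R : realType} d (T : measurableType d) (P : probability T R).

Let gen (S : set (T -> R)) :=
  [set A | exists f, S f /\ exists B : set R, measurable B /\ A = f @^-1` B].

(** The density of P( . [&] A) with respect to [P], both restricted to [sigma_of S]. *)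
Lemma ex_cexp_version (S : set (T -> R)) (A : set T) :
  (forall f, S f -> measurable_fun setT f) -> measurable A ->
  exists Z : T -> R, cexp_version P (sigma_of S) (\1_A) Z.
Proof.
move=> mS mA.
pose T' := g_sigma_algebraType (gen S).
have sm : sigma_of S `<=` measurable by exact: sigma_of_measurable.
have mid : measurable_fun setT (id : T -> T').
  by move=> _ B mB; rewrite setTI; exact: sm.
(* Pushing forward along the identity, from the full sigma-algebra to the generated one, is
   restriction to a sub-sigma-algebra. *)
pose mu1 : {measure set T' -> \bar R} := pushforward P (id : T -> T').
pose nu1 : {measure set T' -> \bar R} := pushforward (mrestr P mA) (id : T -> T').
pose mu0 := mu1 mid; pose nu0 := nu1 mid.
have fmu : fin_num_fun mu0.
  by move=> B mB; apply: fin_num_measure; exact: sm.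
have fnu : fin_num_fun nu0.
  by move=> B mB; exact: (fin_num_measure P _ (measurableI _ _ (sm _ mB) mA)).
pose mu : {finite_measure set T' -> \bar R} := fmeasure fmu.
pose nu : {finite_measure set T' -> \bar R} := fmeasure fnu.
have numu : charge_of_finite_measure nu `<< mu.
  apply/null_content_dominatesP => B mB muB0.
  have mBT := sm _ mB.
  exact: (subset_measure0 (measurableI _ _ mBT mA) mBT (@subIsetl _ B A) (muB0 : P B = 0%E)).
pose f := Radon_Nikodym (charge_of_finite_measure nu) mu.
have ff x : f x \is a fin_num by exact: Radon_Nikodym_fin_num.
have fi : mu.-integrable setT f by exact: Radon_Nikodym_integrable.
have fE B : measurable B -> nu B = (\int[mu]_(x in B) f x)%E.
  by move=> mB; exact: Radon_Nikodym_integral numu mB.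
exists (fine \o f).
have mf : measurable_fun (setT : set T') f by exact: measurable_int fi.
have mfT : measurable_fun (setT : set T) f.
  move=> _ B mB; rewrite setTI; apply: sm.
  by have := mf measurableT B mB; rewrite setTI.
have fineK' : EFin \o (fine \o f) = f.
  by apply/funext => x /=; rewrite fineK.
have fiP : P.-integrable setT f.
  apply/integrableP; split => //.
  have /integrableP[_] := fi.
  rewrite (_ : (\int[mu]_x `|f x|)%E = (\int[pushforward P (id : T -> T')]_x `|f x|)%E)//.
  rewrite ge0_integral_pushforward//.
  exact: measurableT_comp.
split.
- by apply/integrable_indic.
- by rewrite fineK'.
- move=> B mB.
  have : measurable_fun (setT : set T') (fine \o f).
    exact: measurableT_comp.
  by move=> /(_ measurableT _ mB); rewrite setTI.
move=> B sB; have mB := sm _ sB.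
rewrite integral_indic// setIC.
transitivity (nu B); last by [].
rewrite fE//.
rewrite (_ : (\int[mu]_(x in B) f x)%E = (\int[pushforward P (id : T -> T')]_(x in B) f x)%E)//.
rewrite integral_pushforward//; last exact: integrableS fiP.
by apply: eq_integral => x _; rewrite /= fineK.
Qed.

(** The sigma-algebra of [SM] lies in that of [S1] joined with an independent [SE], and adjoining
    independent information does not change a conditional expectation. On [H] [&] [K], with [H] from
    [S1] and [K] from [SE], the integrals of [Z] and of the indicator of [A] both acquire the factor
    [P K]; a Dynkin argument does the rest. *)
Lemma cond_indep_intro (S1 S2 SE SM : set (T -> R)) :
  (forall f, S1 f -> measurable_fun setT f) ->
  (forall f, S2 f -> measurable_fun setT f) ->
  (forall f, SE f -> measurable_fun setT f) ->
  indep2 P (sigma_of SE) (sigma_of (S1 `|` S2)) ->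
  (forall f B, SM f -> measurable B -> sigma_of (S1 `|` SE) (f @^-1` B)) ->
  cond_indep P (sigma_of S1) (sigma_of S2) (sigma_of SM).
Proof.
move=> mS1 mS2 mSE ind SMsub A A2.
have s1 := sigma_of_measurable mS1; have s2 := sigma_of_measurable mS2.
have sE := sigma_of_measurable mSE.
have mA := s2 _ A2.
have [Z cZ] := ex_cexp_version mS1 mA.
exists Z; split => //.
have [i1 iZ ZG ZE] := cZ; split => //.
  by move=> B mB; apply: sub_sigma_algebra; left; exact: ZG.
have mZ : measurable_fun setT Z by apply/measurable_EFinP; exact: measurable_int iZ.
have sub : <<s sigma_of S1 `|` sigma_of SM >> `<=`
    <<s capsets (sigma_of S1) (sigma_of SE) >>.
  rewrite -sigma_of_capsets; apply: smallest_sub; first exact: smallest_sigma_algebra.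
  move=> B [B1|BM].
    by apply: sigma_ofS B1; exact: subsetUl.
  by apply: sigma_of_sub BM; [exact: smallest_sigma_algebra|exact: SMsub].
set C := capsets (sigma_of S1) (sigma_of SE) in sub *.
have mC : C `<=` measurable.
  by move=> _ [H [K [sH sK ->]]]; apply: measurableI; [exact: s1|exact: sE].
have smC : <<s C >> `<=` measurable.
  by apply: smallest_sub => //; exact: sigma_algebra_measurable.
move=> D /sub CD.
pose PP (D : set T) := (\int[P]_(w in D) (Z w)%:E = \int[P]_(w in D) (\1_A w)%:E)%E.
have iZS D' : measurable D' -> P.-integrable D' (EFin \o Z).
  by move=> mD; apply: integrableS iZ.
have i1S D' : measurable D' -> P.-integrable D' (EFin \o \1_A).
  by move=> mD; apply: integrableS i1.
refine (@dynkin_induction _ (g_sigma_algebraType C) C PP _ _ _ _ _ _ D CD) => //.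
- by apply: capsets_setI; exact: sigma_of_setI.
- by apply: ZE; exact: sigma_of_setT.
- move=> _ [H [K [sH sK ->]]]; rewrite /PP.
  have mH := s1 _ sH; have mK := sE _ sK; have mHK := measurableI _ _ mH mK.
  have indicM (h : T -> R) : (\int[P]_(w in H `&` K) (h w)%:E =
      \int[P]_w (h w * \1_H w * \1_K w)%:E)%E.
    rewrite integral_mkcond; apply: eq_integral => w _.
    rewrite patchE !indicE in_setI.
    by case: (w \in H); case: (w \in K); rewrite /= ?mulr1 ?mulr0.
  have split_indep (h : T -> R) : P.-integrable setT (EFin \o h) ->
      (forall B, measurable B -> sigma_of (S1 `|` S2) (h @^-1` B)) ->
      (\int[P]_(w in H `&` K) (h w)%:E = \int[P]_(w in H) (h w)%:E * P K)%E.
    move=> ih sh; rewrite indicM.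
    have mh : measurable_fun setT h by apply/measurable_EFinP; exact: measurable_int ih.
    have hH : (\int[P]_(w in H) (h w)%:E = \int[P]_w (h w * \1_H w)%:E)%E.
      rewrite integral_mkcond; apply: eq_integral => w _.
      by rewrite patchE !indicE; case: (w \in H); rewrite /= ?mulr1 ?mulr0.
    have ihH : P.-integrable setT (EFin \o fun w => h w * \1_H w).
      apply: le_integrable ih => //.
        apply/measurable_EFinP; apply: measurable_funM => //.
      move=> w _ /=; rewrite lee_fin normrM indicE.
      by case: (w \in H); rewrite ?normr1 ?normr0 ?mulr1 ?mulr0.
    rewrite hH (_ : P K = \int[P]_w (\1_K w)%:E)%E; last by rewrite integral_indic// setIT.
    apply: integral_mul_indep => //.
    - exact/integrable_indic.
    - apply: le_integrable ihH => //.
        apply/measurable_EFinP; apply: measurable_funM => //; exact: measurable_funM.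
      move=> w _ /=; rewrite lee_fin [X in X <= _]normrM [\1_K w]indicE.
      by case: (w \in K); rewrite ?normr1 ?normr0 ?mulr1 ?mulr0.
    move=> B E mB mE; rewrite setIC muleC; apply: ind.
      have : measurable_fun (setT : set (g_sigma_algebraType (gen SE))) (\1_K : T -> R).
        by apply: measurable_indic; exact: sK.
      by move=> /(_ measurableT _ mE); rewrite setTI.
    have : measurable_fun (setT : set (g_sigma_algebraType (gen (S1 `|` S2))))
        (fun w => h w * \1_H w).
      apply: measurable_funM; first by apply/sigma_of_measurable_fun.
      by apply: measurable_indic; apply: sigma_ofS sH; exact: subsetUl.
    by move=> /(_ measurableT _ mB); rewrite setTI.
  rewrite !split_indep//.
  + by rewrite ZE.
  + move=> B mB.
    have : measurable_fun (setT : set (g_sigma_algebraType (gen (S1 `|` S2)))) (\1_A : T -> R).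
      by apply: measurable_indic; apply: sigma_ofS A2; exact: subsetUr.
    by move=> /(_ measurableT _ mB); rewrite setTI.
  + by move=> B mB; apply: sigma_ofS (ZG _ mB); exact: subsetUl.
- move=> E CE; rewrite /PP => PE.
  have mE : measurable (E : set T) by apply: smC; exact: CE.
  have compl (h : T -> R) : P.-integrable setT (EFin \o h) ->
     (\int[P]_(w in ~` E) (h w)%:E = \int[P]_w (h w)%:E - \int[P]_(w in E) (h w)%:E)%E.
    move=> ih; rewrite -(setvU (E : set T)) integral_setU_EFin//.
    - rewrite addeK//; apply: integrable_fin_num => //.
      by apply: integrableS ih.
    - exact: measurableC.
    - by apply/measurable_EFinP; rewrite setvU; exact: measurable_int ih.
    - by apply/disj_setPS => w [].
  rewrite !compl// PE; congr (_ - _)%E.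
  by apply: ZE; exact: sigma_of_setT.
- move=> F CF tF PF; rewrite /PP.
  have mF n : measurable (F n : set T) by apply: smC; exact: CF.
  rewrite !integral_bigcup//.
  + by apply: eq_eseriesr => n _; exact: PF.
  + by apply: i1S; exact: bigcupT_measurable.
  + by apply: iZS; exact: bigcupT_measurable.
Qed.

End conditional_independence.

(** * Linear algebra of the model and of the estimator *)

Section orthogonality.
Context {R : realType} (N : nat) (Sg : 'M[R]_N).

(** Rows are linear functionals of a centred vector with covariance [Sg]; two families are [perp]
    when uncorrelated. All probabilistic orthogonality below is expressed in this form. *)
Definition perp {m n} (U : 'M[R]_(m, N)) (V : 'M[R]_(n, N)) := U *m Sg *m V^T = 0.

Lemma perpMl m n p (K : 'M[R]_(p, m)) (U : 'M[R]_(m, N)) (V : 'M[R]_(n, N)) :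
  perp U V -> perp (K *m U) V.
Proof. by rewrite /perp -!mulmxA => ->; rewrite mulmx0. Qed.

Lemma perpDl m n (U U' : 'M[R]_(m, N)) (V : 'M[R]_(n, N)) :
  perp U V -> perp U' V -> perp (U + U') V.
Proof. by rewrite /perp !mulmxDl => -> ->; rewrite addr0. Qed.

Lemma perpNl m n (U : 'M[R]_(m, N)) (V : 'M[R]_(n, N)) : perp U V -> perp (- U) V.
Proof. by rewrite /perp !mulNmx => ->; rewrite oppr0. Qed.

Lemma perpBl m n (U U' : 'M[R]_(m, N)) (V : 'M[R]_(n, N)) :
  perp U V -> perp U' V -> perp (U - U') V.
Proof. by move=> UV U'V; apply: perpDl => //; exact: perpNl. Qed.

Lemma perp0l m n (V : 'M[R]_(n, N)) : perp (0 : 'M[R]_(m, N)) V.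
Proof. by rewrite /perp !mul0mx. Qed.

Hypothesis pSg : psd Sg.

Lemma perpC m n (U : 'M[R]_(m, N)) (V : 'M[R]_(n, N)) : perp U V -> perp V U.
Proof.
by rewrite /perp => UV; apply: trmx_inj; rewrite !trmx_mul trmxK pSg.1 mulmxA UV trmx0.
Qed.

Lemma perpMr m n p (K : 'M[R]_(p, n)) (U : 'M[R]_(m, N)) (V : 'M[R]_(n, N)) :
  perp U V -> perp U (K *m V).
Proof. by move=> /perpC UV; apply/perpC/perpMl. Qed.

Lemma perpDr m n (U : 'M[R]_(m, N)) (V V' : 'M[R]_(n, N)) :
  perp U V -> perp U V' -> perp U (V + V').
Proof. by move=> /perpC UV /perpC UV'; apply/perpC/perpDl. Qed.

Lemma perpBr m n (U : 'M[R]_(m, N)) (V V' : 'M[R]_(n, N)) :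
  perp U V -> perp U V' -> perp U (V - V').
Proof. by move=> /perpC UV /perpC UV'; apply/perpC/perpBl. Qed.

Lemma trmx_mul_eq0 m n (X : 'M[R]_(m, n)) : X^T *m X = 0 -> X = 0.
Proof.
move=> XX; apply/matrixP => i j; rewrite mxE.
have /matrixP/(_ j j) := XX; rewrite !mxE => /eqP.
rewrite psumr_eq0; last by move=> k _; rewrite !mxE -expr2 sqr_ge0.
by move=> /allP/(_ i (mem_index_enum _))/=; rewrite !mxE -expr2 sqrf_eq0 => /eqP.
Qed.

(* Coefficients of an orthogonal projection onto the row span of W; solvability of
   the normal equations does not require W Sg W^T to be invertible. *)
Definition pcoef p m (W : 'M[R]_(p, N)) (U : 'M[R]_(m, N)) : 'M[R]_(m, p) :=
  U *m Sg *m W^T *m pinvmx (W *m Sg *m W^T).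

(** With Sg = G G^T and B = W Sg W^T, a kernel vector c of B satisfies |G^T W^T c|^2 = c^T B c = 0.
    Hence U Sg W^T kills the kernel of B, its rows lie in the row space of B, and the pseudo-inverse
    solves the normal equations. *)
Lemma perp_pcoef p m (W : 'M[R]_(p, N)) (U : 'M[R]_(m, N)) :
  perp (U - pcoef W U *m W) W.
Proof.
rewrite /perp !mulmxBl; apply/eqP; rewrite subr_eq0; apply/eqP.
rewrite /pcoef; set B := W *m Sg *m W^T.
have -> : U *m Sg *m W^T *m pinvmx B *m W *m Sg *m W^T = U *m Sg *m W^T *m pinvmx B *m B.
  by rewrite /B !mulmxA.
rewrite mulmxKpV//.
have [G GE] := psd_factor pSg.
rewrite submxE; have := mulmx_coker B; move: (cokermx B) => c Bc.
suff Gc : G^T *m W^T *m c = 0.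
  by apply/eqP; rewrite GE -!mulmxA [G^T *m _]mulmxA Gc !mulmx0.
apply: trmx_mul_eq0; rewrite !trmx_mul !trmxK.
have -> : c^T *m (W *m G) *m (G^T *m W^T *m c) = c^T *m (B *m c).
  by rewrite /B GE !mulmxA.
by rewrite Bc mulmx0.
Qed.

End orthogonality.

(** * Stacked vectors and block selectors *)

Section stacking.
Context {R : realType}.

Definition stackm k n N (f : nat -> 'M[R]_(n, N)) : 'M[R]_(k * n, N) :=
  \matrix_(a, c) stack (fun j : 'I_k => col c (f j)) a 0.

Lemma stackE k n (f : 'I_k -> 'cV[R]_n) j i : stack f (mxvec_index j i) 0 = f j i 0.
Proof. by rewrite /stack mxE mxvecE !mxE. Qed.

Lemma stackmE k n N (f : nat -> 'M[R]_(n, N)) (j : 'I_k) i c :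
  stackm k f (mxvec_index j i) c = f j i c.
Proof. by rewrite mxE stackE mxE. Qed.

Lemma row_stackm k n N (f : nat -> 'M[R]_(n, N)) (j : 'I_k) i :
  row (mxvec_index j i) (stackm k f) = row i (f j).
Proof. by apply/rowP => c; rewrite mxE stackmE mxE. Qed.

Lemma stackmM k n N m (f : nat -> 'M[R]_(n, N)) (B : 'M[R]_(N, m)) :
  stackm k f *m B = stackm k (fun j => f j *m B).
Proof.
apply/row_matrixP => a; case/mxvec_indexP: a => j i.
by rewrite row_mul !row_stackm row_mul.
Qed.

Lemma stackp_lin Omega k n N (f : nat -> 'M[R]_(n, N)) (xi : Omega -> 'cV[R]_N) w :
  stackp (fun j w => f j *m xi w) k w = stackm k f *m xi w.
Proof.
rewrite stackmM; apply/matrixP => a b; rewrite ord1.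
by case/mxvec_indexP: a => j i; rewrite stackmE stackE.
Qed.

Lemma stackm_eq0 k n N (f : nat -> 'M[R]_(n, N)) :
  stackm k f = 0 <-> forall j, (j < k)%N -> f j = 0.
Proof.
split=> [f0 j jk|f0].
  by apply/row_matrixP => i; rewrite -(row_stackm f (Ordinal jk)) f0 !row0.
apply/row_matrixP => a; case/mxvec_indexP: a => j i.
by rewrite row_stackm f0// !row0.
Qed.

Lemma perp_stackm (N : nat) (Sg : 'M[R]_N) k n m (f : nat -> 'M[R]_(n, N)) (V : 'M[R]_(m, N)) :
  perp Sg (stackm k f) V <-> forall j, (j < k)%N -> perp Sg (f j) V.
Proof. by rewrite /perp !stackmM stackm_eq0. Qed.

Lemma eq_stackm k n N (f g : nat -> 'M[R]_(n, N)) :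
  (forall j, (j < k)%N -> f j = g j) -> stackm k f = stackm k g.
Proof.
move=> fg; apply/row_matrixP => a; case/mxvec_indexP: a => j i.
by rewrite !row_stackm fg.
Qed.

Variable T : nat.

(** The projection of a stacked vector onto block [k]. It is made total by [inord], so its
    properties are stated for [k <= T]. *)
Definition slot n (k : nat) : 'M[R]_(n, T.+1 * n) :=
  \matrix_(i, a) (a == mxvec_index (inord k : 'I_T.+1) i)%:R.

Lemma row_slot n k i : row i (slot n k) = delta_mx 0 (mxvec_index (inord k) i).
Proof. by apply/rowP => a; rewrite !mxE eqxx. Qed.

Lemma slot_stackm n N (f : nat -> 'M[R]_(n, N)) k : (k <= T)%N ->
  slot n k *m stackm T.+1 f = f k.
Proof.
move=> kT; apply/row_matrixP => i.
by rewrite row_mul row_slot -rowE row_stackm inordK.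
Qed.

Lemma stackm_slot n : stackm T.+1 (slot n) = 1%:M.
Proof.
apply/row_matrixP => a; case/mxvec_indexP: a => j i.
by rewrite row_stackm row_slot inord_val row1.
Qed.

Lemma slot_stack n (f : nat -> 'cV[R]_n) k : (k <= T)%N ->
  slot n k *m stack (fun j : 'I_T.+1 => f j) = f k.
Proof.
move=> kT; have -> : stack (fun j : 'I_T.+1 => f j) = stackm T.+1 f.
  apply/matrixP => a b; rewrite ord1; case/mxvec_indexP: a => j i.
  by rewrite stackE stackmE.
exact: slot_stackm.
Qed.

Lemma slot_orth n j k : (j <= T)%N -> (k <= T)%N ->
  slot n j *m (slot n k)^T = if j == k then 1%:M else 0.
Proof.
move=> jT kT; apply/matrixP => i i'; rewrite !mxE.
under eq_bigr do rewrite !mxE.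
rewrite (bigD1 (mxvec_index (inord j) i))//= eqxx mul1r big1; last first.
  by move=> a /negbTE ->; rewrite mul0r.
rewrite addr0; case: (eqVneq j k) => [->|jk].
  rewrite mxE; congr (nat_of_bool _)%:R.
  by rewrite /mxvec_index (inj_eq (@cast_ord_inj _ _ _)) (inj_eq enum_rank_inj) xpair_eqE eqxx.
rewrite mxE /mxvec_index (inj_eq (@cast_ord_inj _ _ _)) (inj_eq enum_rank_inj) xpair_eqE.
by rewrite -(inj_eq val_inj)/= !inordK// (negbTE jk).
Qed.

Definition bdiag n (Q : nat -> 'M[R]_n) : 'M[R]_(T.+1 * n) :=
  \sum_(k < T.+1) (slot n k)^T *m Q k *m slot n k.

Lemma slot_bdiag n (Q : nat -> 'M[R]_n) j k : (j <= T)%N -> (k <= T)%N ->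
  slot n j *m bdiag Q *m (slot n k)^T = if j == k then Q j else 0.
Proof.
move=> jT kT; rewrite /bdiag mulmx_sumr mulmx_suml.
rewrite (bigD1 (Ordinal (jT : (j < T.+1)%N)))//= big1 ?addr0.
  rewrite !mulmxA (slot_orth _ jT jT) eqxx mul1mx -mulmxA (slot_orth _ jT kT).
  by case: eqVneq; rewrite ?mulmx1 ?mulmx0.
move=> i /negbTE ij; rewrite !mulmxA (slot_orth _ jT (ltn_ord i)).
by rewrite -(inj_eq val_inj)/= eq_sym in ij; rewrite ij !mul0mx.
Qed.

Lemma psd_bdiag n (Q : nat -> 'M[R]_n) : (forall k, (k <= T)%N -> psd (Q k)) ->
  psd (bdiag Q).
Proof.
move=> pQ; split.
  rewrite /bdiag linear_sum; apply: eq_bigr => k _.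
  by rewrite /= !trmx_mul trmxK (pQ k (ltn_ord k)).1 mulmxA.
move=> u; rewrite /bdiag mulmx_sumr mulmx_suml summxE sumr_ge0// => k _.
have := (pQ k (ltn_ord k)).2 (slot n k *m u).
by rewrite trmx_mul !mulmxA.
Qed.

Lemma slot_resolution n :
  \sum_(k < T.+1) (slot n k)^T *m slot n k = 1%:M :> 'M[R]_(T.+1 * n).
Proof.
set X := \sum_k _.
rewrite -[LHS]mul1mx -stackm_slot stackmM; apply: eq_stackm => j jT.
rewrite mulmx_sumr (bigD1 (Ordinal jT))//= big1 ?addr0.
  by rewrite mulmxA slot_orth// eqxx mul1mx.
move=> i /negbTE ij; rewrite mulmxA (slot_orth _ (jT : (j <= T)%N) (ltn_ord i : (i <= T)%N)).
by rewrite -(inj_eq val_inj)/= eq_sym in ij; rewrite ij mul0mx.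
Qed.

End stacking.

(** * Coefficients and covariances of the state-space model *)

Section model_algebra.
Context {R : realType} (nx ny T : nat).
Variables (A : nat -> 'M[R]_nx) (C : nat -> 'M[R]_(ny, nx)).
Variables (Q : nat -> 'M[R]_nx) (Rn : nat -> 'M[R]_ny).

(* Coefficients of q_k, r_k, x_k, y_k with respect to (q_0..q_T, r_0..r_T). *)
Definition Nm := (T.+1 * nx + T.+1 * ny)%N.
Definition qm k : 'M[R]_(nx, Nm) := row_mx (slot T nx k) 0.
Definition rm k : 'M[R]_(ny, Nm) := row_mx 0 (slot T ny k).

(** The noise vector is rebuilt from its blocks; this later shows that the noise is measurable with
    respect to the states and observations. *)
Lemma model_resolution (v : 'cV[R]_Nm) :
  \sum_(k < T.+1) (qm k)^T *m (qm k *m v) + \sum_(k < T.+1) (rm k)^T *m (rm k *m v) = v.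
Proof.
rewrite -[v]vsubmxK /qm /rm.
under eq_bigr do rewrite mul_row_col mul0mx addr0 tr_row_mx trmx0 mul_col_mx mul0mx mulmxA.
under [X in _ + X]eq_bigr do rewrite mul_row_col mul0mx add0r tr_row_mx trmx0 mul_col_mx mul0mx mulmxA.
rewrite -[LHS]vsubmxK; congr col_mx.
  rewrite [LHS]linearD/= !linear_sum/= [X in _ + X]big1 ?addr0; last first.
    by move=> k _; rewrite col_mxKu.
  under eq_bigr do rewrite col_mxKu.
  by rewrite -mulmx_suml slot_resolution mul1mx.
rewrite [LHS]linearD/= !linear_sum/= [X in X + _]big1 ?add0r; last first.
  by move=> k _; rewrite col_mxKd.
under eq_bigr do rewrite col_mxKd.
by rewrite -mulmx_suml slot_resolution mul1mx.
Qed.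

Definition Sm : 'M[R]_Nm := block_mx (bdiag T Q) 0 0 (bdiag T Rn).
Fixpoint xm k : 'M[R]_(nx, Nm) := if k is k'.+1 then A k *m xm k' + qm k else qm 0.
Definition ym k : 'M[R]_(ny, Nm) := C k *m xm k + rm k.

Lemma qm_cov j k : (j <= T)%N -> (k <= T)%N ->
  qm j *m Sm *m (qm k)^T = if j == k then Q j else 0.
Proof.
move=> jT kT; rewrite /qm /Sm tr_row_mx mul_row_block mul_row_col.
by rewrite !trmx0 !mulmx0 ?mul0mx !addr0 slot_bdiag.
Qed.

Lemma rm_cov j k : (j <= T)%N -> (k <= T)%N ->
  rm j *m Sm *m (rm k)^T = if j == k then Rn j else 0.
Proof.
move=> jT kT; rewrite /rm /Sm tr_row_mx mul_row_block mul_row_col.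
by rewrite !trmx0 !mulmx0 ?mul0mx !add0r slot_bdiag.
Qed.

Lemma rm_qm j k : perp Sm (rm j) (qm k).
Proof.
rewrite /perp /rm /qm /Sm tr_row_mx mul_row_block mul_row_col.
by rewrite !trmx0 !mulmx0 !mul0mx !add0r ?mulmx0 ?mul0mx ?addr0.
Qed.

Hypotheses (hQ : forall k, (k <= T)%N -> psd (Q k)) (hR : forall k, (k <= T)%N -> psd (Rn k)).

Lemma psd_Sm : psd Sm.
Proof.
have [sQ pQ] := psd_bdiag hQ; have [sR pR] := psd_bdiag hR.
split; first by rewrite tr_block_mx !trmx0 sQ sR.
move=> u; rewrite -[u]vsubmxK tr_col_mx mul_row_block mul_row_col.
by rewrite !mulmx0 addr0 add0r mxE addr_ge0.
Qed.

Lemma qm_xm j k : (j < k <= T)%N -> perp Sm (qm k) (xm j).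
Proof.
have pS := psd_Sm; move=> /andP[jk kT].
elim: j jk => [|j IH] jk /=.
  by rewrite /perp qm_cov// gtn_eqF.
apply: perpDr => //.
  by apply: perpMr => //; apply: IH; exact: ltnW.
by rewrite /perp qm_cov ?gtn_eqF// ltnW// (leq_trans jk).
Qed.

Lemma rm_xm j k : perp Sm (rm k) (xm j).
Proof.
have pS := psd_Sm; elim: j => [|j IH] /=; first exact: rm_qm.
by apply: perpDr => //; [exact: perpMr|exact: rm_qm].
Qed.

Lemma rm_ym j k : (j < k <= T)%N -> perp Sm (rm k) (ym j).
Proof.
have pS := psd_Sm; move=> /andP[jk kT]; apply: perpDr => //.
  by apply: perpMr => //; exact: rm_xm.
by rewrite /perp rm_cov ?gtn_eqF// ltnW// (leq_trans jk).
Qed.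

(** Functionals of the model about which y_0..y_k carry no information, later noises among them; a
    causal xh_k is uncorrelated with all of them. *)
Definition causal_upto k m (u : 'M[R]_(m, Nm)) := forall j, (j <= k)%N -> perp Sm u (ym j).

Definition SX : 'M[R]_(T.+1 * nx) := stackm T.+1 xm *m Sm *m (stackm T.+1 xm)^T.

Lemma slot_SX j k : (j <= T)%N -> (k <= T)%N ->
  slot T nx j *m SX *m (slot T nx k)^T = xm j *m Sm *m (xm k)^T.
Proof.
move=> jT kT; rewrite /SX !mulmxA slot_stackm// -!mulmxA -trmx_mul slot_stackm//.
Qed.

(* The joint covariances of (xh_0..xh_T) and the model that admissible estimators can realise. *)
Definition feasible (M : 'M[R]_(T.+1 * nx, Nm)) :=
  psd (block_mx SX M M^T Sm) /\
  forall k (u : 'rV[R]_Nm), (k <= T)%N -> causal_upto k u ->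
    slot T nx k *m M *m u^T = 0.

End model_algebra.

(** * Innovations, unutilized information and residual noise as orthogonal projections *)

Section estimator_algebra.
Context {R : realType} (nx ny T : nat).
Variables (A : nat -> 'M[R]_nx) (C : nat -> 'M[R]_(ny, nx)).
Variables (Q : nat -> 'M[R]_nx) (Rn : nat -> 'M[R]_ny).
Hypotheses (hQ : forall k, (k <= T)%N -> psd (Q k)) (hR : forall k, (k <= T)%N -> psd (Rn k)).
Local Notation Nm := (Nm nx ny T).
Local Notation Sm := (Sm T Q Rn).
Local Notation xm := (xm (nx := nx) ny T A).
Local Notation ym := (ym (nx := nx) (ny := ny) T A C).
Local Notation qm := (qm nx ny T).
Local Notation rm := (rm nx ny T).

Variables (N : nat) (Sg : 'M[R]_N) (L : 'M[R]_(Nm, N)) (H : nat -> 'M[R]_(nx, N)).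
Hypothesis pSg : psd Sg.
Hypothesis SgL : L *m Sg *m L^T = Sm.
Hypothesis SgH : forall j k, (j <= T)%N -> (k <= T)%N ->
  H j *m Sg *m (H k)^T = xm j *m Sm *m (xm k)^T.
Hypothesis SgHL : forall k (u : 'rV[R]_Nm), (k <= T)%N ->
  causal_upto A C Q Rn k u -> perp Sg (H k) (u *m L).

(** From here every random variable is a coefficient matrix over one vector with covariance [Sg]:
    [L] embeds the model noise, [H k] is the estimate. Projections stand for conditional
    expectations, which they are once the vector is Gaussian. *)
Definition Xm k := xm k *m L.
Definition Ym k := ym k *m L.
Definition xpm k := pcoef Sg (stackm k Ym) (Xm k) *m stackm k Ym.
Definition innovm k := if k is 0 then Ym 0 else Ym k - C k *m xpm k.
Definition Jm k := if k is k'.+1 then H k - A k *m H k' else H 0.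
Definition Ecm k := pcoef Sg (stackm k H) (stackm k innovm) *m stackm k H.
Definition upsm k := stackm k innovm - Ecm k.
Definition picoef k := lsubmx (pcoef Sg (col_mx (innovm k) (upsm k)) (Jm k)).
Definition phicoef k := rsubmx (pcoef Sg (col_mx (innovm k) (upsm k)) (Jm k)).
Definition wm k := Jm k - picoef k *m innovm k - phicoef k *m upsm k.

Lemma perpL m n (u : 'M[R]_(m, Nm)) (v : 'M[R]_(n, Nm)) :
  perp Sg (u *m L) (v *m L) <-> perp Sm u v.
Proof.
rewrite /perp trmx_mul !mulmxA.
have -> : u *m L *m Sg *m L^T = u *m (L *m Sg *m L^T) by rewrite !mulmxA.
by rewrite SgL.
Qed.

Lemma perpHL m k (u : 'M[R]_(m, Nm)) : (k <= T)%N ->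
  causal_upto A C Q Rn k u -> perp Sg (H k) (u *m L).
Proof.
move=> kT cu; apply: perpC => //; apply/row_matrixP => i; rewrite row0 !row_mul.
apply: perpC => //; apply: SgHL => // j jk.
by have /row_matrixP/(_ i) := cu j jk; rewrite row0 !row_mul.
Qed.

Lemma xpm_perp k j : (j < k)%N -> perp Sg (Xm k - xpm k) (Ym j).
Proof.
move=> jk; apply: perpC => //.
by move: j jk; apply/perp_stackm; apply: perpC => //; exact: perp_pcoef.
Qed.

(** The innovation is C_k times the prediction error of x_k, plus r_k; both are orthogonal to the
    earlier observations. *)
Lemma Im_perp_Ym k j : (j < k <= T)%N -> perp Sg (innovm k) (Ym j).
Proof.
case: k => [|k] jk; first by rewrite ltn0 in jk.
rewrite /innovm.
have -> : Ym k.+1 - C k.+1 *m xpm k.+1 = C k.+1 *m (Xm k.+1 - xpm k.+1) + rm k.+1 *m L.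
  by rewrite /Ym /Xm /ym mulmxDl mulmxBr !mulmxA addrAC.
apply: perpDl; last by apply/perpL; exact: rm_ym.
by apply: perpMl; apply: xpm_perp; case/andP: jk.
Qed.

Lemma Ym_Im k : Ym k = innovm k + (if k is 0 then 0 else C k *m xpm k).
Proof. by case: k => [|k]; rewrite /innovm ?addr0// subrK. Qed.

Lemma xpm_model k : exists K, xpm k = K *m L.
Proof.
exists (pcoef Sg (stackm k Ym) (Xm k) *m stackm k ym).
by rewrite /xpm -mulmxA stackmM.
Qed.

Lemma Im_model k : exists K, innovm k = K *m L.
Proof.
case: k => [|k]; first by exists (ym 0).
have [K KE] := xpm_model k.+1; exists (ym k.+1 - C k.+1 *m K).
by rewrite /innovm KE mulmxBl mulmxA.
Qed.

Lemma perp_Ym_Im m (V : 'M[R]_(m, N)) k :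
  (forall j, (j <= k)%N -> perp Sg (Ym j) V) -> perp Sg (innovm k) V.
Proof.
case: k => [|k] h; first exact: h.
apply: perpBl; first exact: h.
apply/perpMl/perpMl/perp_stackm => j jk; apply: h; exact: ltnW.
Qed.

(** Observations and innovations up to time [k] span the same space: y_j is the j-th innovation plus
    a combination of earlier observations, whence the strong induction. *)
Lemma perp_Im_Ym m (V : 'M[R]_(m, N)) k :
  (forall j, (j <= k)%N -> perp Sg (innovm j) V) ->
  forall j, (j <= k)%N -> perp Sg (Ym j) V.
Proof.
move=> h; elim/ltn_ind => j IH jk; rewrite Ym_Im; apply: perpDl; first exact: h.
case: j IH jk => [|j] IH jk; first exact: perp0l.
apply/perpMl/perpMl/perp_stackm => i ij; apply: IH => //.
exact: leq_trans (ltnW ij) jk.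
Qed.

(** A later innovation is a model functional orthogonal to y_0..y_j, hence invisible to a causal
    estimate at time [j]. *)
Lemma Im_perp_H k j : (j < k <= T)%N -> perp Sg (innovm k) (H j).
Proof.
move=> /andP[jk kT]; have [K KE] := Im_model k; apply: perpC => //; rewrite KE.
apply: perpHL; first exact: ltnW (leq_trans jk kT).
move=> i ij; apply/perpL; rewrite -KE; apply: Im_perp_Ym.
by rewrite kT (leq_ltn_trans ij jk).
Qed.

Lemma Im_perp_Im k j : (j < k <= T)%N -> perp Sg (innovm k) (innovm j).
Proof.
move=> /andP[jk kT]; apply: perpC => //; apply: perp_Ym_Im => i ij.
by apply: perpC => //; apply: Im_perp_Ym; rewrite kT (leq_ltn_trans ij jk).
Qed.

Lemma upsm_perp_H k j : (j < k)%N -> perp Sg (upsm k) (H j).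
Proof.
move=> jk; apply: perpC => //.
by move: j jk; apply/perp_stackm; apply: perpC => //; exact: perp_pcoef.
Qed.

(** The unutilized information is built from innovations and estimates before time [k]. This
    orthogonality removes the cross terms from the covariance of w_k. *)
Lemma upsm_perp_Im k : (k <= T)%N -> perp Sg (upsm k) (innovm k).
Proof.
move=> kT; apply: perpBl.
  by apply/perp_stackm => j jk; apply: perpC => //; apply: Im_perp_Im; rewrite jk.
apply: perpMl; apply/perp_stackm => j jk; apply: perpC => //.
by apply: Im_perp_H; rewrite jk.
Qed.

(** The estimates have the second moments of the states, so their increment behaves like q_k:
    orthogonal to the past and, next, of covariance [Q k]. *)
Lemma Jm_perp_H k j : (j < k <= T)%N -> perp Sg (Jm k) (H j).
Proof.
case: k => [|k]; first by rewrite ltn0.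
move=> /andP[jk kT]; rewrite /perp /Jm !mulmxBl -!mulmxA.
have jT : (j <= T)%N := leq_trans (ltnW jk) kT.
rewrite !(mulmxA (H _)) SgH// SgH//; last exact: ltnW.
have := @qm_xm R nx ny T A Q Rn hQ hR j k.+1; rewrite jk => /(_ kT).
rewrite /perp => h; rewrite /= !mulmxDl h addr0 !mulmxA subrr//.
Qed.

Lemma Jm_cov k : (k <= T)%N -> Jm k *m Sg *m (Jm k)^T = Q k.
Proof.
have pS := psd_Sm hQ hR.
case: k => [|k] kT; first by rewrite /Jm SgH// qm_cov.
have k'T : (k <= T)%N := ltnW kT.
have JH : Jm k.+1 *m Sg *m (H k)^T = 0 by apply: Jm_perp_H; rewrite ltnSn.
have -> : Jm k.+1 *m Sg *m (Jm k.+1)^T = Jm k.+1 *m Sg *m (H k.+1)^T.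
  rewrite {2}/Jm linearB/= mulmxBr trmx_mul mulmxA JH mul0mx subr0//.
rewrite /Jm !mulmxBl -!mulmxA !(mulmxA (H _)) !SgH//=.
rewrite linearD/= trmx_mul !mulmxDr !mulmxDl !mulmxA.
have h : perp Sm (qm k.+1) (xm k) by apply: qm_xm => //; rewrite ltnSn.
have h' : perp Sm (xm k) (qm k.+1) by exact: perpC.
move: h h'; rewrite /perp => h h'.
rewrite h mul0mx addr0.
rewrite (_ : A k.+1 *m xm k *m Sm *m (qm k.+1)^T = 0); last by rewrite -2!(mulmxA (A k.+1)) h' mulmx0.
by rewrite !addr0 add0r (qm_cov _ _ kT kT) eqxx addrAC addrN add0r.
Qed.

Lemma Jm_perpL m k (u : 'M[R]_(m, Nm)) : (k <= T)%N ->
  causal_upto A C Q Rn k u -> perp Sg (Jm k) (u *m L).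
Proof.
case: k => [|k] kT cu; first exact: perpHL.
apply: perpBl; first exact: perpHL.
apply: perpMl; apply: perpHL; first exact: ltnW.
by move=> j jk; apply: cu; exact: leqW.
Qed.

Lemma pcoef_split k : pcoef Sg (col_mx (innovm k) (upsm k)) (Jm k) *m col_mx (innovm k) (upsm k) =
  picoef k *m innovm k + phicoef k *m upsm k.
Proof. by rewrite -mul_row_col hsubmxK. Qed.

Lemma wm_perp_col k : perp Sg (wm k) (col_mx (innovm k) (upsm k)).
Proof.
rewrite (_ : wm k = Jm k - pcoef Sg (col_mx (innovm k) (upsm k)) (Jm k) *m col_mx (innovm k) (upsm k)).
  exact: perp_pcoef.
by rewrite pcoef_split /wm opprD addrA.
Qed.

Lemma wm_perp_Imk k : perp Sg (wm k) (innovm k).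
Proof.
have := wm_perp_col k; rewrite /perp tr_col_mx mul_mx_row => /eqP.
by rewrite -[X in _ == X]row_mx0 => /eqP/eq_row_mx[].
Qed.

Lemma wm_perp_ups k : perp Sg (wm k) (upsm k).
Proof.
have := wm_perp_col k; rewrite /perp tr_col_mx mul_mx_row => /eqP.
by rewrite -[X in _ == X]row_mx0 => /eqP/eq_row_mx[].
Qed.

Lemma wm_perp_H k j : (j < k <= T)%N -> perp Sg (wm k) (H j).
Proof.
move=> jk; apply: perpBl; first apply: perpBl.
- exact: Jm_perp_H.
- by apply: perpMl; exact: Im_perp_H.
- by apply: perpMl; apply: upsm_perp_H; case/andP: jk.
Qed.

(** For [j < k], the innovations before time [k] are the unutilized information plus a combination
    of past estimates, and w_k is orthogonal to both. *)
Lemma wm_perp_Im k j : (j <= k <= T)%N -> perp Sg (wm k) (innovm j).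
Proof.
rewrite leq_eqVlt => /andP[/orP[/eqP ->|jk] kT]; first exact: wm_perp_Imk.
apply: perpC => //; move: j jk; apply/perp_stackm; apply: perpC => //.
rewrite -(subrK (Ecm k) (stackm k innovm)); apply: perpDr => //; first exact: wm_perp_ups.
apply: perpMr => //; apply: perpC => //; apply/perp_stackm => j jk; apply: perpC => //.
by apply: wm_perp_H; rewrite jk.
Qed.

(** Projecting on y_0..y_k splits any functional of the model, future included, into a part
    generated by these observations and a part invisible to them. *)
Lemma causal_resid k (u : 'rV[R]_Nm) : exists (K : 'M[R]_(1, k.+1 * ny)) (e : 'rV[R]_Nm),
  causal_upto A C Q Rn k e /\ u *m L = K *m stackm k.+1 Ym + e *m L.
Proof.
pose K := pcoef Sg (stackm k.+1 Ym) (u *m L).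
have KE : K *m stackm k.+1 Ym = K *m stackm k.+1 ym *m L by rewrite -mulmxA stackmM.
exists K, (u - K *m stackm k.+1 ym); split; last by rewrite mulmxBl -KE addrC subrK.
move=> j jk; apply/perpL; rewrite mulmxBl -KE; apply: perpC => //.
by move: (j) (jk : (j < k.+1)%N); apply/perp_stackm; apply: perpC => //; exact: perp_pcoef.
Qed.

Lemma perpL_upsm m k (e : 'M[R]_(m, Nm)) : (k <= T)%N -> causal_upto A C Q Rn k e ->
  perp Sg (upsm k) (e *m L).
Proof.
move=> kT ce; apply: perpBl.
  apply/perp_stackm => j jk; apply: perp_Ym_Im => i ij.
  apply: perpC => //; apply/perpL; apply: ce; exact: leq_trans ij (ltnW jk).
apply: perpMl; apply/perp_stackm => j jk; apply: perpHL.
  exact: leq_trans (ltnW jk) kT.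
by move=> i ij; apply: ce; exact: leq_trans ij (ltnW jk).
Qed.

(** The observed part of the functional is handled through the innovations up to time [k]. The
    remainder is orthogonal to J_k by causality and to the innovation and unutilized information
    because these are built from y_0..y_k and earlier causal estimates. *)
Lemma wm_perp_model k (u : 'rV[R]_Nm) : (k <= T)%N -> perp Sg (wm k) (u *m L).
Proof.
move=> kT; have [K [e [ce ->]]] := causal_resid k u.
apply: perpDr => //.
  apply: perpMr => //; apply: perpC => //; apply/perp_stackm => j jk.
  move: j jk; apply: perp_Im_Ym => j jk; apply: perpC => //.
  by apply: wm_perp_Im; rewrite jk.
apply: perpBl; first apply: perpBl.
- exact: Jm_perpL.
- apply: perpMl; apply: perp_Ym_Im => j jk; apply: perpC => //; apply/perpL; exact: ce.
- by apply: perpMl; exact: perpL_upsm.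
Qed.

Lemma wm_perp_modelM m k (u : 'M[R]_(m, Nm)) : (k <= T)%N -> perp Sg (wm k) (u *m L).
Proof.
move=> kT; apply: perpC => //; apply/row_matrixP => i; rewrite row0 !row_mul.
by apply: perpC => //; exact: wm_perp_model.
Qed.

(** The earlier residual is a combination of innovations and estimates up to time [j], all of them
    orthogonal to w_k. *)
Lemma wm_perp_wm k j : (j < k <= T)%N -> perp Sg (wm k) (wm j).
Proof.
move=> /andP[jk kT].
have HI i : (i <= j)%N -> perp Sg (wm k) (innovm i).
  by move=> ij; apply: wm_perp_Im; rewrite kT (leq_trans ij (ltnW jk)).
have HH i : (i <= j)%N -> perp Sg (wm k) (H i).
  by move=> ij; apply: wm_perp_H; rewrite kT (leq_ltn_trans ij jk).
apply: perpBr => //; first apply: perpBr => //.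
- rewrite /Jm; case: j jk HI HH => [|j] jk HI HH; first exact: HH.
  by apply: perpBr => //; [exact: HH|apply: perpMr => //; exact: HH].
- by apply: perpMr => //; exact: HI.
- apply: perpMr => //; apply: perpBr => //.
    apply: perpC => //; apply/perp_stackm => i ij; apply: perpC => //; exact/HI/ltnW.
  apply: perpMr => //; apply: perpC => //; apply/perp_stackm => i ij.
  by apply: perpC => //; exact/HH/ltnW.
Qed.

(** Pythagoras: J_k has covariance [Q k] and is the sum of three pairwise orthogonal terms. *)
Lemma wm_cov k : (k <= T)%N -> wm k *m Sg *m (wm k)^T =
  Q k - picoef k *m (innovm k *m Sg *m (innovm k)^T) *m (picoef k)^T
      - phicoef k *m (upsm k *m Sg *m (upsm k)^T) *m (phicoef k)^T.
Proof.
move=> kT.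
have wI : wm k *m Sg *m (innovm k)^T = 0 := wm_perp_Imk k.
have wu : wm k *m Sg *m (upsm k)^T = 0 := wm_perp_ups k.
have uI : upsm k *m Sg *m (innovm k)^T = 0 := upsm_perp_Im kT.
have Iu : innovm k *m Sg *m (upsm k)^T = 0 := perpC pSg uI.
have JE : Jm k = wm k + picoef k *m innovm k + phicoef k *m upsm k.
  by rewrite /wm -addrA [picoef k *m _ + _]addrC addrA subrK subrK.
have := Jm_cov kT; have wE : wm k = Jm k - picoef k *m innovm k - phicoef k *m upsm k by [].
move: wE wI wu uI Iu JE.
(* From here only the orthogonality relations matter; generalising keeps the definitions from
   unfolding under rewriting. *)
move: (wm k) (Jm k) (innovm k) (upsm k) (picoef k) (phicoef k) => w J I u p f.
move=> wE wI wu uI Iu JE JQ.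
have JI : J *m Sg *m (I)^T = p *m (I *m Sg *m (I)^T).
  by rewrite JE !mulmxDl wI add0r -(mulmxA (f)) -(mulmxA (f)) uI mulmx0 addr0 !mulmxA.
have Ju : J *m Sg *m (u)^T = f *m (u *m Sg *m (u)^T).
  by rewrite JE !mulmxDl wu add0r -(mulmxA (p)) -(mulmxA (p)) Iu mulmx0 add0r !mulmxA.
rewrite -JI -Ju -JQ {2}wE.
have wJ : w *m Sg *m (J - p *m I - f *m u)^T = w *m Sg *m J^T.
  have -> : (J - p *m I - f *m u)^T = J^T - I^T *m p^T - u^T *m f^T.
    by apply/matrixP => i j; rewrite -!trmx_mul !mxE.
  by rewrite 2!mulmxBr 2!mulmxA wI wu !mul0mx !subr0.
have IJ : I *m Sg *m J^T = I *m Sg *m I^T *m p^T.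
  by apply: trmx_inj; rewrite !trmx_mul !trmxK pSg.1 !mulmxA JI !mulmxA.
have uJ : u *m Sg *m J^T = u *m Sg *m u^T *m f^T.
  by apply: trmx_inj; rewrite !trmx_mul !trmxK pSg.1 !mulmxA Ju !mulmxA.
rewrite wJ wE !mulmxBl JI Ju -!(mulmxA p) -!(mulmxA f).
by rewrite IJ uJ.
Qed.

End estimator_algebra.

(** * The noise vector of the model *)

Section second_moments.
Context {R : realType} d (T : measurableType d) (P : probability T R).

Definition vsqint n (Y : T -> 'cV[R]_n) := forall i, sqint P (Defs.coord Y i).

Definition crossmx m n (Y : T -> 'cV[R]_m) (Z : T -> 'cV[R]_n) : 'M[R]_(m, n) :=
  \matrix_(i, j) Ex P (fun w => Y w i 0 * Z w j 0).

Lemma vsqintM m n (K : 'M[R]_(m, n)) (Y : T -> 'cV[R]_n) :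
  vsqint Y -> vsqint (fun w => K *m Y w).
Proof.
move=> Y2 i; rewrite (_ : Defs.coord _ i = fun w => \sum_j K i j * Defs.coord Y j w).
  by apply: sqint_sum => j; exact: sqintZ.
by apply/funext => w; rewrite /Defs.coord mxE.
Qed.

Lemma crossmxM m n p q (K : 'M[R]_(m, n)) (K' : 'M[R]_(p, q)) (Y : T -> 'cV[R]_n)
    (Z : T -> 'cV[R]_q) : vsqint Y -> vsqint Z ->
  crossmx (fun w => K *m Y w) (fun w => K' *m Z w) = K *m crossmx Y Z *m K'^T.
Proof.
move=> Y2 Z2; apply/matrixP => a b; rewrite mxE.
have iYZ i j : P.-integrable setT (EFin \o fun w => Y w i 0 * Z w j 0).
  exact: (sqintM (Y2 i) (Z2 j)).
rewrite (_ : (fun w => _) = fun w => \sum_j \sum_i K a i * K' b j * (Y w i 0 * Z w j 0)).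
  rewrite (proj2 (@Ex_sum _ _ _ P _ _ _ _)); last first.
    move=> j; have h := fun i => integrableZ (K a i * K' b j) (iYZ i j).
    by have [] := Ex_sum (index_enum 'I_n) h.
  rewrite mxE; apply: eq_bigr => j _.
  rewrite (proj2 (@Ex_sum _ _ _ P _ _ _ _)); last by move=> i; exact: integrableZ.
  rewrite mxE mulr_suml; apply: eq_bigr => i _.
  by rewrite ExZ// !mxE mulrAC.
apply/funext => w; rewrite !mxE mulr_suml.
under eq_bigr do rewrite mulr_sumr.
rewrite exchange_big/=; apply: eq_bigr => j _; apply: eq_bigr => i _.
ring.
Qed.

Lemma trmx_crossmx m n (Y : T -> 'cV[R]_m) (Z : T -> 'cV[R]_n) :
  (crossmx Y Z)^T = crossmx Z Y.
Proof.
apply/matrixP => i j; rewrite !mxE; congr (Ex P _).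
by apply/funext => w; rewrite mulrC.
Qed.

Lemma psd_crossmx n (Y : T -> 'cV[R]_n) : vsqint Y -> psd (crossmx Y Y).
Proof.
move=> Y2; split; first exact: trmx_crossmx.
move=> u; rewrite -[X in _ *m X](trmxK u) -crossmxM// mxE.
by apply: Ex_ge0 => w; rewrite -expr2 sqr_ge0.
Qed.

Lemma crossmx_col m n (Y : T -> 'cV[R]_m) (Z : T -> 'cV[R]_n) :
  crossmx (fun w => col_mx (Y w) (Z w)) (fun w => col_mx (Y w) (Z w)) =
  block_mx (crossmx Y Y) (crossmx Y Z) (crossmx Y Z)^T (crossmx Z Z).
Proof.
rewrite trmx_crossmx; apply/matrixP => i j.
rewrite mxE; case: (split_ordP i) => i' ->; case: (split_ordP j) => j' ->.
- rewrite block_mxEul mxE; congr (Ex P _).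
  by apply/funext => w; rewrite !col_mxEu.
- rewrite block_mxEur mxE; congr (Ex P _).
  by apply/funext => w; rewrite col_mxEu col_mxEd.
- rewrite block_mxEdl mxE; congr (Ex P _).
  by apply/funext => w; rewrite col_mxEu col_mxEd.
- rewrite block_mxEdr mxE; congr (Ex P _).
  by apply/funext => w; rewrite !col_mxEd.
Qed.

Lemma vsqint_col m n (Y : T -> 'cV[R]_m) (Z : T -> 'cV[R]_n) :
  vsqint Y -> vsqint Z -> vsqint (fun w => col_mx (Y w) (Z w)).
Proof.
move=> Y2 Z2 i; case: (split_ordP i) => i' ->.
  by rewrite (_ : Defs.coord _ _ = Defs.coord Y i')//; apply/funext => w; rewrite /Defs.coord col_mxEu.
by rewrite (_ : Defs.coord _ _ = Defs.coord Z i')//; apply/funext => w; rewrite /Defs.coord col_mxEd.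
Qed.

Lemma crossmx_trace n (Y Z : T -> 'cV[R]_n) : vsqint Y -> vsqint Z ->
  (\int[P]_w (\sum_(i < n) (Y w i 0 - Z w i 0) ^+ 2)%:E =
   (\tr (crossmx Y Y) + \tr (crossmx Z Z) - 2 * \tr (crossmx Z Y))%:E)%E.
Proof.
move=> Y2 Z2.
pose f i w := Y w i 0 * Y w i 0 + (Z w i 0 * Z w i 0 + (- 2) * (Z w i 0 * Y w i 0)).
have iYY i : P.-integrable setT (EFin \o fun w => Y w i 0 * Y w i 0) by exact: (sqintM (Y2 i) (Y2 i)).
have iZZ i : P.-integrable setT (EFin \o fun w => Z w i 0 * Z w i 0) by exact: (sqintM (Z2 i) (Z2 i)).
have iZY i : P.-integrable setT (EFin \o fun w => Z w i 0 * Y w i 0) by exact: (sqintM (Z2 i) (Y2 i)).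
have if_ i : P.-integrable setT (EFin \o f i).
  by apply: integrableA => //; apply: integrableA => //; exact: integrableZ.
have [h1 h2] := Ex_sum (index_enum 'I_n) if_.
rewrite (_ : (fun w => (\sum_(i < n) (Y w i 0 - Z w i 0) ^+ 2)%:E) =
   EFin \o fun w => \sum_(i <- index_enum 'I_n) f i w); last first.
  by apply/funext => w /=; congr EFin; apply: eq_bigr => i _; rewrite /f; ring.
rewrite ExE// h2; congr EFin.
rewrite /mxtrace mulr_sumr -sumrN -!big_split/=; apply: eq_bigr => i _.
rewrite !mxE /f ExD//; last by apply: integrableA => //; exact: integrableZ.
rewrite ExD//; last exact: integrableZ.
by rewrite ExZ// mulNr addrA.
Qed.

End second_moments.

Section mutual_independence.
Context {R : realType} d (T : measurableType d) (P : probability T R).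

Lemma mutual_indep_prefix (Gs : seq (set (set T))) m (A : nat -> set T) :
  mutual_indep P Gs -> (m <= size Gs)%N -> (forall i, (i < size Gs)%N -> nth set0 Gs i setT) ->
  (forall i, (i < m)%N -> nth set0 Gs i (A i)) ->
  P (\big[setI/setT]_(i < m) A i) = (\prod_(i < m) P (A i))%E.
Proof.
move=> ind mG GT GA.
have := ind (fun i => if (i < m)%N then A i else setT).
rewrite (big_ord_widen _ A mG) (big_ord_widen _ (fun i => P (A i)) mG).
rewrite [in X in _ -> X]big_mkcond/= [in X in _ -> _ = X]big_mkcond/= => ->.
  by apply: eq_bigr => i _; case: ifP => // _; exact: probability_setT.
by move=> i iG; case: ifPn => [/GA//|_]; exact: GT.
Qed.

(** Mutual independence speaks of single events of each family, so each step must first show that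
    the partial sum is independent of the next term. *)
Lemma gauss_rv_sum (Gs : seq (set (set T))) (f : nat -> T -> R) (a : nat -> R) m :
  mutual_indep P Gs -> (m <= size Gs)%N -> (forall i, (i < size Gs)%N -> nth set0 Gs i setT) ->
  (forall i, (i < m)%N -> gauss_rv P (f i) 0 (a i)) ->
  (forall i B, (i < m)%N -> measurable B -> nth set0 Gs i (f i @^-1` B)) ->
  gauss_rv P (fun w => \sum_(i < m) f i w) 0 (\sum_(i < m) a i).
Proof.
move=> ind mG GT gf Gf; elim: m mG gf Gf => [|m IH] mG gf Gf.
  rewrite big_ord0 (_ : (fun w => _) = cst 0); last by apply/funext => w; rewrite big_ord0.
  split; [exact: measurable_cst|exact: lexx|move=> B mB].
  rewrite eqxx preimage_cst indicE; case: ifP => _; first exact: probability_setT.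
  exact: measure0.
rewrite (_ : (fun w => _) = (fun w => \sum_(i < m) f i w) \+ f m); last first.
  by apply/funext => w; rewrite big_ord_recr.
rewrite big_ord_recr/=.
have mf i : (i < m.+1)%N -> measurable_fun setT (f i) by move=> /gf[].
have mpre i B : (i < m.+1)%N -> measurable B -> measurable (f i @^-1` B).
  by move=> im mB; rewrite -[X in measurable X]setTI; exact: mf.
apply: gauss_rv_add.
- by apply: IH; [exact: ltnW|move=> i im; apply: gf; exact: ltnW|
    move=> i B im; apply: Gf; exact: ltnW].
- exact: gf.
(* Rectangles in the first m terms: a pi-system with respect to whose sigma-algebra the partial sum
   is measurable. *)
pose C : set (set T) := [set A | exists B : nat -> set R, (forall i, measurable (B i)) /\
  A = \big[setI/setT]_(i < m) (f i @^-1` B i)].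
pose D : set (set T) := [set A | exists B : set R, measurable B /\ A = f m @^-1` B].
suff CD : indep2 P <<s C >> D.
  move=> B E mB mE; apply: CD; last by exists E.
  have msum : measurable_fun (setT : set (g_sigma_algebraType C)) (fun w => \sum_(i < m) f i w).
    apply: measurable_sum => i _ Y mY; rewrite setTI; apply: sub_sigma_algebra.
    exists (fun j : nat => if j == i then Y else setT); split.
      by move=> j; case: ifP.
    rewrite (bigD1 i)//= eqxx big1 ?setIT// => j /negbTE ji.
    by rewrite (_ : (j == i :> nat) = false)// preimage_setT.
  by have := msum measurableT _ mB; rewrite setTI.
apply: indep2_gen.
- move=> _ [B [mB ->]]; apply: bigsetI_measurable => i _; apply: mpre => //.
  exact: ltnW (ltn_ord i).
- by move=> _ [B [mB ->]]; exact: mpre.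
- move=> _ _ [B [mB ->]] [B' [mB' ->]]; exists (fun i => B i `&` B' i); split.
    by move=> i; exact: measurableI.
  by rewrite -big_split.
move=> _ _ [B [mB ->]] [E [mE ->]].
pose F i := if (i < m)%N then f i @^-1` B i else f m @^-1` E.
have h k : (k <= m.+1)%N ->
    P (\big[setI/setT]_(i < k) F i) = (\prod_(i < k) P (F i))%E.
  move=> km; apply: (mutual_indep_prefix ind) => //; first exact: leq_trans mG.
  move=> i ik; rewrite /F; case: ifPn => [im|]; first by apply: Gf => //; exact: ltnW.
  rewrite -leqNgt => mi; have -> : i = m by apply/eqP; rewrite eqn_leq mi andbT -ltnS (leq_trans ik).
  exact: Gf.
have Fm : F m = f m @^-1` E by rewrite /F ltnn.
have FE : \big[setI/setT]_(i < m) (f i @^-1` B i) = \big[setI/setT]_(i < m) F i.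
  by apply: eq_bigr => i _; rewrite /F ltn_ord.
have := h m.+1 (leqnn _); rewrite !big_ord_recr/= Fm -FE => ->.
by rewrite FE h.
Qed.

End mutual_independence.

Section independence_propagation.
Context {R : realType} d (T : measurableType d) (P : probability T R).
Implicit Types S : set (T -> R).

Lemma sigma_of_lincomb S n (X : T -> 'cV[R]_n) (u : 'rV[R]_n) (B : set R) :
  (forall i, S (Defs.coord X i)) -> measurable B ->
  sigma_of S ((fun w => (u *m X w) 0 0) @^-1` B).
Proof.
move=> SX; move: B; apply/sigma_of_measurable_fun.
rewrite (_ : (fun w => _) = fun w => \sum_i u 0 i * Defs.coord X i w); last first.
  by apply/funext => w; rewrite mxE.
apply: measurable_sum => i; apply: measurable_funM => //.
by apply/sigma_of_measurable_fun => B mB; exact: sigma_of_preimage.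
Qed.

Lemma sigma_of_comp S S' : (forall f B, S' f -> measurable B -> sigma_of S (f @^-1` B)) ->
  sigma_of S' `<=` sigma_of S.
Proof. by move=> h; apply: sigma_of_sub; first exact: smallest_sigma_algebra. Qed.

Lemma indep2_capsets (G : set (set T)) S1 S2 :
  G `<=` measurable ->
  (forall f, S1 f -> measurable_fun setT f) -> (forall f, S2 f -> measurable_fun setT f) ->
  (forall A B C, G A -> sigma_of S1 B -> sigma_of S2 C ->
    P (A `&` (B `&` C)) = (P A * P (B `&` C))%E) ->
  indep2 P G (sigma_of (S1 `|` S2)).
Proof.
move=> mG mS1 mS2 h; apply: indep2_sym; rewrite sigma_of_capsets; apply: indep2_gen => //.
- move=> _ [B [C [S1B S2C ->]]]; apply: measurableI.
    exact: sigma_of_measurable S1B.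
  exact: sigma_of_measurable S2C.
- by apply: capsets_setI; exact: sigma_of_setI.
by move=> _ A [B [C [S1B S2C ->]]] GA; rewrite setIC muleC; exact: h.
Qed.

(** For A in [G], B from [S1] and C from [S2], conditioning gives P(A B C) as the integral over A B
    of an [S1]-measurable version of P(C | S1). As A is independent of [S1], the factor P(A) comes
    out and leaves P(B C). *)
Lemma cond_indep_indep2 (G F2 : set (set T)) S1 S2 :
  G `<=` measurable -> G `<=` F2 ->
  (forall f, S1 f -> measurable_fun setT f) -> (forall f, S2 f -> measurable_fun setT f) ->
  indep2 P G (sigma_of S1) ->
  cond_indep P (sigma_of S1) (sigma_of S2) F2 ->
  indep2 P G (sigma_of (S1 `|` S2)).
Proof.
move=> mG GF2 mS1 mS2 ind ci; apply: indep2_capsets => // A B C GA S1B S2C.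
have mA := mG _ GA; have mB := sigma_of_measurable mS1 S1B.
have mC := sigma_of_measurable mS2 S2C.
have [Z [[i1 iZ ZG ZE] [_ _ _ ZE']]] := ci _ S2C.
have mZ : measurable_fun setT Z by apply/measurable_EFinP; exact: measurable_int iZ.
have PI (D : set T) : measurable D -> P (D `&` C) = (\int[P]_(w in D) (\1_C w)%:E)%E.
  by move=> mD; rewrite integral_indic// setIC.
rewrite setIA PI; last exact: measurableI.
rewrite PI// -(ZE B S1B) -(ZE' (A `&` B)); last first.
  pose GG := <<s sigma_of S1 `|` F2 >>.
  have GGI : setI_closed GG.
    exact: (@measurableI _ (g_sigma_algebraType (sigma_of S1 `|` F2))).
  by apply: GGI; apply: sub_sigma_algebra; [right; exact: GF2|left].
rewrite muleC (_ : P A = \int[P]_w (\1_A w)%:E)%E; last by rewrite integral_indic// setIT.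
have ZB : (\int[P]_(w in B) (Z w)%:E = \int[P]_w (Z w * \1_B w)%:E)%E.
  rewrite integral_mkcond; apply: eq_integral => w _.
  by rewrite patchE indicE; case: (w \in B); rewrite /= ?mulr1 ?mulr0.
have ZAB : (\int[P]_(w in A `&` B) (Z w)%:E = \int[P]_w (Z w * \1_B w * \1_A w)%:E)%E.
  rewrite integral_mkcond; apply: eq_integral => w _.
  rewrite patchE !indicE in_setI.
  by case: (w \in A); case: (w \in B); rewrite /= ?mulr1 ?mulr0.
have iZB : P.-integrable setT (EFin \o fun w => Z w * \1_B w).
  apply: le_integrable iZ => //.
    by apply/measurable_EFinP; exact: measurable_funM.
  move=> w _ /=; rewrite lee_fin normrM indicE.
  by case: (w \in B); rewrite ?normr1 ?normr0 ?mulr1 ?mulr0.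
rewrite ZB ZAB; apply: integral_mul_indep => //.
- exact/integrable_indic.
- apply: le_integrable iZB => //.
    by apply/measurable_EFinP; apply: measurable_funM => //; exact: measurable_funM.
  move=> w _ /=; rewrite lee_fin [X in X <= _]normrM [\1_A w]indicE.
  by case: (w \in A); rewrite ?normr1 ?normr0 ?mulr1 ?mulr0.
move=> D E mD mE.
have sD : sigma_of S1 ((fun w => Z w * \1_B w) @^-1` D).
  move: D mD; apply/sigma_of_measurable_fun; apply: measurable_funM.
    exact/sigma_of_measurable_fun.
  exact: measurable_indic.
(* The preimage of [E] under an indicator is the whole space, A, its complement or empty, according
   to whether [E] contains 1 and 0. *)
have [A1|A1] := pselect (E 1); have [E0|E0] := pselect (E 0).
- rewrite (_ : \1_A @^-1` E = setT) ?setIT; last first.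
    by apply/seteqP; split => // w _ /=; rewrite indicE; case: (w \in A).
  by rewrite probability_setT mule1.
- rewrite (_ : \1_A @^-1` E = A); last first.
    apply/seteqP; split => w /=; rewrite indicE; last by move=> /mem_set ->.
    by case: (boolP (w \in A)) => // /set_mem.
  by rewrite setIC muleC; exact: ind.
- rewrite (_ : \1_A @^-1` E = ~` A); last first.
    apply/seteqP; split => w /=; rewrite indicE.
      by case: (boolP (w \in A)) => // /negP h _ wA; apply: h; rewrite inE.
    by move=> h; case: (boolP (w \in A)) => // /set_mem.
  have mX := sigma_of_measurable mS1 sD.
  have h := ind _ _ GA sD.
  rewrite -setDE measureD//; last by rewrite (le_lt_trans (probability_le1 _ _))// ltry.
  set DD := _ @^-1` D in h mX *.
  transitivity (P DD - P A * P DD)%E; first by congr (_ - _)%E; rewrite setIC; exact: h.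
  transitivity (P DD * (1 - P A))%E; last by congr (_ * _)%E; exact/esym/probability_setC.
  have fA : P A \is a fin_num by exact: fin_num_measure.
  have fD : P DD \is a fin_num by exact: fin_num_measure.
  move: fA fD; case: (P A) => // p _; case: (P DD) => // q _.
  by rewrite -EFinM -!EFinB -EFinM; congr EFin; ring.
- rewrite (_ : \1_A @^-1` E = set0) ?setI0 ?measure0 ?mule0//.
  by apply/seteqP; split => // w /=; rewrite indicE; case: (w \in A).
Qed.

End independence_propagation.

Section model_coordinates.
Context {R : realType} d (Om : measurableType d) (P : probability Om R).
Variables (nx ny T : nat) (A : nat -> 'M[R]_nx) (C : nat -> 'M[R]_(ny, nx)).
Variables (Q : nat -> 'M[R]_nx) (Rn : nat -> 'M[R]_ny).
Local Notation Nm := (Nm nx ny T).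
Local Notation Sm := (Sm T Q Rn).
Local Notation xm := (xm (nx := nx) ny T A).
Local Notation ym := (ym (nx := nx) (ny := ny) T A C).

Lemma lgss_gauss_vec (x : nat -> Om -> 'cV[R]_nx) (y : nat -> Om -> 'cV[R]_ny) :
  lgss_model P T A C Q Rn x y -> exists xi : Om -> 'cV[R]_Nm,
    [/\ gauss_vec P xi 0 Sm,
        forall k, (k <= T)%N -> x k = fun w => xm k *m xi w &
        forall k, (k <= T)%N -> y k = fun w => ym k *m xi w].
Proof.
move=> [q [r [q0 xE yE gqr ind]]].
pose xi w : 'cV[R]_Nm := col_mx (stackp q T.+1 w) (stackp r T.+1 w).
have qE k w : (k <= T)%N -> qm nx ny T k *m xi w = q k w.
  by move=> kT; rewrite mul_row_col mul0mx addr0 (slot_stack (fun j => q j w) kT).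
have rE k w : (k <= T)%N -> rm nx ny T k *m xi w = r k w.
  by move=> kT; rewrite mul_row_col mul0mx add0r (slot_stack (fun j => r j w) kT).
have xxi k w : (k <= T)%N -> x k w = xm k *m xi w.
  elim: k => [|k IH] kT /=; first by rewrite -q0 qE.
  by rewrite xE//= IH ?(ltnW kT)// mulmxDl mulmxA qE.
exists xi; split; last 2 first.
- by move=> k kT; apply/funext => w; exact: xxi.
- by move=> k kT; apply/funext => w; rewrite /ym mulmxDl -mulmxA -xxi// rE// yE.
move=> u; rewrite mulmx0 mxE.
pose uq k : 'cV[R]_nx := slot T nx k *m usubmx u.
pose ur k : 'cV[R]_ny := slot T ny k *m dsubmx u.
(* One summand per independent noise, listed as in the hypothesis of mutual independence: q_0..q_T,
   then r_0..r_T. *)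
pose f i w := if (i < T.+1)%N then ((uq i)^T *m q i w) 0 0
              else ((ur (i - T.+1)%N)^T *m r (i - T.+1)%N w) 0 0.
pose a i := if (i < T.+1)%N then ((uq i)^T *m Q i *m uq i) 0 0
            else ((ur (i - T.+1)%N)^T *m Rn (i - T.+1)%N *m ur (i - T.+1)%N) 0 0.
have idx i : (T.+1 + i < T.+1)%N = false by rewrite ltnNge leq_addr.
have uE n (v : 'cV[R]_(T.+1 * n)) (z : nat -> Om -> 'cV[R]_n) w :
    (v^T *m stackp z T.+1 w) = \sum_(k < T.+1) (slot T n k *m v)^T *m z k w.
  rewrite -(mul1mx (stackp z T.+1 w)) -slot_resolution mulmx_suml mulmx_sumr.
  apply: eq_bigr => k _; rewrite trmx_mul -!mulmxA.
  by rewrite (slot_stack (fun j => z j w) (ltn_ord k : (k <= T)%N)).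
have := @gauss_rv_sum _ _ _ P _ f a (T.+1 + T.+1)%N ind.
rewrite (_ : (fun w => _) = fun w => (u^T *m xi w) 0 0); last first.
  apply/funext => w; rewrite big_split_ord/=.
  rewrite -[u in u^T]vsubmxK tr_col_mx mul_row_col mxE !uE !summxE.
  congr (_ + _); apply: eq_bigr => i _; rewrite /f ?ltn_ord//.
  by rewrite idx addKn.
rewrite (_ : \sum_(i < T.+1 + T.+1) a i = (u^T *m Sm *m u) 0 0); last first.
  rewrite big_split_ord/= -[in RHS](vsubmxK u) tr_col_mx mul_row_block mul_row_col.
  rewrite !mulmx0 addr0 add0r [RHS]mxE /bdiag !mulmx_sumr !mulmx_suml !summxE.
  congr (_ + _); apply: eq_bigr => i _; rewrite /a ?ltn_ord ?idx ?addKn//.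
    by rewrite /uq trmx_mul !mulmxA.
  by rewrite /ur trmx_mul !mulmxA.
rewrite size_cat !size_map !size_iota.
have nthG i B : (i < T.+1 + T.+1)%N ->
   (if (i < T.+1)%N then sigma_of (coords (q i)) B else sigma_of (coords (r (i - T.+1)%N)) B) ->
   nth set0 ([seq sigma_of (coords (q k)) | k <- iota 0 T.+1] ++
     [seq sigma_of (coords (r k)) | k <- iota 0 T.+1]) i B.
  move=> iT; rewrite nth_cat size_map size_iota; case: ifPn => [iT1|].
    by rewrite (nth_map 0%N) ?size_iota// nth_iota.
  rewrite -leqNgt => Ti.
  by rewrite (nth_map 0%N) ?size_iota ?nth_iota ?ltn_subLR.
apply=> //.
- by move=> i iT; apply: nthG => //; case: ifP => _; exact: sigma_of_setT.
- move=> i iT; rewrite /f /a; case: ifPn => [iT1|].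
    by have := (gqr i iT1).1 (uq i); rewrite mulmx0 mxE.
  rewrite -leqNgt => Ti.
  have iT2 : (i - T.+1 <= T)%N by lia.
  by have := (gqr _ iT2).2 (ur (i - T.+1)%N); rewrite mulmx0 mxE.
- move=> i B iT mB; apply: nthG => //; rewrite /f; have [iT1|iT1] := boolP (i < T.+1)%N.
    by apply: sigma_of_lincomb => // j; exists j.
  by apply: sigma_of_lincomb => // j; exists j.
Qed.

End model_coordinates.

(** * The cost of an admissible estimator *)

Section sigma_measurable_vectors.
Context {R : realType} d (Om : measurableType d) (S : set (Om -> R)).

Definition vmeas n (z : Om -> 'cV[R]_n) := forall i B, measurable B ->
  sigma_of S (Defs.coord z i @^-1` B).

Let gen := [set A | exists f, S f /\ exists B : set R, measurable B /\ A = f @^-1` B].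

Lemma vmeasP n (z : Om -> 'cV[R]_n) : vmeas z <->
  forall i, measurable_fun (setT : set (g_sigma_algebraType gen)) (Defs.coord z i).
Proof.
split=> h i; first by apply/sigma_of_measurable_fun; exact: h.
by move=> B mB; have /sigma_of_measurable_fun := h i; exact.
Qed.

Lemma vmeas_coords n (z : Om -> 'cV[R]_n) : coords z `<=` S -> vmeas z.
Proof. by move=> zS i B mB; apply: sigma_of_preimage => //; apply: zS; exists i. Qed.

Lemma vmeasM m n (K : 'M[R]_(m, n)) (z : Om -> 'cV[R]_n) :
  vmeas z -> vmeas (fun w => K *m z w).
Proof.
move=> /vmeasP mz; apply/vmeasP => i.
rewrite (_ : Defs.coord _ i = fun w => \sum_j K i j * Defs.coord z j w); last first.
  by apply/funext => w; rewrite /Defs.coord mxE.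
by apply: measurable_sum => j; exact: measurable_funM.
Qed.

Lemma vmeasD n (z z' : Om -> 'cV[R]_n) : vmeas z -> vmeas z' -> vmeas (fun w => z w + z' w).
Proof.
move=> /vmeasP mz /vmeasP mz'; apply/vmeasP => i.
rewrite (_ : Defs.coord _ i = Defs.coord z i \+ Defs.coord z' i); first exact: measurable_funD.
by apply/funext => w; rewrite /Defs.coord/= mxE.
Qed.

Lemma vmeasB n (z z' : Om -> 'cV[R]_n) : vmeas z -> vmeas z' -> vmeas (fun w => z w - z' w).
Proof.
move=> mz /(vmeasM (- 1%:M)) mz'; rewrite (_ : (fun w => _) = fun w => z w + (- 1%:M) *m z' w).
  exact: vmeasD.
by apply/funext => w; rewrite mulNmx mul1mx.
Qed.

Lemma vmeas_sum n (I : Type) (r : seq I) (z : I -> Om -> 'cV[R]_n) :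
  (forall i, vmeas (z i)) -> vmeas (fun w => \sum_(i <- r) z i w).
Proof.
move=> mz; apply/vmeasP => i.
rewrite (_ : Defs.coord _ i = fun w => \sum_(j <- r) Defs.coord (z j) i w).
  by apply: measurable_sum => j; have /vmeasP := mz j; exact.
by apply/funext => w; rewrite /Defs.coord summxE.
Qed.

Lemma vmeas_lin n (z : Om -> 'cV[R]_n) u B : vmeas z -> measurable B ->
  sigma_of S (lin z u @^-1` B).
Proof. by move=> mz mB; exact: (vmeasM u mz 0 mB). Qed.

Lemma vmeas_stackp n k (z : nat -> Om -> 'cV[R]_n) :
  (forall j, (j < k)%N -> vmeas (z j)) -> vmeas (stackp z k).
Proof.
move=> mz a B mB; case/mxvec_indexP: a => j i.
rewrite (_ : Defs.coord _ _ = Defs.coord (z j) i); first exact: mz.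
by apply/funext => w; rewrite /Defs.coord stackE.
Qed.

End sigma_measurable_vectors.

Lemma eq_stackp (Om : Type) (R : realType) n k (z z' : nat -> Om -> 'cV[R]_n) w :
  (forall j, (j < k)%N -> z j w = z' j w) -> stackp z k w = stackp z' k w.
Proof.
move=> zz; apply/matrixP => a b; rewrite ord1; case/mxvec_indexP: a => j i.
by rewrite !stackE zz.
Qed.

Section gaussian_second_moments.
Context {R : realType} d (T : measurableType d) (P : probability T R).
Variables (N : nat) (xi : T -> 'cV[R]_N) (Sig : 'M[R]_N).
Hypothesis gxi : gauss_vec P xi 0 Sig.

Let coord_lin i : Defs.coord xi i = lin xi (delta_mx 0 i).
Proof. by apply/funext => w; rewrite /lin -rowE mxE. Qed.

Lemma vsqint_gauss : vsqint P xi.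
Proof. by move=> i; rewrite coord_lin; exact: sqint_lin gxi _. Qed.

Lemma crossmx_gauss : Sig^T = Sig -> crossmx P xi xi = Sig.
Proof.
move=> sSig; apply/matrixP => i j; rewrite mxE.
have -> : (fun w => xi w i 0 * xi w j 0) =
    fun w => lin xi (delta_mx 0 i) w * lin xi (delta_mx 0 j) w.
  by rewrite -!coord_lin.
by rewrite (Ex_linM gxi sSig) -rowE trmx_delta -colE !mxE.
Qed.

End gaussian_second_moments.

Lemma eq_slots (R : realType) (T m n : nat) (K K' : 'M[R]_(T.+1 * n, m)) :
  (forall k, (k <= T)%N -> slot T n k *m K = slot T n k *m K') -> K = K'.
Proof.
move=> KK; rewrite -[LHS]mul1mx -[RHS]mul1mx -slot_resolution !mulmx_suml.
by apply: eq_bigr => k _; rewrite -!mulmxA (KK k (ltn_ord k)).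
Qed.

Lemma vsqint_stackp (R : realType) d (T : measurableType d) (P : probability T R) n k
    (z : nat -> T -> 'cV[R]_n) :
  (forall j, (j < k)%N -> vsqint P (z j)) -> vsqint P (stackp z k).
Proof.
move=> z2 a; case/mxvec_indexP: a => j i.
rewrite (_ : Defs.coord _ _ = Defs.coord (z j) i); first exact: z2.
by apply/funext => w; rewrite /Defs.coord stackE.
Qed.

Section total_gain.
Context {R : realType} (nx ny T : nat) (A : nat -> 'M[R]_nx) (alpha : nat -> R).

(** The weighted sum of the inner products E <xh_k, x_k>, read off the cross-covariance; the only
    part of the cost that varies between admissible estimators. *)
Definition gain (M : 'M[R]_(T.+1 * nx, Nm nx ny T)) : R :=
  \sum_(k < T.+1) alpha k * \tr (slot T nx k *m M *m (xm ny T A k)^T).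

Definition signal_energy (S : 'M[R]_(Nm nx ny T)) : R :=
  \sum_(k < T.+1) alpha k * \tr (xm ny T A k *m S *m (xm ny T A k)^T).

End total_gain.

Section cost_of_admissible.
Context {R : realType} d (Om : measurableType d) (P : probability Om R).
Variables (nx ny T : nat) (A : nat -> 'M[R]_nx) (C : nat -> 'M[R]_(ny, nx)).
Variables (Q : nat -> 'M[R]_nx) (Rn : nat -> 'M[R]_ny).
Hypotheses (hQ : forall k, (k <= T)%N -> psd (Q k)) (hR : forall k, (k <= T)%N -> psd (Rn k)).
Local Notation Nm := (Nm nx ny T).
Local Notation Sm := (Sm T Q Rn).
Local Notation xm := (xm (nx := nx) ny T A).
Local Notation ym := (ym (nx := nx) (ny := ny) T A C).
Local Notation qm := (qm nx ny T).
Local Notation rm := (rm nx ny T).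

Variables (xi : Om -> 'cV[R]_Nm) (x : nat -> Om -> 'cV[R]_nx) (y : nat -> Om -> 'cV[R]_ny).
Variable xh : nat -> Om -> 'cV[R]_nx.
Hypothesis gxi : gauss_vec P xi 0 Sm.
Hypothesis xE : forall k, (k <= T)%N -> x k = fun w => xm k *m xi w.
Hypothesis yE : forall k, (k <= T)%N -> y k = fun w => ym k *m xi w.
Hypothesis adm : admissible P T x y xh.

Let past k : set (Om -> R) :=
  [set f | exists j, ((j < k)%N /\ coords (y j) f) \/ ((j < k)%N /\ coords (xh j) f)].

Let meas_xh k : (k <= T)%N -> forall f, coords (xh k) f -> measurable_fun setT f.
Proof. by move=> kT f [i ->]; have [h _ _] := adm; exact: h. Qed.

Let lin_coord n (K : 'M[R]_(n, Nm)) i : Defs.coord (fun w => K *m xi w) i = lin xi (row i K).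
Proof. by apply/funext => w; rewrite /Defs.coord /lin -row_mul [RHS]mxE. Qed.

Let meas_y k : (k <= T)%N -> forall f, coords (y k) f -> measurable_fun setT f.
Proof.
by move=> kT f [i ->]; rewrite yE// lin_coord; exact: measurable_lin gxi _.
Qed.

Let meas_past k : (k <= T.+1)%N -> forall f, past k f -> measurable_fun setT f.
Proof.
move=> kT f [j [[jk]|[jk]]]; first by apply: meas_y; rewrite -ltnS (leq_trans jk).
by apply: meas_xh; rewrite -ltnS (leq_trans jk).
Qed.

(** The noises are recovered as q_k = x_k - A_k x_(k-1) and r_k = y_k - C_k x_k. Causality
    conditions on states and observations, while the argument below works with functionals of the
    noise. *)
Lemma vmeas_model_vars : vmeas (model_vars T x y) xi.
Proof.
have qE k w : (k <= T)%N -> qm k *m xi w =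
    if k is k'.+1 then x k w - A k *m x k' w else x 0%N w.
  case: k => [|k] kT; rewrite xE//= mulmxDl.
  by rewrite xE ?(ltnW kT)//= mulmxA addrAC subrr add0r.
have rE k w : (k <= T)%N -> rm k *m xi w = y k w - C k *m x k w.
  by move=> kT; rewrite yE// xE// /ym mulmxDl mulmxA addrAC subrr add0r.
have mx k : (k <= T)%N -> vmeas (model_vars T x y) (x k).
  by move=> kT; apply: vmeas_coords => f fx; exists k; split => //; left.
have my k : (k <= T)%N -> vmeas (model_vars T x y) (y k).
  by move=> kT; apply: vmeas_coords => f fy; exists k; split => //; right.
have mq k : (k <= T)%N -> vmeas (model_vars T x y) (fun w => qm k *m xi w).
  move=> kT; rewrite (_ : (fun w => _) = if k is k'.+1 then fun w => x k w - A k *m x k' w else x 0%N).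
    case: k kT => [|k] kT; first exact: mx.
    by apply: vmeasB; [exact: mx|apply: vmeasM; apply: mx; exact: ltnW].
  by apply/funext => w; rewrite qE//; case: (k).
have mr k : (k <= T)%N -> vmeas (model_vars T x y) (fun w => rm k *m xi w).
  move=> kT; rewrite (_ : (fun w => _) = fun w => y k w - C k *m x k w).
    by apply: vmeasB; [exact: my|apply: vmeasM; exact: mx].
  by apply/funext => w; rewrite rE.
rewrite (_ : xi = fun w => \sum_(k < T.+1) (qm k)^T *m (qm k *m xi w) +
                          \sum_(k < T.+1) (rm k)^T *m (rm k *m xi w)).
  apply: vmeasD; apply: vmeas_sum => k; apply: vmeasM.
    exact: mq (ltn_ord k).
  exact: mr (ltn_ord k).
by apply/funext => w; rewrite model_resolution.
Qed.

(* Causality enters only here: the residual of y_k is orthogonal to y_0..y_{k-1}, and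
   xh_k is independent of the model given the past. *)
Lemma past_indep k : (k <= T.+1)%N ->
  indep2 P (sigma_of (lin xi @` [set u | forall j, (j < k)%N -> perp Sm u (ym j)]))
           (sigma_of (past k)).
Proof.
have pS := psd_Sm hQ hR.
have mlin (U : set 'rV[R]_Nm) f : (lin xi @` U) f -> measurable_fun setT f.
  by move=> [u _ <-]; exact: measurable_lin gxi _.
elim: k => [_|k IH kT].
  apply: indep2_sigma_of; [exact: mlin|by move=> f [j []] []|].
  move=> D E cD [[|n] [f [B [pf mB ->]]]]; last first.
    by have [j [[]|[]]] := pf 0%N isT.
  rewrite (_ : [set w | _] = setT); last by apply/seteqP; split => // w _ i.
  rewrite setIT -[LHS]mule1; congr (_ * _)%E; exact/esym/probability_setT.
set U := [set u | _].
have sUm : sigma_of (lin xi @` U) `<=` measurable by apply: sigma_of_measurable; exact: mlin.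
pose K := pcoef Sm (stackm k ym) (ym k) *m stackm k ym.
pose e i : 'rV[R]_Nm := row i (ym k - K).
have eperp i j : (j < k)%N -> perp Sm (e i) (ym j).
  rewrite /e rowE => jk; apply: perpMl; apply: perpC => //.
  by move: j jk; apply/perp_stackm; apply: perpC => //; exact: perp_pcoef.
pose U1 : set 'rV[R]_Nm := [set u | exists i, u = e i].
have indUe : indep2 P (sigma_of (lin xi @` U)) (sigma_of (lin xi @` U1)).
  apply: (gauss_indep2 gxi pS.1) => u _ Uu [i ->].
  have : perp Sm u (ym k - K).
    apply: perpBr => //; first exact: Uu.
    by apply: perpMr => //; apply: perpC => //; apply/perp_stackm => j jk;
      apply: perpC => //; apply: Uu; exact: ltnW.
  by rewrite /e rowE trmx_mul mulmxA => ->; rewrite mul0mx.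
have kT' : (k <= T)%N by rewrite -ltnS.
have mpast := meas_past (ltnW kT).
have {}IH := IH (ltnW kT).
(* Functionals in [U] and the residual of y_k are independent of each other, and both are orthogonal
   to the observations before [k]. The induction hypothesis applied to their intersections thus
   makes [U] independent of the past and the residual jointly. *)
have ind1 : indep2 P (sigma_of (lin xi @` U)) (sigma_of (past k `|` lin xi @` U1)).
  apply: indep2_capsets => //; first exact: mlin.
  move=> D B E sD sB sE.
  have sDE : sigma_of (lin xi @` [set u | forall j, (j < k)%N -> perp Sm u (ym j)]) (D `&` E).
    apply: sigma_of_setI; first by apply: sigma_ofS sD; apply: image_subset => v Uv i ik; apply: Uv; exact: ltnW.
    by apply: sigma_ofS sE; apply: image_subset => _ [i ->]; exact: eperp.
  have sE' : sigma_of (lin xi @` [set u | forall j, (j < k)%N -> perp Sm u (ym j)]) E.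
    by apply: sigma_ofS sE; apply: image_subset => _ [i ->]; exact: eperp.
  rewrite [B `&` E]setIC setIA (IH _ _ sDE sB) (indUe _ _ sD sE) (IH _ _ sE' sB).
  by rewrite muleA.
have vpy j : (j < k)%N -> vmeas (past k `|` lin xi @` U1) (y j).
  by move=> jk; apply: vmeas_coords => f fy; left; exists j; left.
have vyk : vmeas (past k `|` lin xi @` U1) (y k).
  rewrite yE// (_ : (fun w => _) = fun w =>
    pcoef Sm (stackm k ym) (ym k) *m stackp y k w + (ym k - K) *m xi w); last first.
    apply/funext => w; rewrite mulmxBl addrC -[LHS](subrK (K *m xi w)); congr (_ + _).
    rewrite /K -mulmxA -stackp_lin; congr (_ *m _).
    by apply: eq_stackp => j jk; rewrite yE//; exact: leq_trans (ltnW jk) kT'.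
  apply: vmeasD; first apply: vmeasM.
    by apply: vmeas_stackp => j; exact: vpy.
  apply: vmeas_coords => f [i ->]; right; rewrite lin_coord.
  by exists (e i) => //; exists i.
pose S1 : set (Om -> R) := [set f | exists j, ((j <= k)%N /\ coords (y j) f)
                                     \/ ((j < k)%N /\ coords (xh j) f)].
have S1sub : sigma_of S1 `<=` sigma_of (past k `|` lin xi @` U1).
  apply: sigma_of_comp => f B [j [[jk [i ->]]|[jk [i ->]]]] mB.
    by move: jk; rewrite leq_eqVlt => /orP[/eqP ->|jk]; [exact: vyk|exact: vpy].
  by apply: sigma_of_preimage => //; left; exists j; right; split => //; exists i.
have mS1 f : S1 f -> measurable_fun setT f.
  move=> [j [[jk]|[jk]]]; first by apply: meas_y; exact: leq_trans kT'.
  by apply: meas_xh; exact: leq_trans (ltnW jk) kT'.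
have ind2 : indep2 P (sigma_of (lin xi @` U)) (sigma_of S1).
  exact: indep2S S1sub ind1.
have [_ ci _] := adm.
have := cond_indep_indep2 sUm _ mS1 (meas_xh kT') ind2 (ci k kT').
have sUF : sigma_of (lin xi @` U) `<=` sigma_of (model_vars T x y).
  apply: sigma_of_comp => _ B [u _ <-] mB; apply: vmeas_lin => //.
  exact: vmeas_model_vars.
move=> /(_ sUF); apply: indep2S => //; apply: sigma_ofS => f [j [[jk fy]|[jk fx]]].
  by left; exists j; left.
move: jk fx; rewrite ltnS leq_eqVlt => /orP[/eqP ->|jk] fx; first by right.
by left; exists j; right.
Qed.

Lemma estimator_pair_law a b i j (B D : set R) : (a <= T)%N -> (b <= T)%N ->
  measurable B -> measurable D ->
  P (Defs.coord (x a) i @^-1` B `&` Defs.coord (x b) j @^-1` D) =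
  P (Defs.coord (xh a) i @^-1` B `&` Defs.coord (xh b) j @^-1` D).
Proof.
move=> aT bT mB mD; have [_ _ law] := adm.
(* An intersection of two conditional constraints, so that both may fall on the same coordinate. *)
pose E k l : set R := (if (k == a) && (l == i) then B else setT) `&`
                      (if (k == b) && (l == j) then D else setT).
have mE k l : measurable (E k l).
  by apply: measurableI; case: ifP => _ //; exact: measurableT.
have EE (z : nat -> Om -> 'cV[R]_nx) : [set w | forall k l, (k <= T)%N -> E k l (z k w l 0)] =
    Defs.coord (z a) i @^-1` B `&` Defs.coord (z b) j @^-1` D.
  apply/seteqP; split => w /=.
    move=> h; split.
      by have := h a i aT; rewrite /E !eqxx/= => -[].
    by have := h b j bT; rewrite /E !eqxx/= => -[].
  move=> [zB zD] k l kT; split; case: ifP => // /andP[/eqP -> /eqP ->] //.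
by rewrite -!EE; exact/esym/law.
Qed.

Let mcx a i : (a <= T)%N -> measurable_fun setT (Defs.coord (x a) i).
Proof. by move=> aT; rewrite xE// lin_coord; exact: measurable_lin gxi _. Qed.

Let mcxh a i : (a <= T)%N -> measurable_fun setT (Defs.coord (xh a) i).
Proof. by move=> aT; apply: (meas_xh aT); exists i. Qed.

Let vsqint_xi : vsqint P xi := vsqint_gauss gxi.

Lemma vsqint_x a : (a <= T)%N -> vsqint P (x a).
Proof. by move=> aT; rewrite xE//; apply: vsqintM; exact: vsqint_xi. Qed.

Let msq : measurable_fun setT (fun z : R * R => (z.1 ^+ 2)%:E).
Proof. by apply/measurable_EFinP; exact: measurable_funX. Qed.

Let mmul : measurable_fun setT (fun z : R * R => (z.1 * z.2)%:E).
Proof. by apply/measurable_EFinP; exact: measurable_funM. Qed.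

Lemma vsqint_xh a : (a <= T)%N -> vsqint P (xh a).
Proof.
move=> aT i; split; first exact: mcxh.
have [_ lx] := vsqint_x aT i; apply: le_lt_trans lx.
rewrite le_eqVlt; apply/orP; left; apply/eqP/esym.
apply: (eq_pair_law_integral (mcx i aT) (mcx i aT) (mcxh i aT) (mcxh i aT) _ msq).
  by move=> B D mB mD; exact: estimator_pair_law.
by move=> z; rewrite lee_fin sqr_ge0.
Qed.

Lemma crossmx_xh a b : (a <= T)%N -> (b <= T)%N ->
  crossmx P (xh a) (xh b) = xm a *m Sm *m (xm b)^T.
Proof.
move=> aT bT; have pS := psd_Sm hQ hR.
rewrite -(crossmx_gauss gxi pS.1).
rewrite -crossmxM; [|exact: vsqint_xi|exact: vsqint_xi].
rewrite -xE// -xE//; apply/matrixP => i j; rewrite !mxE /Ex; congr fine; apply/esym.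
apply: (eq_pair_law_integral_signed (mcx i aT) (mcx j bT) (mcxh i aT) (mcxh j bT) _ mmul).
  by move=> B D mB mD; exact: estimator_pair_law.
exact: (sqintM (vsqint_x aT i) (vsqint_x bT j)).
Qed.

Lemma causal_crossmx k (u : 'rV[R]_Nm) : (k <= T)%N -> causal_upto A C Q Rn k u ->
  crossmx P (xh k) (fun w => u *m xi w) = 0.
Proof.
move=> kT cu; apply/matrixP => i j; rewrite ord1 !mxE.
have ui := sqint_lin gxi u.
rewrite (Ex_mul_indep (X := Defs.coord (xh k) i) (Y := lin xi u)).
- by rewrite (Ex_lin gxi) mulr0.
- exact: sqint_integrable (vsqint_xh kT i).
- exact: sqint_integrable ui.
- exact: sqintM (vsqint_xh kT i) ui.
move=> B D mB mD; rewrite setIC muleC; apply: (past_indep (k := k.+1)) => //.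
  by apply: sigma_of_preimage => //; exists u => // j jk; exact: cu.
by apply: sigma_of_preimage => //; exists k; right; split => //; exists i.
Qed.

Let xh_slot k : (k <= T)%N -> xh k = fun w => slot T nx k *m stackp xh T.+1 w.
Proof. by move=> kT; apply/funext => w; rewrite (slot_stack (fun j => xh j w) kT). Qed.

Definition estimator_crossmx := crossmx P (stackp xh T.+1) xi.

Lemma feasible_estimator : feasible A C Q Rn estimator_crossmx.
Proof.
have pS := psd_Sm hQ hR.
have vxh : vsqint P (stackp xh T.+1) by apply: vsqint_stackp => j; exact: vsqint_xh.
split; last first.
  move=> k u kT /(causal_crossmx kT) <-.
  by rewrite (xh_slot kT) crossmxM//; exact: vsqint_xi.
have := psd_crossmx (vsqint_col vxh vsqint_xi).
rewrite crossmx_col (crossmx_gauss gxi pS.1); congr (psd (block_mx _ _ _ _)).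
apply: eq_slots => j jT; apply: trmx_inj; apply: eq_slots => k kT; apply: trmx_inj.
rewrite !trmx_mul !trmxK slot_SX// -(crossmx_xh jT kT).
by rewrite -(crossmxM _ _ vxh vxh) (xh_slot jT) (xh_slot kT).
Qed.

(** Equal laws give E |xh_k|^2 = E |x_k|^2, so the two squares merge and the cost is twice a
    difference. *)
Lemma cost_estimator (alpha : nat -> R) : cost P T alpha x xh =
  (2 * (signal_energy A alpha Sm - gain A alpha estimator_crossmx))%:E.
Proof.
have pS := psd_Sm hQ hR.
have vxh : vsqint P (stackp xh T.+1) by apply: vsqint_stackp => j; exact: vsqint_xh.
rewrite /cost /signal_energy /gain -sumrB mulr_sumr -sumEFin; apply: eq_bigr => k _.
have kT : (k <= T)%N by rewrite -ltnS.
rewrite crossmx_trace; [|exact: vsqint_x|exact: vsqint_xh].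
rewrite -EFinM; congr EFin.
have -> : crossmx P (xh k) (x k) = slot T nx k *m estimator_crossmx *m (xm k)^T.
  by rewrite (xh_slot kT) xE// crossmxM.
have -> : crossmx P (x k) (x k) = xm k *m Sm *m (xm k)^T.
  by rewrite xE// crossmxM// (crossmx_gauss gxi pS.1).
rewrite crossmx_xh//; ring.
Qed.

End cost_of_admissible.

(** * An optimal cross-covariance *)

Section block_forms.
Context {R : realType}.

Lemma mx11_tr (M : 'M[R]_1) : M^T = M.
Proof. by apply/matrixP => i j; rewrite mxE !ord1. Qed.

Lemma block_quad m n (S : 'M[R]_m) (M : 'M[R]_(m, n)) (S' : 'M[R]_n) (u : 'cV[R]_m) (v : 'cV[R]_n) :
  ((col_mx u v)^T *m block_mx S M M^T S' *m col_mx u v) 0 0 =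
  (u^T *m S *m u) 0 0 + 2 * (u^T *m M *m v) 0 0 + (v^T *m S' *m v) 0 0.
Proof.
rewrite tr_col_mx mul_row_block mul_row_col !mulmxDl.
have -> : v^T *m M^T *m u = u^T *m M *m v.
  by rewrite -[LHS]mx11_tr !trmx_mul !trmxK mulmxA.
rewrite !mxE; ring.
Qed.

Lemma psd_congr m n (K : 'M[R]_(m, n)) (S : 'M[R]_n) : psd S -> psd (K *m S *m K^T).
Proof.
move=> [sS pS]; split; first by rewrite !trmx_mul trmxK sS mulmxA.
by move=> u; have := pS (K^T *m u); rewrite trmx_mul trmxK !mulmxA.
Qed.

Lemma psd_diag_ge0 n (S : 'M[R]_n) i : psd S -> 0 <= S i i.
Proof.
by move=> [_ /(_ (delta_mx i 0))]; rewrite trmx_delta -rowE -colE !mxE.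
Qed.

Lemma psd_diag_le_trace n (S : 'M[R]_n) i : psd S -> S i i <= \tr S.
Proof.
move=> pS; rewrite /mxtrace (bigD1 i)//= lerDl sumr_ge0// => j _.
exact: psd_diag_ge0.
Qed.

(** Testing on e_b together with plus or minus e_a gives 2 |M_ab| <= S_aa + S'_bb. *)
Lemma psd_block_bounded m n (S : 'M[R]_m) (M : 'M[R]_(m, n)) (S' : 'M[R]_n) a b :
  psd S -> psd S' -> psd (block_mx S M M^T S') -> `|M a b| <= \tr S + \tr S'.
Proof.
move=> pS pS' [_ pM].
have h (s : R) : s ^+ 2 = 1 -> 0 <= S a a + 2 * s * M a b + S' b b.
  move=> s2; have := pM (col_mx (s *: delta_mx a 0) (delta_mx b 0)); rewrite block_quad.
  have -> : (s *: delta_mx a 0 : 'cV[R]_m)^T = s *: delta_mx 0 a.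
    by apply/matrixP => i j; rewrite !mxE andbC.
  rewrite !trmx_delta -!scalemxAl -!scalemxAr -!rowE -!colE !mxE.
  by rewrite !mulrA -[s * s]expr2 s2 mul1r.
have h1 := h 1 (expr1n _ _); have h2 := h (-1) (sqrr_sign R 1).
have := psd_diag_le_trace a pS; have := psd_diag_le_trace b pS'.
have := psd_diag_ge0 a pS; have := psd_diag_ge0 b pS'.
by move=> ? ? ? ?; rewrite ler_norml; apply/andP; split; lra.
Qed.

Lemma continuous_mull (V : topologicalType) (c : R) (f : V -> R) :
  continuous f -> continuous (fun v => c * f v).
Proof.
move=> cf v; apply: (@cvgM _ _ (nbhs v) _ (fun=> c) f); last exact: cf.
exact: cvg_cst.
Qed.

Lemma continuous_affine (V : topologicalType) (a b c : R) (f : V -> R) :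
  continuous f -> continuous (fun v => a + b * f v + c).
Proof.
move=> cf v; apply: (@cvgD _ _ _ (nbhs v) _ (fun v => a + b * f v) (fun=> c)).
  apply: (@cvgD _ _ _ (nbhs v) _ (fun=> a) (fun v => b * f v)); first exact: cvg_cst.
  exact: continuous_mull.
exact: cvg_cst.
Qed.

Lemma continuous_bigsum (V : topologicalType) (I : Type) (r : seq I) (f : I -> V -> R) :
  (forall i, continuous (f i)) -> continuous (fun v => \sum_(i <- r) f i v).
Proof.
move=> cf; elim: r => [|i r IH].
  rewrite (_ : (fun v => _) = cst 0); first by move=> v; exact: cvg_cst.
  by apply/funext => v; rewrite big_nil.
rewrite (_ : (fun v => _) = fun v => f i v + \sum_(j <- r) f j v).
  by move=> v; apply: cvgD; [exact: cf|exact: IH].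
by apply/funext => v; rewrite big_cons.
Qed.

Lemma continuous_vec_mx_entry m n p q (K : 'M[R]_(p, m)) (L : 'M[R]_(n, q)) i j :
  continuous (fun v : 'rV[R]_(m * n) => (K *m vec_mx v *m L) i j).
Proof.
have -> : (fun v : 'rV[R]_(m * n) => (K *m vec_mx v *m L) i j) =
    fun v => \sum_b \sum_a K i a * L b j * v 0 (mxvec_index a b).
  apply/funext => v; rewrite mxE; apply: eq_bigr => b _.
  by rewrite mxE mulr_suml; apply: eq_bigr => a _; rewrite mxE mulrAC.
apply: continuous_bigsum => b; apply: continuous_bigsum => a; apply: continuous_mull.
exact: coord_continuous.
Qed.

End block_forms.

Section optimal_feasible.
Context {R : realType} (nx ny T : nat).
Variables (A : nat -> 'M[R]_nx) (C : nat -> 'M[R]_(ny, nx)).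
Variables (Q : nat -> 'M[R]_nx) (Rn : nat -> 'M[R]_ny).
Hypotheses (hQ : forall k, (k <= T)%N -> psd (Q k)) (hR : forall k, (k <= T)%N -> psd (Rn k)).
Local Notation Nm := (Nm nx ny T).
Local Notation Sm := (Sm T Q Rn).
Local Notation SX := (SX T A Q Rn).
Local Notation feasible := (feasible (T := T) A C Q Rn).

Lemma psd_SX : psd SX.
Proof. exact/psd_congr/psd_Sm. Qed.

(** The feasible set is nonempty: this is the cross-covariance of an estimator uncorrelated with the
    model. *)
Lemma feasible0 : feasible 0.
Proof.
have pS := psd_Sm hQ hR; have pX := psd_SX; split; last by move=> k u _ _; rewrite mulmx0 mul0mx.
split; first by rewrite tr_block_mx !trmxK !trmx0 pX.1 pS.1.
move=> u; rewrite -(vsubmxK u) block_quad.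
have -> : ((usubmx u)^T *m (0 : 'M[R]_(T.+1 * nx, Nm)) *m dsubmx u) 0 0 = 0.
  by rewrite mulmx0 mul0mx mxE.
by rewrite mulr0 addr0 addr_ge0// ?pX.2 ?pS.2.
Qed.

Lemma feasible_bounded M a b : feasible M -> `|M a b| <= \tr SX + \tr Sm.
Proof. by move=> [pM _]; apply: psd_block_bounded pM; [exact: psd_SX|exact: psd_Sm]. Qed.

Lemma ex_optimal_feasible (alpha : nat -> R) : exists M, feasible M /\
  forall M', feasible M' -> gain A alpha M' <= gain A alpha M.
Proof.
(* Matrices are flattened to row vectors, for which compactness of boxes and the extreme value
   theorem are stated. *)
pose F : set 'rV[R]_((T.+1 * nx) * Nm) := [set v | feasible (vec_mx v)].
pose b := \tr SX + \tr Sm.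
have Fb : F `<=` [set v | forall i, `[- b, b]%classic (v ord0 i)].
  move=> v Fv i; case/mxvec_indexP: i => a c.
  have := feasible_bounded a c Fv; rewrite ler_norml mxE/= in_itv/=.
  exact.
have closed_ge0 (f : 'rV[R]_((T.+1 * nx) * Nm) -> R) : continuous f -> closed [set v | 0 <= f v].
  move=> cf; rewrite (_ : [set v | _] = f @^-1` [set t | 0 <= t])//.
  by apply: preimage_closed; [move=> v _; exact: cf|exact: closed_ge].
have closed_eq0 (f : 'rV[R]_((T.+1 * nx) * Nm) -> R) : continuous f -> closed [set v | f v = 0].
  move=> cf; rewrite (_ : [set v | _] = f @^-1` [set t | t = 0])//.
  by apply: preimage_closed; [move=> v _; exact: cf|exact: closed_eq].
have cF : closed F.
  pose F1 (u : 'cV[R]_(T.+1 * nx)) (w : 'cV[R]_Nm) := [set v : 'rV[R]_((T.+1 * nx) * Nm) |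
    0 <= (u^T *m SX *m u) 0 0 + 2 * (u^T *m vec_mx v *m w) 0 0 + (w^T *m Sm *m w) 0 0].
  pose F2 k (u : 'rV[R]_Nm) i := [set v : 'rV[R]_((T.+1 * nx) * Nm) |
    (slot T nx k *m vec_mx v *m u^T) i 0 = 0].
  (* One closed inequality per test vector and one closed equation per causal functional and
     coordinate. *)
  have -> : F = (\bigcap_(z in setT) F1 z.1 z.2) `&`
      \bigcap_(z in [set z : nat * 'rV[R]_Nm | (z.1 <= T)%N /\ causal_upto A C Q Rn z.1 z.2])
        \bigcap_(i in setT) F2 z.1 z.2 i.
    apply/seteqP; split => v /=.
      move=> [[_ pv] cv]; split.
        by move=> [u w] _ /=; have := pv (col_mx u w); rewrite block_quad.
      by move=> [k u] /= [kT cu] i _; rewrite /F2/= (cv k u kT cu) mxE.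
    move=> [v1 v2]; split; last first.
      move=> k u kT cu; apply/matrixP => i j; rewrite ord1 [RHS]mxE.
      by have := v2 (k, u) (conj kT cu) i I.
    split; first by rewrite tr_block_mx trmxK psd_SX.1 (psd_Sm hQ hR).1.
    by move=> u; rewrite -(vsubmxK u) block_quad; exact: (v1 (usubmx u, dsubmx u)).
  apply: closedI; apply: closed_bigI.
    move=> [u w] _; apply: closed_ge0; apply: continuous_affine.
    exact: continuous_vec_mx_entry.
  move=> [k u] _; apply: closed_bigI => i _; apply: closed_eq0.
  exact: continuous_vec_mx_entry.
have kF : compact F.
  apply: (subclosed_compact cF _ Fb).
  apply: (@rV_compact _ _ (fun=> `[- b, b]%classic)) => i; exact: segment_compact.
have cg : {within F, continuous (fun v => gain A alpha (vec_mx v))}.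
  apply: continuous_subspaceT; apply: continuous_bigsum => k; apply: continuous_mull.
  by apply: continuous_bigsum => i; exact: continuous_vec_mx_entry.
have [|v] := EVT_max_rV _ kF cg.
  by exists 0; rewrite /F/= linear0; exact: feasible0.
rewrite inE => Fv vmax; exists (vec_mx v); split => // M' FM'.
by have := vmax (mxvec M'); rewrite mxvecK; apply; rewrite inE /F/= mxvecK.
Qed.

End optimal_feasible.

(** * Linear images of a Gaussian vector *)

(** Cramer-Wold carried from initial segments of [nat] to a finite type by enumeration; it will be
    used with pairs of a time and a coordinate. *)
Lemma eq_law_finite (R : realType) d d' (T : measurableType d) (T' : measurableType d')
    (P : probability T R) (P' : probability T' R) (I : finType)
    (X : I -> T -> R) (X' : I -> T' -> R) :
  (forall i, measurable_fun setT (X i)) -> (forall i, measurable_fun setT (X' i)) ->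
  (forall (c : I -> R) B, measurable B ->
    P ((fun w => \sum_i c i * X i w) @^-1` B) = P' ((fun w => \sum_i c i * X' i w) @^-1` B)) ->
  forall B : I -> set R, (forall i, measurable (B i)) ->
  P [set w | forall i, B i (X i w)] = P' [set w | forall i, B i (X' i w)].
Proof.
move=> mX mX' XX B mB.
pose lift S (z : I -> S) (z0 : S) (a : nat) : S :=
  if (insub a : option 'I_#|I|) is Some o then z (enum_val o) else z0.
have liftE S (z : I -> S) z0 i : lift S z z0 (enum_rank i) = z i.
  by rewrite /lift valK enum_rankK.
have mlift d0 (S : measurableType d0) (z : I -> S -> R) a :
    (forall i, measurable_fun setT (z i)) -> measurable_fun setT (lift _ z (cst 0) a).
  by move=> mz; rewrite /lift; case: insub.
have sumE S (z : I -> S -> R) (c : nat -> R) w :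
    \sum_(a < #|I|) c a * lift _ z (cst 0) a w = \sum_i c (enum_rank i) * z i w.
  rewrite (reindex_onto enum_rank enum_val)/=; last by move=> o _; exact: enum_valK.
  by apply: eq_big => [i|i _]; [rewrite enum_rankK eqxx|rewrite liftE].
have setE S (z : I -> S -> R) : [set w | forall i, B i (z i w)] =
    [set w | forall a, (a < #|I|)%N -> lift _ B setT a (lift _ z (cst 0) a w)].
  apply/seteqP; split => w /= h.
    by move=> a; rewrite /lift; case: insub.
  by move=> i; have := h (enum_rank i) (ltn_ord _); rewrite !liftE.
rewrite !setE; apply: eq_law_rectangle.
- by move=> a; exact: mlift.
- by move=> a; exact: mlift.
- move=> c D mD.
  under [X in P (X @^-1` _)]eq_fun do rewrite sumE.
  under [X in P' (X @^-1` _)]eq_fun do rewrite sumE.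
  exact: XX.
by move=> a; rewrite /lift; case: insub.
Qed.

Section gaussian_images.
Context {R : realType} d (T : measurableType d) (P : probability T R).
Variables (N : nat) (xi : T -> 'cV[R]_N) (Sg : 'M[R]_N).
Hypotheses (gxi : gauss_vec P xi 0 Sg) (pSg : psd Sg).

Definition rv n (K : 'M[R]_(n, N)) : T -> 'cV[R]_n := fun w => K *m xi w.

Lemma rvE n (K : 'M[R]_(n, N)) w : rv K w = K *m xi w. Proof. by []. Qed.

Definition rows n (K : 'M[R]_(n, N)) : set 'rV[R]_N := [set u | exists i, u = row i K].

Lemma coord_rv n (K : 'M[R]_(n, N)) i : Defs.coord (rv K) i = lin xi (row i K).
Proof. by apply/funext => w; rewrite /Defs.coord /lin -row_mul [RHS]mxE. Qed.

Lemma coords_rv n (K : 'M[R]_(n, N)) : coords (rv K) = lin xi @` rows K.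
Proof.
apply/seteqP; split => f.
  by move=> [i ->]; exists (row i K); [exists i|rewrite coord_rv].
by move=> [_ [i ->] <-]; exists i; rewrite coord_rv.
Qed.

Lemma perp_rows m n (K : 'M[R]_(m, N)) (K' : 'M[R]_(n, N)) u v :
  perp Sg K K' -> rows K u -> rows K' v -> perp Sg u v.
Proof.
move=> KK [i ->] [j ->]; rewrite !rowE; apply: perpMl; exact: perpMr.
Qed.

Lemma gauss_vec_rv n (K : 'M[R]_(n, N)) : gauss_vec P (rv K) 0 (K *m Sg *m K^T).
Proof.
move=> u; have := gxi (K^T *m u); rewrite !mulmx0 trmx_mul trmxK !mulmxA.
by congr gauss_rv; apply/funext => w; rewrite /rv mulmxA.
Qed.

Lemma covmx_rv n (K : 'M[R]_(n, N)) : covmx P (rv K) = K *m Sg *m K^T.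
Proof.
apply/matrixP => i j; rewrite mxE !coord_rv unlock.
rewrite [X in (_ - X * _)%E](gauss_rv_mean (gauss_rv_lin gxi (row i K))) mul0e sube0.
rewrite -[LHS]/(Ex P (fun w => lin xi (row i K) w * lin xi (row j K) w)).
by rewrite (Ex_linM gxi pSg.1) !rowE trmx_mul trmx_delta -!mulmxA -rowE !mulmxA -colE !mxE.
Qed.

(** Pairwise orthogonality suffices, because each family is then orthogonal to the union of the
    preceding ones. *)
Lemma gauss_mutual_indep (Us : seq (set 'rV[R]_N)) :
  (forall i j u v, (i < j < size Us)%N -> nth set0 Us i u -> nth set0 Us j v -> perp Sg v u) ->
  mutual_indep P [seq sigma_of (lin xi @` U) | U <- Us].
Proof.
move=> UU A; rewrite size_map => hA.
have {}hA i : (i < size Us)%N -> sigma_of (lin xi @` nth set0 Us i) (A i).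
  by move=> iU; have := hA i iU; rewrite (nth_map set0).
suff h m : (m <= size Us)%N ->
    P (\big[setI/setT]_(i < m) A i) = (\prod_(i < m) P (A i))%E by exact: h.
elim: m => [|m IH] mU; first by rewrite !big_ord0; exact: probability_setT.
rewrite !big_ord_recr/= -IH ?(ltnW mU)//.
pose V := [set u | exists i, (i < m)%N /\ nth set0 Us i u].
apply: (@gauss_indep2 _ _ _ P _ _ _ gxi pSg.1 V (nth set0 Us m)).
- move=> u v [i [im Uu]] Uv; apply: (perpC pSg); apply: UU Uu Uv.
  by rewrite im.
- apply: (big_ind (sigma_of (lin xi @` V))); [exact: sigma_of_setT|by move=> *; exact: sigma_of_setI|].
  move=> i _; apply: sigma_ofS (hA i (ltn_trans (ltn_ord i) mU)); apply: image_subset => u Uu.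
  by exists i.
exact: hA.
Qed.

Lemma gauss_eq_law (I : finType) (u u' : I -> 'rV[R]_N) (B : I -> set R) :
  (forall i j, u i *m Sg *m (u j)^T = u' i *m Sg *m (u' j)^T) ->
  (forall i, measurable (B i)) ->
  P [set w | forall i, B i (lin xi (u i) w)] = P [set w | forall i, B i (lin xi (u' i) w)].
Proof.
move=> uu mB; apply: eq_law_finite => // [i|i|c D mD]; try exact: measurable_lin gxi _.
have sumE (z : I -> 'rV[R]_N) : (fun w => \sum_i c i * lin xi (z i) w) = lin xi (\sum_i c i *: z i).
  apply/funext => w; rewrite /lin mulmx_suml summxE; apply: eq_bigr => i _.
  by rewrite -scalemxAl [RHS]mxE.
rewrite !sumE.
have [_ _ h] := gauss_rv_lin gxi (\sum_i c i *: u i).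
have [_ _ h'] := gauss_rv_lin gxi (\sum_i c i *: u' i).
apply: etrans (h _ mD) _; apply: etrans _ (esym (h' _ mD)).
suff -> : (\sum_i c i *: u i) *m Sg *m (\sum_i c i *: u i)^T =
   (\sum_i c i *: u' i) *m Sg *m (\sum_i c i *: u' i)^T by [].
rewrite !linear_sum/= !mulmx_suml; apply: eq_bigr => i _.
rewrite !mulmx_suml; apply: eq_bigr => j _.
have trZ a (z : 'rV[R]_N) : (a *: z)^T = a *: z^T by apply/matrixP => k l; rewrite !mxE.
by rewrite !trZ -!scalemxAl -!scalemxAr uu.
Qed.

(** In the Gaussian case orthogonal projection is conditional expectation: [u - v] is uncorrelated
    with [V], hence independent of it, and being centred it integrates to 0 over every event of
    [V]. *)
Lemma gauss_cexp (V : set 'rV[R]_N) u v :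
  (forall B, measurable B -> sigma_of (lin xi @` V) (lin xi v @^-1` B)) ->
  (forall z, V z -> perp Sg (u - v) z) ->
  cexp_version P (sigma_of (lin xi @` V)) (lin xi u) (lin xi v).
Proof.
move=> sv uv.
have iu z : P.-integrable setT (EFin \o lin xi z) by exact: sqint_integrable (sqint_lin gxi z).
split => // D sD.
have mlin W f : (lin xi @` W) f -> measurable_fun setT f.
  by move=> [z _ <-]; exact: measurable_lin gxi _.
have mD := sigma_of_measurable (@mlin V) sD.
have ind : indep2 P (sigma_of (lin xi @` [set u - v])) (sigma_of (lin xi @` V)).
  by apply: (gauss_indep2 gxi pSg.1) => _ z -> Vz; exact: uv.
have zero : (\int[P]_(w in D) (lin xi (u - v) w)%:E = 0)%E.
  have -> : (\int[P]_(w in D) (lin xi (u - v) w)%:E = \int[P]_w (lin xi (u - v) w * \1_D w)%:E)%E.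
    rewrite integral_mkcond; apply: eq_integral => w _.
    by rewrite patchE indicE; case: (w \in D); rewrite /= ?mulr1 ?mulr0.
  rewrite integral_mul_indep//.
  - by rewrite (gauss_rv_mean (gauss_rv_lin gxi (u - v))) mul0e.
  - exact/integrable_indic.
  - apply: le_integrable (iu (u - v)) => //.
      apply/measurable_EFinP; apply: measurable_funM => //; exact: measurable_lin gxi _.
    move=> w _ /=; rewrite lee_fin normrM indicE.
    by case: (w \in D); rewrite ?normr1 ?normr0 ?mulr1 ?mulr0.
  move=> B E mB mE; apply: ind; first by apply: sigma_of_preimage => //; exists (u - v).
  move: E mE; apply/sigma_of_measurable_fun; exact: measurable_indic.
have -> : (\int[P]_(w in D) (lin xi u w)%:E =
   \int[P]_(w in D) ((lin xi v w)%:E + (lin xi (u - v) w)%:E))%E.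
  apply: eq_integral => w _; rewrite -EFinD; congr EFin.
  by rewrite /lin mulmxBl [X in _ + X]mxE [X in _ + (_ + X)]mxE addrC subrK.
rewrite integralD//; first by rewrite zero adde0.
  by apply: integrableS (iu v).
by apply: integrableS (iu (u - v)).
Qed.

End gaussian_images.

(** * The optimal estimator *)

Section constructed_estimator.
Context {R : realType} d (Om : measurableType d) (P : probability Om R).
Variables (nx ny T : nat) (A : nat -> 'M[R]_nx) (C : nat -> 'M[R]_(ny, nx)).
Variables (Q : nat -> 'M[R]_nx) (Rn : nat -> 'M[R]_ny).
Hypotheses (hQ : forall k, (k <= T)%N -> psd (Q k)) (hR : forall k, (k <= T)%N -> psd (Rn k)).
Local Notation Nm := (Nm nx ny T).
Local Notation Sm := (Sm T Q Rn).
Local Notation xm := (xm (nx := nx) ny T A).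
Local Notation ym := (ym (nx := nx) (ny := ny) T A C).
Local Notation qm := (qm nx ny T).
Local Notation rm := (rm nx ny T).

Variables (N : nat) (Sg : 'M[R]_N) (L : 'M[R]_(Nm, N)) (H : nat -> 'M[R]_(nx, N)).
Hypothesis pSg : psd Sg.
Hypothesis SgL : L *m Sg *m L^T = Sm.
Hypothesis SgH : forall j k, (j <= T)%N -> (k <= T)%N ->
  H j *m Sg *m (H k)^T = xm j *m Sm *m (xm k)^T.
Hypothesis SgHL : forall k (u : 'rV[R]_Nm), (k <= T)%N ->
  causal_upto A C Q Rn k u -> perp Sg (H k) (u *m L).
Variable xi : Om -> 'cV[R]_N.
Hypothesis gxi : gauss_vec P xi 0 Sg.

Local Notation Xm := (Xm (ny := ny) A L).
Local Notation Ym := (Ym A C L).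
Local Notation xpm := (xpm A C Sg L).
Local Notation innovm := (innovm A C Sg L).
Local Notation Jm := (Jm A H).
Local Notation Ecm := (Ecm A C Sg L H).
Local Notation upsm := (upsm A C Sg L H).
Local Notation picoef := (picoef A C Sg L H).
Local Notation phicoef := (phicoef A C Sg L H).
Local Notation wm := (wm A C Sg L H).
Local Notation rv := (rv xi).

Lemma innov_rv k : innov C (fun k => rv (Ym k)) (fun k => rv (xpm k)) k = rv (innovm k).
Proof.
case: k => [|k]; apply/funext => w //.
by rewrite /innov /innovm ?rvE mulmxBl mulmxA.
Qed.

Lemma stackp_innov_rv k : stackp (innov C (fun k => rv (Ym k)) (fun k => rv (xpm k))) k =
  rv (stackm k innovm).
Proof.
apply/funext => w; rewrite ?rvE -stackp_lin; apply: eq_stackp => j _.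
by rewrite innov_rv.
Qed.

Lemma ups_rv k : ups (innov C (fun k => rv (Ym k)) (fun k => rv (xpm k)))
  (fun k => rv (Ecm k)) k = rv (upsm k).
Proof. by apply/funext => w; rewrite /ups stackp_innov_rv /upsm ?rvE mulmxBl. Qed.

Lemma Jm_rv k w :
  rv (Jm k) w = picoef k *m rv (innovm k) w + phicoef k *m rv (upsm k) w + rv (wm k) w.
Proof.
have -> : Jm k = picoef k *m innovm k + phicoef k *m upsm k + wm k.
  by rewrite addrC /wm -(addrA (Jm k)) -opprD subrK.
by rewrite !rvE mulmxDl mulmxDl -!mulmxA.
Qed.

Lemma lgss_rv : lgss_model P T A C Q Rn (fun k => rv (Xm k)) (fun k => rv (Ym k)).
Proof.
have pS := psd_Sm hQ hR.
exists (fun k => rv (qm k *m L)), (fun k => rv (rm k *m L)); split.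
- by [].
- move=> [//|k] _ w; rewrite /= ?rvE /Xm /=.
  by rewrite !mulmxDl !mulmxA.
- by move=> k _ w; rewrite ?rvE /Ym /ym /Xm !mulmxDl !mulmxA.
- move=> k kT; have cov n (K K' : 'M[R]_(n, Nm)) :
      K *m L *m Sg *m (K' *m L)^T = K *m Sm *m K'^T.
    by rewrite trmx_mul -SgL !mulmxA.
  have := gauss_vec_rv gxi (qm k *m L); have := gauss_vec_rv gxi (rm k *m L).
  rewrite !cov (qm_cov _ _ kT kT) (rm_cov _ _ kT kT) !eqxx => gr gq.
  by split; [exact: gq|exact: gr].
pose Us := [seq rows (qm k *m L) | k <- iota 0 T.+1] ++ [seq rows (rm k *m L) | k <- iota 0 T.+1].
have -> : [seq sigma_of (coords (rv (qm k *m L))) | k <- iota 0 T.+1] ++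
  [seq sigma_of (coords (rv (rm k *m L))) | k <- iota 0 T.+1] =
  [seq sigma_of (lin xi @` U) | U <- Us].
  rewrite map_cat -!map_comp; congr (_ ++ _); apply: eq_map => k /=;
  by rewrite coords_rv.
apply: (gauss_mutual_indep gxi pSg) => i j u v.
rewrite size_cat !size_map size_iota => /andP[ij jT].
have nthE k : (k < T.+1 + T.+1)%N -> nth set0 Us k =
    if (k < T.+1)%N then rows (qm k *m L) else rows (rm (k - T.+1)%N *m L).
  move=> kT; rewrite nth_cat size_map size_iota; case: ifPn => [kT1|].
    by rewrite (nth_map 0%N) ?size_iota// nth_iota.
  by rewrite -leqNgt => Tk; rewrite (nth_map 0%N) ?size_iota ?nth_iota ?ltn_subLR.
rewrite !nthE//; last exact: ltn_trans jT.
have rq a b : perp Sg (rm a *m L) (qm b *m L) by apply/(perpL SgL); exact: rm_qm.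
case: ifPn => [iT1|iT1]; case: ifPn => [jT1|jT1] iu jv; apply: (perp_rows pSg _ jv iu).
- by apply/(perpL SgL); rewrite /perp qm_cov// gtn_eqF.
- exact: rq.
- by case/negP: iT1; exact: ltn_trans jT1.
- apply/(perpL SgL); rewrite /perp rm_cov; [|lia|lia].
  by rewrite gtn_eqF//; lia.
Qed.

Let mv : model_vars T (fun k => rv (Xm k)) (fun k => rv (Ym k)) =
  lin xi @` [set u | exists j, (j <= T)%N /\ (rows (Xm j) u \/ rows (Ym j) u)].
Proof.
apply/seteqP; split => f.
  move=> [j [jT]]; rewrite !coords_rv => -[[u ju <-]|[u ju <-]].
    by exists u => //; exists j; split => //; left.
  by exists u => //; exists j; split => //; right.
move=> [u [j [jT [ju|ju]]] <-]; exists j; split => //; rewrite !coords_rv.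
  by left; exists u.
by right; exists u.
Qed.

Let mlin (U : set 'rV[R]_N) f : (lin xi @` U) f -> measurable_fun setT f.
Proof. by move=> [u _ <-]; exact: measurable_lin gxi _. Qed.

Lemma same_law_rv : same_joint_law P T (fun k => rv (Xm k)) (fun k => rv (H k)).
Proof.
move=> B mB.
have E (K : nat -> 'M[R]_(nx, N)) :
    [set w | forall j i, (j <= T)%N -> B j i (rv (K j) w i 0)] =
    [set w | forall a : 'I_T.+1 * 'I_nx, B a.1 a.2 (lin xi (row a.2 (K a.1)) w)].
  apply/seteqP; split => w /= h.
    by move=> [j i] /=; rewrite -coord_rv; apply: h; rewrite -ltnS.
  by move=> j i jT; have := h (Ordinal (jT : (j < T.+1)%N), i); rewrite /= -coord_rv.
rewrite !E; apply: (gauss_eq_law gxi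
  (u := fun a : 'I_T.+1 * 'I_nx => row a.2 (H a.1)) (u' := fun a => row a.2 (Xm a.1))
  (B := fun a => B a.1 a.2)); last by move=> a; exact: mB.
move=> [j i] [k l] /=; rewrite !rowE !trmx_mul !mulmxA.
have jT : (j <= T)%N := ltn_ord j; have kT : (k <= T)%N := ltn_ord k.
have h := SgH jT kT; rewrite -SgL in h.
transitivity ((delta_mx 0 i : 'rV[R]_nx) *m (H j *m Sg *m (H k)^T) *m (delta_mx 0 l : 'rV[R]_nx)^T).
  by rewrite !mulmxA.
by rewrite h !mulmxA.
Qed.

Lemma admissible_rv :
  admissible P T (fun k => rv (Xm k)) (fun k => rv (Ym k)) (fun k => rv (H k)).
Proof.
split.
- by move=> k kT i; rewrite coord_rv; exact: measurable_lin gxi _.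
- move=> k kT.
  (* The independent information adjoined to the past at time [k] is what y_0..y_k do not reveal of
     the model. By [causal_resid] it completes the past to the whole model. *)
  pose U : set 'rV[R]_N := [set v | exists u, causal_upto A C Q Rn k u /\ v = u *m L].
  set S1 := [set f | _].
  have S1E : S1 = lin xi @` [set u | exists j, ((j <= k)%N /\ rows (Ym j) u)
                                     \/ ((j < k)%N /\ rows (H j) u)].
    apply/seteqP; split => f.
      by move=> [j []]; rewrite !coords_rv => -[jk [u ju <-]]; exists u => //;
        exists j; [left|right].
    by move=> [u [j [[jk ju]|[jk ju]]] <-]; exists j; rewrite !coords_rv;
      [left|right]; split => //; exists u.
  apply: (@cond_indep_intro _ _ _ P S1 (coords (rv (H k))) (lin xi @` U)).
  + by rewrite S1E; exact: mlin.
  + by rewrite coords_rv; exact: mlin.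
  + exact: mlin.
  + rewrite S1E coords_rv -image_setU; apply: (gauss_indep2 gxi pSg.1).
    move=> _ v [u [cu ->]] /= vV.
    have uY j : (j <= k)%N -> perp Sg (u *m L) (Ym j).
      by move=> jk; apply/(perpL SgL); exact: cu.
    have uH j : (j <= k)%N -> perp Sg (u *m L) (H j).
      move=> jk; apply: (perpC pSg); apply: SgHL; first exact: leq_trans kT.
      by move=> i ij; apply: cu; exact: leq_trans jk.
    have rK n (K : 'M[R]_(n, N)) : rows K v -> perp Sg (u *m L) K -> perp Sg (u *m L) v.
      by move=> [i ->] uK; rewrite rowE; exact: perpMr.
    move: vV => [[j [[jk jv]|[jk jv]]]|kv].
    * exact: rK jv (uY j jk).
    * exact: rK jv (uH j (ltnW jk)).
    * exact: rK kv (uH k (leqnn k)).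
  move=> f B; rewrite mv => -[y [j [jT ju]] <-] mB.
  have [u ->] : exists u, y = u *m L.
    by case: ju => -[i ->]; [exists (row i (xm j))|exists (row i (ym j))]; rewrite -row_mul.
  have [K [e [ce ->]]] := causal_resid A C pSg SgL k u.
  have vY : vmeas (S1 `|` lin xi @` U) (stackp (fun k => rv (Ym k)) k.+1).
    apply: vmeas_stackp => i ik; apply: vmeas_coords => g gi.
    by left; exists i; left.
  have ve : vmeas (S1 `|` lin xi @` U) (rv (e *m L)).
    apply: vmeas_coords => g [i ->]; right; rewrite coord_rv; exists (row i (e *m L)) => //.
    by exists e; split => //; apply/rowP => a; rewrite mxE ord1.
  have := vmeasD (vmeasM K vY) ve.
  move=> /(_ 0 B mB); set z := Defs.coord _ 0.
  suff -> : lin xi (K *m stackm k.+1 Ym + e *m L) = z by [].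
  apply/funext => w; rewrite /z /Defs.coord /lin mulmxDl -mulmxA; congr ((K *m _ + _) _ _).
  by rewrite -stackp_lin.
exact: same_law_rv.
Qed.

Lemma cexp_xp k : cexp_vec P
  (sigma_of [set f | exists j, (j < k)%N /\ coords (rv (Ym j)) f]) (rv (Xm k)) (rv (xpm k)).
Proof.
move=> i; rewrite !coord_rv.
have -> : [set f | exists j, (j < k)%N /\ coords (rv (Ym j)) f] =
    lin xi @` [set u | exists j, (j < k)%N /\ rows (Ym j) u].
  apply/seteqP; split => f.
    by move=> [j [jk]]; rewrite coords_rv => -[u ju <-]; exists u => //; exists j.
  by move=> [u [j [jk ju]] <-]; exists j; rewrite coords_rv; split => //; exists u.
apply: (gauss_cexp gxi pSg).
  move=> B mB.
  have vY : vmeas (lin xi @` [set u | exists j, (j < k)%N /\ rows (Ym j) u])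
      (stackp (fun k => rv (Ym k)) k).
    apply: vmeas_stackp => j jk; apply: vmeas_coords => g; rewrite coords_rv => -[u ju <-].
    by exists u => //; exists j.
  have := vmeasM (pcoef Sg (stackm k Ym) (Xm k)) vY i mB.
  set z := Defs.coord _ i; suff -> : lin xi (row i (xpm k)) = z by [].
  rewrite -coord_rv; apply/funext => w.
  by rewrite /z /Defs.coord rvE /xpm -mulmxA -stackp_lin.
move=> z [j [jk [l ->]]]; rewrite -raddfB/= !rowE; apply: perpMl; apply: (perpMr pSg).
exact: xpm_perp.
Qed.

Lemma cexp_Ec k : cexp_vec P
  (sigma_of [set f | exists j, (j < k)%N /\ coords (rv (H j)) f])
  (rv (stackm k innovm)) (rv (Ecm k)).
Proof.
move=> i; rewrite !coord_rv.
have -> : [set f | exists j, (j < k)%N /\ coords (rv (H j)) f] =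
    lin xi @` [set u | exists j, (j < k)%N /\ rows (H j) u].
  apply/seteqP; split => f.
    by move=> [j [jk]]; rewrite coords_rv => -[u ju <-]; exists u => //; exists j.
  by move=> [u [j [jk ju]] <-]; exists j; rewrite coords_rv; split => //; exists u.
apply: (gauss_cexp gxi pSg).
  move=> B mB.
  have vY : vmeas (lin xi @` [set u | exists j, (j < k)%N /\ rows (H j) u])
      (stackp (fun k => rv (H k)) k).
    apply: vmeas_stackp => j jk; apply: vmeas_coords => g; rewrite coords_rv => -[u ju <-].
    by exists u => //; exists j.
  have := vmeasM (pcoef Sg (stackm k H) (stackm k innovm)) vY i mB.
  set z := Defs.coord _ i; suff -> : lin xi (row i (Ecm k)) = z by [].
  rewrite -coord_rv; apply/funext => w.
  by rewrite /z /Defs.coord rvE /Ecm -mulmxA -stackp_lin.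
move=> z [j [jk [l ->]]]; rewrite -raddfB/= !rowE; apply: perpMl; apply: (perpMr pSg).
exact: upsm_perp_H.
Qed.

Lemma noise_cov k : (k <= T)%N ->
  Q k - picoef k *m covmx P (rv (innovm k)) *m (picoef k)^T
      - phicoef k *m covmx P (rv (upsm k)) *m (phicoef k)^T = wm k *m Sg *m (wm k)^T.
Proof. by move=> kT; rewrite !(covmx_rv gxi pSg) (wm_cov hQ hR). Qed.

Lemma noise_indep : mutual_indep P
  (sigma_of (model_vars T (fun k => rv (Xm k)) (fun k => rv (Ym k)))
     :: [seq sigma_of (coords (rv (wm k))) | k <- iota 0 T.+1]).
Proof.
pose U0 := [set u | exists j, (j <= T)%N /\ (rows (Xm j) u \/ rows (Ym j) u)].
have -> : sigma_of (model_vars T (fun k => rv (Xm k)) (fun k => rv (Ym k)))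
     :: [seq sigma_of (coords (rv (wm k))) | k <- iota 0 T.+1] =
   [seq sigma_of (lin xi @` U) | U <- U0 :: [seq rows (wm k) | k <- iota 0 T.+1]].
  rewrite map_cons mv -map_comp; congr (_ :: _); apply: eq_map => k; rewrite /comp.
  by rewrite coords_rv.
set W := [seq rows (wm k) | k <- iota 0 T.+1].
have sW : size W = T.+1 by rewrite size_map size_iota.
have nthW k : (k <= T)%N -> nth set0 W k = rows (wm k).
  by move=> kT; rewrite (nth_map 0%N) ?size_iota// nth_iota.
apply: (gauss_mutual_indep gxi pSg) => i j u v.
move: W sW nthW => W sW nthW; rewrite /= sW.
case: j => [|j]; first by rewrite ltn0.
rewrite !ltnS => /andP[ij jT]; rewrite /= nthW//.
case: i ij => [_|i ij].
  move=> [l [lT lu]] jv.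
  have [u' ->] : exists u', u = u' *m L.
    by case: lu => -[a ->]; [exists (row a (xm l))|exists (row a (ym l))]; rewrite -row_mul.
  by case: jv => a ->; rewrite rowE; apply: perpMl; apply: (wm_perp_modelM hQ hR).
have iT : (i <= T)%N := leq_trans (ltnW ij) jT.
rewrite /= nthW// => iu jv.
apply: (perp_rows pSg _ jv iu); apply: (wm_perp_wm hQ hR) => //.
by rewrite ij.
Qed.

Lemma jointly_gauss_lin (U : set 'rV[R]_N) : jointly_gauss P (lin xi @` U).
Proof.
move=> fs cs fsU.
have [u uP] : exists u : nat -> 'rV[R]_N, forall i, (i < size fs)%N ->
    nth (fun _ => 0) fs i = lin xi (u i).
  suff /boolp.choice[u uP] : forall i, exists u, (i < size fs)%N -> nth (fun _ => 0) fs i = lin xi u.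
    by exists u.
  move=> i; have [ifs|_] := boolP (i < size fs)%N; last by exists 0.
  by have [u _ <-] := fsU _ (mem_nth (fun _ => 0) ifs); exists u.
pose v := \sum_(i < size fs) cs`_i *: u i.
exists 0, ((v *m Sg *m v^T) 0 0).
have := gauss_rv_lin gxi v.
congr gauss_rv; apply/funext => w; rewrite -(linE _ _ (fun i => cs`_i)); apply: eq_bigr => i _.
by rewrite uP.
Qed.

Lemma jointly_gauss_rv : jointly_gauss P
  [set f | exists j, (j <= T)%N /\ (coords (rv (Ym j)) f \/ coords (rv (Jm j)) f)].
Proof.
move=> fs cs h; apply: (@jointly_gauss_lin setT) => f /h [j [_]].
by rewrite !coords_rv => -[[u _ <-]|[u _ <-]]; exists u.
Qed.

Lemma cost_rv alpha : cost P T alpha (fun k => rv (Xm k)) (fun k => rv (H k)) =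
  (2 * (signal_energy A alpha Sm - gain A alpha (stackm T.+1 H *m Sg *m L^T)))%:E.
Proof.
have gL : gauss_vec P (rv L) 0 Sm by rewrite -SgL; exact: gauss_vec_rv.
have xE k : (k <= T)%N -> rv (Xm k) = fun w => xm k *m rv L w.
  by move=> _; apply/funext => w; rewrite !rvE /Xm mulmxA.
rewrite (cost_estimator hQ hR gL xE admissible_rv).
congr (2 * (_ - gain _ _ _))%:E.
rewrite /estimator_crossmx -(crossmx_gauss gxi pSg.1).
rewrite -crossmxM; [|exact: vsqint_gauss gxi|exact: vsqint_gauss gxi].
congr (crossmx P _ _); apply/funext => w; exact: stackp_lin.
Qed.

End constructed_estimator.

Unset Implicit Arguments.
Set Strict Implicit.
Set Printing Implicit Defensive.

Theorem theorem1 (R : realType) (nx ny T : nat)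
  (A : nat -> 'M[R]_nx) (C : nat -> 'M[R]_(ny, nx))
  (Q : nat -> 'M[R]_nx) (Rn : nat -> 'M[R]_ny) (alpha : nat -> R)
  (hQ : forall k, (k <= T)%N -> psd (Q k))
  (hR : forall k, (k <= T)%N -> psd (Rn k))
  (halpha : forall k, (k <= T)%N -> 0 <= alpha k) :
  exists (d : measure_display) (Omega : measurableType d) (P : probability Omega R)
    (x : nat -> Omega -> 'cV[R]_nx) (y : nat -> Omega -> 'cV[R]_ny)
    (xh J w : nat -> Omega -> 'cV[R]_nx)
    (pi : nat -> 'M[R]_(nx, ny)) (phi : forall k, 'M[R]_(nx, k * ny))
    (xp : nat -> Omega -> 'cV[R]_nx) (Ec : forall k, Omega -> 'cV[R]_(k * ny)),
    let I := innov C y xp in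
    let upsilon := ups I Ec in
    let Sw := fun k => Q k - pi k *m covmx P (I k) *m (pi k)^T
                           - phi k *m covmx P (upsilon k) *m (phi k)^T in
    lgss_model P T A C Q Rn x y /\
        admissible P T x y xh /\
        (* structure of the estimator *)
        (forall v, xh 0%N v = J 0%N v) /\
        (forall k, (1 <= k <= T)%N -> forall v, xh k v = A k *m xh k.-1 v + J k v) /\
        (forall k, (k <= T)%N -> forall v,
            J k v = pi k *m I k v + phi k *m upsilon k v + w k v) /\
        (* xp k is E[x_k | y_0..y_{k-1}] and Ec k is E[I_0^{k-1} | xh_0^{k-1}] *)
        (forall k, (1 <= k <= T)%N ->
            cexp_vec P (sigma_of [set f | exists j, (j < k)%N /\ coords (y j) f])
                     (x k) (xp k)) /\
        (forall k, (k <= T)%N ->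
            cexp_vec P (sigma_of [set f | exists j, (j < k)%N /\ coords (xh j) f])
                     (stackp I k) (Ec k)) /\
        (* the noises w_k *)
        (forall k, (k <= T)%N -> psd (Sw k) /\ gauss_vec P (w k) 0 (Sw k)) /\
        mutual_indep P (sigma_of (model_vars T x y)
                        :: [seq sigma_of (coords (w k)) | k <- iota 0 T.+1]) /\
        (* linearity: (Y_0^T, J_0^T) jointly Gaussian *)
        jointly_gauss P [set f | exists j, (j <= T)%N /\ (coords (y j) f \/ coords (J j) f)] /\
        (* optimality among all admissible estimators *)
        forall (d' : measure_display) (Omega' : measurableType d')
          (P' : probability Omega' R)
          (x' : nat -> Omega' -> 'cV[R]_nx) (y' : nat -> Omega' -> 'cV[R]_ny)
          (xh' : nat -> Omega' -> 'cV[R]_nx),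
          lgss_model P' T A C Q Rn x' y' -> admissible P' T x' y' xh' ->
          (cost P T alpha x xh <= cost P' T alpha x' xh')%E.
Proof.
have [M [FM Mmax]] := ex_optimal_feasible A C hQ hR alpha.
have [pM cM] := FM; have pS := psd_Sm hQ hR.
(* Feasibility is exactly what makes this matrix the covariance of a Gaussian vector, the estimates
   stacked over the model noise; [H] and [L] select the two halves. *)
set Sg := block_mx _ _ _ _ in pM.
pose L : 'M[R]_(Nm nx ny T, T.+1 * nx + Nm nx ny T) := row_mx 0 1%:M.
pose H k : 'M[R]_(nx, T.+1 * nx + Nm nx ny T) := row_mx (slot T nx k) 0.
have SgL : L *m Sg *m L^T = Sm T Q Rn.
  rewrite /L /Sg tr_row_mx mul_row_block mul_row_col !trmx0 trmx1.
  by rewrite !mul0mx !mul1mx !add0r mulmx0 add0r mulmx1.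
have SgH j k : (j <= T)%N -> (k <= T)%N ->
    H j *m Sg *m (H k)^T = xm ny T A j *m Sm T Q Rn *m (xm ny T A k)^T.
  move=> jT kT; rewrite /H /Sg tr_row_mx mul_row_block mul_row_col !trmx0.
  by rewrite !mulmx0 !mul0mx !addr0 slot_SX.
have HLE k : H k *m Sg *m L^T = slot T nx k *m M.
  rewrite /H /L /Sg tr_row_mx mul_row_block mul_row_col !trmx0 trmx1.
  by rewrite !mulmx0 !mul0mx !addr0 add0r mulmx1.
have SgHL k (u : 'rV[R]_(Nm nx ny T)) : (k <= T)%N -> causal_upto A C Q Rn k u ->
    perp Sg (H k) (u *m L).
  by move=> kT cu; rewrite /perp trmx_mul mulmxA HLE; exact: cM.
have [d [Om [P [xi gxi]]]] := ex_gauss_vec pM.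
exists d, Om, P, (fun k => rv xi (Xm A L k)), (fun k => rv xi (Ym A C L k)),
  (fun k => rv xi (H k)), (fun k => rv xi (Jm A H k)), (fun k => rv xi (wm A C Sg L H k)),
  (picoef A C Sg L H), (phicoef A C Sg L H),
  (fun k => rv xi (xpm A C Sg L k)), (fun k => rv xi (Ecm A C Sg L H k)).
move=> I upsilon Sw.
have IE k : I k = rv xi (innovm A C Sg L k) by exact: innov_rv.
have uE k : upsilon k = rv xi (upsm A C Sg L H k) by exact: ups_rv.
have SwE k : (k <= T)%N -> Sw k = wm A C Sg L H k *m Sg *m (wm A C Sg L H k)^T.
  by move=> kT; rewrite /Sw IE uE; exact: (noise_cov hQ hR pM SgL SgH SgHL gxi).
split; first exact: (lgss_rv A C hQ hR pM SgL gxi).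
split; first exact: (admissible_rv pM SgL SgH SgHL gxi).
split; first by [].
split; first by move=> [//|k] _ v; rewrite /rv mulmxBl mulmxA addrC subrK.
split.
  by move=> k kT v; rewrite IE uE; exact: Jm_rv.
split; first by move=> k _; exact: (cexp_xp A C L pM gxi).
split.
  by move=> k _; rewrite (stackp_innov_rv A C Sg L xi k); exact: (cexp_Ec A C L H pM gxi).
split.
  move=> k kT; rewrite (SwE k kT); split; first exact: psd_congr.
  exact: gauss_vec_rv.
split; first exact: (noise_indep hQ hR pM SgL SgH SgHL gxi).
split; first exact: (jointly_gauss_rv gxi).
move=> d' Om' P' x' y' xh' lg ad.
(* A competitor on any space has the same signal energy and a feasible cross-covariance, so
   comparing costs amounts to comparing gains in the reverse order. *)
have [xi' [gxi' xE yE]] := lgss_gauss_vec lg.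
rewrite (cost_rv hQ hR pM SgL SgH SgHL gxi) (cost_estimator hQ hR gxi' xE ad).
rewrite lee_fin ler_pM2l// lerD2l lerN2.
have -> : stackm T.+1 H *m Sg *m L^T = M.
  by apply: eq_slots => k kT; rewrite !mulmxA slot_stackm// HLE.
by apply: Mmax; exact: feasible_estimator gxi' xE yE ad.
Qed.
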